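(* Let $1\le p_1,p_2\le\infty$, $1\le q_1,q_2\le\infty$, $r>0$, $s<0$, and assume $p_1\ne p_2$. Let $$\theta=\frac{r}{r-s},\qquad \frac1p=\frac{1-\theta}{p_1}+\frac{\theta}{p_2},\qquad \frac1q=\frac{1-\theta}{q_1}+\frac{\theta}{q_2}.$$ Then there is a constant $c$, not depending on $f$, such that for every function $f\in S_0(\mathbb{R}^n)\cap\left(L^1(\mathbb{R}^n)+L^\infty(\mathbb{R}^n)\right)$, $$\|f\|_{p,q}\le c\,\|f\|_{\dot B^r_{p_1,q_1}}^{1-\theta}\,\|f\|_{\dot B^s_{p_2,q_2}}^{\theta}.$$
   Context: Conventions: $1/\infty=0$; the inequality is trivial when its right-hand side is infinite. $S_0(\mathbb{R}^n)$ is the class of measurable, almost everywhere finite functions $f$ on $\mathbb{R}^n$ with $\lambda_f(y)=|\{x:|f(x)|>y\}|<\infty$ for every $y>0$. For $f\in S_0(\mathbb{R}^n)$ the non-increasing rearrangement is $f^*(t)=\inf\{y>0:\lambda_f(y)<t\}$, $0<t<\infty$. Lorentz quasinorms: $\|f\|_{p,q}=\left(\int_0^\infty (t^{1/p}f^*(t))^q\,\frac{dt}{t}\right)^{1/q}$ for $0<p,q<\infty$, and $\|f\|_{p,\infty}=\sup_{t>0}t^{1/p}f^*(t)$ for $0<p\le\infty$. Let $p_h(y)=(4\pi h)^{-n/2}e^{-|y|^2/(4h)}$ and $P_hf(x)=\int_{\mathbb{R}^n}p_h(y)f(x-y)\,dy$, $h>0$. For $-\infty<s<\infty$, $0<p,q\le\infty$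 and a non-negative integer $m$ with $2m>s$, the homogeneous Besov quasinorm is $$\|f\|_{\dot B^s_{p,q}}=\left(\int_0^\infty h^{(m-s/2)q}\left\|\frac{\partial^mP_hf}{\partial h^m}\right\|_p^q\frac{dh}{h}\right)^{1/q}$$ (for $q=\infty$: $\sup_{h>0}h^{m-s/2}\|\partial^mP_hf/\partial h^m\|_p$). One integer $m$ with $2m>r$ is fixed and used in both quasinorms in the statement; the constant may depend on $m$, $n$ and the parameters. *)

(* Defs.v *)
From HB Require Import structures.
From mathcomp Require Import all_boot all_order all_algebra.
From mathcomp Require Import all_classical all_reals all_analysis.
From mathcomp Require Import measurable_realfun.

Set Implicit Arguments.
Unset Strict Implicit.
Unset Printing Implicit Defensive.
Import Order.TTheory GRing.Theory Num.Theory.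
Import numFieldNormedType.Exports.
Local Open Scope classical_set_scope.
Local Open Scope ring_scope.

(* Lebesgue measure on the Borel subsets of R^n is built by induction on n, as
   the image of the product measure on R * R^n under the consing bijection. *)
Section borel_lebesgue.
Context (R : realType).
Local Notation mR := (measurableTypeR R).

Definition cons_pair n (z : mR * n.-tuple mR) : n.+1.-tuple mR :=
  [tuple of z.1 :: z.2].

Definition uncons_pair n (t : n.+1.-tuple mR) : mR * n.-tuple mR :=
  (thead t, [tuple of behead t]).

Lemma measurable_cons_pair n : measurable_fun setT (@cons_pair n).
Proof. by apply: measurable_cons; [exact: measurable_fst|exact: measurable_snd]. Qed.

Lemma measurable_uncons_pair n : measurable_fun setT (@uncons_pair n).
Proof.
apply: measurable_fun_pair; first exact: (measurable_tnth ord0).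
exact: measurable_behead.
Qed.

Lemma cons_pairK n : cancel (@cons_pair n) (@uncons_pair n).
Proof. by case=> x t; congr pair; apply: val_inj. Qed.

Section step.
Context (n : nat) (mu : {sigma_finite_measure set (n.-tuple mR) -> \bar R}).

Definition cons_measure : set (n.+1.-tuple mR) -> \bar R :=
  pushforward (lebesgue_measure \x mu)%E (@cons_pair n).

Let cons_measure0 : cons_measure set0 = 0%E.
Proof. by rewrite /cons_measure /pushforward preimage_set0 measure0. Qed.

Let cons_measure_ge0 A : (0 <= cons_measure A)%E.
Proof. by rewrite /cons_measure /pushforward; apply: integral_ge0. Qed.

Let cons_measure_sigma_additive : semi_sigma_additive cons_measure.
Proof.
move=> F mF tF mUF; rewrite /cons_measure /pushforward preimage_bigcup.
have mpre A : measurable A -> measurable (@cons_pair n @^-1` A).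
  by move=> mA; rewrite -[X in measurable X]setTI; exact: measurable_cons_pair.
apply: measure_semi_sigma_additive.
- by move=> k; exact: mpre.
- apply/trivIsetP => /= i j _ _ ij; rewrite -preimage_setI.
  by move/trivIsetP : tF => /(_ _ _ _ _ ij) ->//; rewrite preimage_set0.
- by rewrite -preimage_bigcup; exact: mpre.
Qed.

HB.instance Definition _ := isMeasure.Build _ _ _ cons_measure
  cons_measure0 cons_measure_ge0 cons_measure_sigma_additive.

Let cons_measure_sigma_finite : sigma_finite setT cons_measure.
Proof.
have /sigma_finiteP[F [FT Fnd mF]] := sigma_finiteT (@lebesgue_measure R).
have /sigma_finiteP[G [GT Gnd mG]] := sigma_finiteT mu.
exists (fun k => @uncons_pair n @^-1` (F k `*` G k)).
  rewrite -preimage_bigcup (_ : \bigcup_k _ = setT) ?preimage_setT//.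
  apply/seteqP; split=> // -[x t] _.
  have [i _ Fi] : (\bigcup_k F k) x by rewrite -FT.
  have [j _ Gj] : (\bigcup_k G k) t by rewrite -GT.
  exists (maxn i j) => //; split => /=.
    by have /subsetPset := Fnd _ _ (leq_maxl i j); exact.
  by have /subsetPset := Gnd _ _ (leq_maxr i j); exact.
move=> k; have [mFk Fk] := mF k; have [mGk Gk] := mG k; split.
  rewrite -[X in measurable X]setTI; apply: measurable_uncons_pair => //.
  exact: measurableX.
rewrite /cons_measure /pushforward -comp_preimage.
rewrite (_ : _ \o _ = id); last by apply/funext => z /=; rewrite cons_pairK.
by rewrite preimage_id product_measure1E// lte_mul_pinfty// ge0_fin_numE.
Qed.

HB.instance Definition _ := Measure_isSigmaFinite.Build _ _ _ cons_measure
  cons_measure_sigma_finite.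

End step.

Fixpoint borel_lebesgue n : {sigma_finite_measure set (n.-tuple mR) -> \bar R} :=
  match n with
  | 0 => \d_([tuple] : 0.-tuple mR)
  | n'.+1 => cons_measure (borel_lebesgue n')
  end.

End borel_lebesgue.

(* R^n with its Lebesgue (completed) sigma-algebra and Lebesgue measure. *)
Definition Rn (R : realType) (n : nat) :=
  caratheodory_type ((borel_lebesgue R n)^*)%mu.

HB.instance Definition _ (R : realType) (n : nat) := Measurable.on (Rn R n).

Definition lebesgue_Rn (R : realType) (n : nat) : set (Rn R n) -> \bar R :=
  @completed_measure_extension _ _ _ (borel_lebesgue R n).
Arguments lebesgue_Rn : clear implicits.

HB.instance Definition _ (R : realType) (n : nat) :=
  Measure.on (lebesgue_Rn R n).

Lemma lebesgue_Rn_sigma_finite (R : realType) (n : nat) :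
  sigma_finite setT (lebesgue_Rn R n).
Proof. exact/completed_measure_extension_sigma_finite/sigma_finiteT. Qed.

HB.instance Definition _ (R : realType) (n : nat) :=
  Measure_isSigmaFinite.Build _ _ _ (lebesgue_Rn R n)
    (lebesgue_Rn_sigma_finite R n).

Section lorentz.
Context d (T : measurableType d) (R : realType).
Variable mu : {measure set T -> \bar R}.
Local Open Scope ereal_scope.

Definition distribution_function (f : T -> \bar R) (y : R) : \bar R :=
  mu [set x | y%:E < `|f x|].

Definition class_S0 (f : T -> \bar R) : Prop :=
  [/\ measurable_fun setT f, {ae mu, forall x, f x \is a fin_num} &
      forall y : R, (0 < y)%R -> distribution_function f y < +oo].

Definition class_L1_plus_Loo (f : T -> \bar R) : Prop :=
  exists g1 g2 : T -> R, [/\ g1 \in Lfun mu 1, g2 \in Lfun mu +oo &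
    {ae mu, forall x, f x = (g1 x + g2 x)%:E}].

Definition rearrangement (f : T -> \bar R) (t : R) : \bar R :=
  ereal_inf [set y%:E | y in
    [set y : R | (0 < y)%R /\ distribution_function f y < t%:E]].

(* The exponent 1/p is [fine p^-1], where [+oo^-1 = 0] in [\bar R]; the value
   at [q = -oo] is junk. *)
Definition lorentz_norm (p q : \bar R) (f : T -> \bar R) : \bar R :=
  match q with
  | q%:E => (\int[lebesgue_measure]_(t in `]0%R, +oo[)
      (((t `^ fine p^-1)%:E * rearrangement f t) `^ q * (t^-1)%:E)) `^ q^-1
  | +oo => ereal_sup [set (t `^ fine p^-1)%:E * rearrangement f t |
                        t in `]0%R, +oo[ ]
  | -oo => 0
  end.

End lorentz.

Section besov.
Context (R : realType) (n : nat).
Local Notation mu := (lebesgue_Rn R n).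

Definition subRn (x y : Rn R n) : Rn R n :=
  [tuple (tnth x i - tnth y i)%R | i < n].

Definition sqnormRn (y : Rn R n) : R := \sum_(i < n) tnth y i ^+ 2.

Definition heat_kernel (h : R) (y : Rn R n) : R :=
  (4 * pi * h) `^ (- (n%:R / 2)) * expR (- (sqnormRn y / (4 * h))).

(* For f in L^1 + L^oo and h > 0 the integral is finite, so [fine] loses
   nothing; it makes the m-th derivative in h a derivative of a real function. *)
Definition heat (f : Rn R n -> \bar R) (h : R) (x : Rn R n) : R :=
  fine (\int[mu]_y ((heat_kernel h y)%:E * f (subRn x y))).

Definition heat_derivative (m : nat) (f : Rn R n -> \bar R) (h : R) (x : Rn R n) : R :=
  derive1n m (heat f ^~ x) h.

Local Open Scope ereal_scope.

Definition besov_norm (m : nat) (s : R) (p q : \bar R) (f : Rn R n -> \bar R) :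
    \bar R :=
  match q with
  | q%:E => (\int[lebesgue_measure]_(h in `]0%R, +oo[)
      ((h `^ ((m%:R - s / 2) * q))%:E *
       'N[mu]_p[EFin \o heat_derivative m f h] `^ q * (h^-1)%:E)) `^ q^-1
  | +oo => ereal_sup [set (h `^ (m%:R - s / 2))%:E *
       'N[mu]_p[EFin \o heat_derivative m f h] | h in `]0%R, +oo[ ]
  | -oo => 0
  end.

End besov.

(* Main.v *)
Require Import Defs.
From mathcomp Require Import all_boot all_order all_algebra.
From mathcomp Require Import all_classical all_reals all_analysis.
From mathcomp Require Import measurable_realfun ess_sup_inf.
From mathcomp Require Import ring lra.

(** The level sets of [f] are compared with the time derivatives of its heat flow
[P_h f]. Fix a level [y], let [E] be the set where [|f| > y] and let [phi] be the
sign of [f] on [E], extended by zero. The correlation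
[Phi z = \int f (x - z) phi x dx] is bounded, continuous at the origin and small
in Gaussian mean at large times, and [Phi 0 = \int_E |f| >= y |E|]. Hence
[U h = \int p_h Phi] tends to [Phi 0] as [h -> 0], whereas [U] and all its
derivatives vanish at infinity; integrating [m] times from infinity gives
[y |E| <= \int_0^oo h^(m-1) |U^(m) h| dh] ([chain_limit_le], [level_mass_le]).
By Fubini's theorem [U^(m) h] is the integral over [E] of
[phi . (d/dh)^m P_h f], so Hoelder's inequality bounds it by
[|E|^(1 - 1/p_i) N_i h], where [N_i h] is the [L^(p_i)] norm of the [m]-th time
derivative and [i] is 1 or 2. With [v = |U^(m)| / |E|], every [y] below the
rearrangement at [t] satisfies [y <= \int h^(m-1) v h dh] and
[v h <= t^(-1/p_i) N_i h] ([heat_level_bound]).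

The rest is one-dimensional ([profile_interpolation]). For [t = 2^j] and [h] of
the order of [2^k], the corresponding piece [w_jk] of the integral is at most
[2^(-j/p_1 + k r/2) X C_k^(1/q_1)] and at most [2^(-j/p_2 + k s/2) Y C_k^(1/q_2)],
up to constants, where [X] and [Y] are the two Besov quasinorms and [C] is a
summable sequence common to all [j] ([mean_norm_dyad]). After convolution with a
geometric kernel, [ln C] is Lipschitz with a small constant
([log_lipschitz_majorant]). By the choice of [theta], [p] and [q], both bounds are
[2^(-j/p) X^(1-theta) Y^theta C_k^(1/q)] times [exp (theta z)], respectively
[exp ((theta - 1) z)], where [z = z_jk] is the logarithm of their quotient
([two_bounds_common_factor]); so their minimum decays exponentially in [|z|].
Now [z_jk] is affine in [j] with slope proportional to [1/p_1 - 1/p_2], which is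
where [p_1 <> p_2] enters, and it increases in [k] at a rate comparable to
[r - s > 0]. The sums of the decaying factor over [j] and over [k] are therefore
bounded ([separated_exp_series]), and Schur's test yields
[\sum_j (2^(j/p) y_j)^q <= c (X^(1-theta) Y^theta)^q] for the rearrangement
values [y_j] at [2^j] ([sequence_interpolation]). By monotonicity the left-hand
side is comparable to the Lorentz quasinorm.

The function [f] is measurable for the completed sigma-algebra only, while
Tonelli's theorem and the induction on the dimension live on the Borel one. So [f]
is replaced by a Borel function equal to it off a Borel null set
([borel_version]), which leaves the heat flow unchanged at every point and every
positive time ([heat_borelE]). *)

Set Implicit Arguments.
Unset Strict Implicit.
Unset Printing Implicit Defensive.
Import Order.TTheory GRing.Theory Num.Theory.
Import numFieldNormedType.Exports.
Local Open Scope classical_set_scope.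
Local Open Scope ring_scope.

(** * Series over the integers *)

(** An enumeration of the integers, which turns two-sided series into ordinary
ones. *)
Definition zenum (i : nat) : int := if odd i then Negz i./2 else Posz i./2.

Definition zcode (k : int) : nat :=
  match k with Posz a => a.*2 | Negz a => a.*2.+1 end.

Lemma zcodeK : cancel zcode zenum.
Proof.
by case=> a; rewrite /zenum /= odd_double /= ?doubleK // uphalf_double.
Qed.

Lemma zenumK : cancel zenum zcode.
Proof.
move=> i; rewrite /zenum; case: ifP => oi /=.
  by rewrite -[RHS]odd_double_half oi.
by rewrite -[RHS]odd_double_half oi.
Qed.

Lemma zcode_le (R : realType) (k : int) : (zcode k)%:R <= 2 * `|k%:~R| :> R.
Proof.
case: k => a /=.
  by rewrite -mul2n natrM -pmulrn ger0_norm.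
rewrite NegzE mulrNz normrN -pmulrn ger0_norm// -addn1 -mul2n natrD natrM.
by rewrite -[X in _ <= 2 * X]natr1; lra.
Qed.

Section series.
Context {R : realType}.
Local Open Scope ereal_scope.

Lemma nneseries_inj_le (g : nat -> nat) (a : nat -> \bar R) :
  injective g -> (forall n, 0 <= a n) ->
  \sum_(i <oo) a (g i) <= \sum_(i <oo) a i.
Proof.
move=> gi a0; rewrite !nneseries_esumT//.
rewrite -(@esum_image _ _ _ _ g); last by move=> x y _ _; exact: gi.
rewrite esum_mkcond; apply: le_esum => i _.
by case: ifP.
Qed.

Lemma nneseries_le_bound (u : nat -> \bar R) (M : \bar R) :
  (forall n, 0 <= u n) -> (forall n, \sum_(0 <= i < n) u i <= M) ->
  \sum_(i <oo) u i <= M.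
Proof.
move=> u0 uM; apply: lime_le; last exact: nearW.
by apply: is_cvg_nneseries => n _ _.
Qed.

(** The points [z i / d] fall in pairwise distinct unit intervals, so the series
is dominated by a two-sided geometric one, whatever the order in which the
points are visited. *)
Lemma separated_exp_series (d eta : R) : (0 < d)%R -> (0 < eta)%R ->
  exists2 M : R, (0 < M)%R & forall z : nat -> R,
    (forall i j, i <> j -> (d <= `|z i - z j|)%R) ->
    \sum_(i <oo) (expR (- (eta * `|z i|)))%:E <= M%:E.
Proof.
move=> d0 e0; pose r := expR (- (eta * d / 2)).
have r0 : (0 < r)%R by exact: expR_gt0.
have r1 : (r < 1)%R by rewrite -expR0 ltr_expR oppr_lt0 divr_gt0// mulr_gt0.
pose M := (expR (eta * d) / (1 - r))%R.
have M0 : (0 < M)%R by rewrite divr_gt0 ?expR_gt0// subr_gt0.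
exists M => // z zsep.
pose n i := Num.floor (z i / d).
have ninj : injective n.
  move=> i j nij; apply: contrapT => /zsep; apply/negP; rewrite -ltNge.
  have /andP[i1 i2] := floor_itv (z i / d); have /andP[j1 j2] := floor_itv (z j / d).
  move: i1 i2 j1 j2; rewrite -/(n i) -/(n j) nij intrD.
  rewrite ler_pdivlMr// ltr_pdivrMr// ler_pdivlMr// ltr_pdivrMr// mulrDl mul1r.
  by move=> *; rewrite ltr_norml; lra.
have step i : (expR (- (eta * `|z i|)) <= expR (eta * d) * r ^+ zcode (n i))%R.
  rewrite -expRM_natl -expRD ler_expR.
  have /andP[i1 i2] := floor_itv (z i / d).
  move: i1 i2; rewrite -/(n i) intrD.
  rewrite ler_pdivlMr// ltr_pdivrMr// mulrDl mul1r => i1 i2.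
  have nz : (`|(n i)%:~R| * d <= `|z i| + d)%R.
    rewrite -[X in (_ * X)%R](gtr0_norm d0) -normrM.
    have -> : ((n i)%:~R * d = z i + ((n i)%:~R * d - z i))%R by lra.
    by rewrite (le_trans (ler_normD _ _))// lerD2l ler_norml; lra.
  have /(ler_wpM2r (ltW d0)) := zcode_le R (n i) => nd.
  have : (eta * ((zcode (n i))%:R * d) <= eta * (2 * (`|z i| + d)))%R.
    by rewrite ler_pM2l//; lra.
  by lra.
have rM i : 0 <= (r ^+ i)%:E by rewrite lee_fin exprn_ge0// ltW.
apply: (@le_trans _ _ (\sum_(i <oo) ((expR (eta * d))%:E * (r ^+ zcode (n i))%:E))).
  apply: lee_nneseries => i *; first by rewrite lee_fin expR_ge0.
  by rewrite -EFinM lee_fin step.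
rewrite nneseriesZl// /M EFinM; apply: lee_wpmul2l.
  by rewrite lee_fin expR_ge0.
apply: le_trans.
  apply: (@nneseries_inj_le (zcode \o n) (fun i => (r ^+ i)%:E)) => //.
  by apply: inj_comp => //; exact: can_inj zcodeK.
apply: nneseries_le_bound => // N.
rewrite sumEFin lee_fin.
have := @geometric_le_lim R N 1%R r ler01 r0.
rewrite ger0_norm ?(ltW r0)// => /(_ r1); rewrite mul1r /series /=.
by under eq_bigr do rewrite mul1r.
Qed.

End series.

(** * Interpolation of sequences *)

Section sequences_interpolation.
Context {R : realType}.

Notation "k_( i )" := ((zenum i)%:~R : R) (at level 8, format "k_( i )").

Lemma powR_expR (a x : R) : 0 < a -> a `^ x = expR (x * ln a).
Proof. by move=> a0; rewrite /powR gt_eqF. Qed.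

Lemma zenum_sep (i j : nat) : i <> j -> 1 <= `|k_(i) - k_(j)|.
Proof.
move=> ij; rewrite -intrB -intr_norm -[leLHS]/(1%:~R) ler_int.
rewrite -gtz0_ge1 normr_gt0 subr_eq0; apply/eqP => zij; apply: ij.
by rewrite -(zenumK i) zij zenumK.
Qed.

(** Convolving with a two-sided geometric kernel costs a constant in l^1 and
produces a sequence whose logarithm is Lipschitz. *)
Lemma log_lipschitz_majorant (e : R) : 0 < e ->
  exists2 K : R, 0 < K & forall (c : nat -> R) (A : R),
    (forall i, 0 < c i) -> (\sum_(i <oo) (c i)%:E <= A%:E)%E ->
    exists C : nat -> R, [/\ forall i, 0 < C i, forall i, c i <= C i,
      (\sum_(i <oo) (C i)%:E <= (K * A)%:E)%E &
      forall i l, `|ln (C i) - ln (C l)| <= e * `|k_(i) - k_(l)|].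
Proof.
move=> e0; have [K K0 HK] := @separated_exp_series R 1 e ltr01 e0.
exists K => // c A c0 cA.
pose a i l := expR (- (e * `|k_(i) - k_(l)|)) * c l.
have a0 i l : 0 < a i l by rewrite mulr_gt0 ?expR_gt0.
have ac i l : a i l <= c l.
  rewrite ler_piMl ?(ltW (c0 l))// -expR0 ler_expR oppr_le0.
  by rewrite mulr_ge0// ltW.
have fin i : (\sum_(l <oo) (a i l)%:E)%E \is a fin_num.
  rewrite ge0_fin_numE; last by apply: nneseries_ge0 => *; rewrite lee_fin ltW.
  apply: (@le_lt_trans _ _ A%:E); last exact: ltry.
  apply: le_trans cA; apply: lee_nneseries => *; rewrite lee_fin; first exact: ltW.
  exact: ac.
pose C i := fine (\sum_(l <oo) (a i l)%:E)%E.
have CE i : (C i)%:E = (\sum_(l <oo) (a i l)%:E)%E by rewrite fineK.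
have cC i : c i <= C i.
  rewrite -lee_fin CE; apply: (@le_trans _ _ (a i i)%:E).
    by rewrite /a subrr normr0 mulr0 oppr0 expR0 mul1r.
  have := @nneseries_lim_ge R (fun l => (a i l)%:E) xpredT 0 i.+1.
  move=> /(_ (fun l _ _ => ltac:(by rewrite lee_fin ltW)))/(le_trans _); apply.
  rewrite big_nat_recr//= leeDr// sume_ge0// => l _.
  by rewrite lee_fin ltW.
have C0 i : 0 < C i := lt_le_trans (c0 i) (cC i).
have Clip i l : ln (C i) - ln (C l) <= e * `|k_(i) - k_(l)|.
  rewrite lerBlDr -(expRK (e * _)) -lnM ?posrE ?expR_gt0//.
  rewrite ler_ln ?posrE ?mulr_gt0 ?expR_gt0//.
  rewrite -lee_fin EFinM !CE -nneseriesZl; last by move=> *; rewrite lee_fin ltW.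
  apply: lee_nneseries => [|x _]; first by move=> *; rewrite lee_fin ltW.
  rewrite -EFinM lee_fin /a mulrA ler_pM2r// -expRD ler_expR.
  have := ler_distD k_(i) k_(l) k_(x).
  by rewrite (distrC k_(l) k_(i)) -(ler_pM2l e0) mulrDr; lra.
exists C; split => //.
- under eq_eseriesr do rewrite CE.
  rewrite nneseries_interchange; last by move=> *; rewrite lee_fin ltW.
  apply: (@le_trans _ _ (\sum_(l <oo) (K%:E * (c l)%:E))%E).
    apply: lee_nneseries => [*|l _].
      by apply: nneseries_ge0 => *; rewrite lee_fin ltW.
    under eq_eseriesr do rewrite /a mulrC EFinM.
    rewrite nneseriesZl; last by move=> *; rewrite lee_fin expR_ge0.
    rewrite muleC; apply: lee_wpmul2r; first by rewrite lee_fin ltW.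
    apply: HK => i j ij.
    have -> : k_(i) - k_(l) - (k_(j) - k_(l)) = k_(i) - k_(j) by lra.
    exact: zenum_sep.
  rewrite nneseriesZl; last by move=> *; rewrite lee_fin ltW.
  by rewrite EFinM lee_wpmul2l// lee_fin ltW.
- move=> i l; rewrite ler_norml Clip andbT lerNl opprB.
  by rewrite distrC Clip.
Qed.

Variables (al1 al2 rho sg th : R).
Hypotheses (al12 : al1 != al2) (rho0 : 0 < rho) (sg0 : 0 < sg).
Hypothesis thE : th = rho / (rho + sg).
Local Notation al := ((1 - th) * al1 + th * al2).

(** It decays exponentially on both sides, because [0 < th < 1]. *)
Let phi (z : R) := expR (Num.min (th * z) ((th - 1) * z)).

Let rs0 : 0 < rho + sg. Proof. exact: addr_gt0. Qed.
Let th0 : 0 < th. Proof. by rewrite thE divr_gt0. Qed.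
Let th1 : th < 1. Proof. by rewrite thE ltr_pdivrMr// mul1r ltrDl. Qed.

Let phi_series (d : R) : 0 < d -> exists2 M : R, 0 < M & forall z : nat -> R,
  (forall i j, i <> j -> d <= `|z i - z j|) ->
  (\sum_(i <oo) (phi (z i))%:E <= M%:E)%E.
Proof.
move=> d0; pose eta := Num.min th (1 - th).
have eta0 : 0 < eta by rewrite lt_min th0 subr_gt0.
have [M M0 HM] := separated_exp_series d0 eta0.
exists M => // z zsep; apply: le_trans (HM _ zsep).
apply: lee_nneseries => *; rewrite lee_fin; first exact: expR_ge0.
rewrite ler_expR ge_min.
set x := z _; have [x0|x0] := leP 0 x.
  apply/orP; right; rewrite ger0_norm//.
  have : eta * x <= (1 - th) * x by rewrite ler_wpM2r// ge_min lexx orbT.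
  by lra.
apply/orP; left; rewrite ltr0_norm//.
have : eta * - x <= th * - x by rewrite ler_wpM2r ?oppr_ge0 ?(ltW x0)// ge_min lexx.
by lra.
Qed.

(** The logarithm of the quotient of the two bounds on the entry [(j, k)]. *)
Definition log_ratio (X Y be1 be2 : R) (C : nat -> R) (j k : nat) : R :=
  ln X - ln Y - k_(j) * (al1 - al2) * ln 2 + k_(k) * (rho + sg) * ln 2
  + (be1 - be2) * ln (C k).

Section core.
Variables (X Y be1 be2 : R) (C : nat -> R).
Hypotheses (X0 : 0 < X) (Y0 : 0 < Y) (C0 : forall i, 0 < C i).
Local Notation be := ((1 - th) * be1 + th * be2).
Let ln20 : 0 < ln (2 : R). Proof. by rewrite ln_gt0// ltr1n. Qed.

Local Notation z := (log_ratio X Y be1 be2 C).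

(** Both bounds on an entry are the same quantity times the two branches of
[phi]: the exponents are chosen so that everything but [z] is common. *)
Lemma two_bounds_common_factor (v : R) j k :
  v <= 2 `^ (- al1 * k_(j) + rho * k_(k)) * X * C k `^ be1 ->
  v <= 2 `^ (- al2 * k_(j) - sg * k_(k)) * Y * C k `^ be2 ->
  v <= 2 `^ (- al * k_(j)) * (X `^ (1 - th) * Y `^ th) * (C k `^ be * phi (z j k)).
Proof.
have thrs : th * (rho + sg) = rho by rewrite thE divfK// gt_eqF.
have -> : 2 `^ (- al1 * k_(j) + rho * k_(k)) * X * C k `^ be1 =
   2 `^ (- al * k_(j)) * (X `^ (1 - th) * Y `^ th) *
     (C k `^ be * expR (th * z j k)).
  rewrite -{1}(lnK X0) !powR_expR// -!expRD; congr expR.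
  rewrite -[in LHS]thrs; unfold log_ratio; ring.
have -> : 2 `^ (- al2 * k_(j) - sg * k_(k)) * Y * C k `^ be2 =
   2 `^ (- al * k_(j)) * (X `^ (1 - th) * Y `^ th) *
     (C k `^ be * expR ((th - 1) * z j k)).
  have sgE : sg = (1 - th) * (rho + sg) by rewrite mulrBl thrs; ring.
  rewrite -{1}(lnK Y0) !powR_expR// -!expRD; congr expR.
  rewrite [in LHS]sgE; unfold log_ratio; ring.
by move=> v1 v2; rewrite /phi; case: (leP (th * _)).
Qed.

(** The step in [j] is constant, and it is nonzero because [al1 != al2]. *)
Lemma separated_in_row k i j : i <> j ->
  `|al1 - al2| * ln 2 <= `|z i k - z j k|.
Proof.
move=> ij; have -> : z i k - z j k = - ((k_(i) - k_(j)) * ((al1 - al2) * ln 2)).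
  by unfold log_ratio; ring.
rewrite normrN !normrM (gtr0_norm ln20).
by rewrite ler_peMl ?zenum_sep// mulr_ge0// ltW.
Qed.

(** The slope in [k] is [(rho + sg) ln 2]; the Lipschitz constant of [ln C] is half
of it, so the perturbation coming from [C] does not destroy the separation. *)
Lemma separated_in_column j k l : 0 <= be1 <= 1 -> 0 <= be2 <= 1 ->
  (forall i l, `|ln (C i) - ln (C l)| <= (rho + sg) * ln 2 / 2 * `|k_(i) - k_(l)|) ->
  k <> l -> (rho + sg) * ln 2 / 2 <= `|z j k - z j l|.
Proof.
move=> be1b be2b Clip kl; set e := (rho + sg) * ln 2 / 2.
have e0 : 0 < e by rewrite divr_gt0// mulr_gt0.
have -> : z j k - z j l =
    2 * e * (k_(k) - k_(l)) + (be1 - be2) * (ln (C k) - ln (C l)).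
  by rewrite /e; unfold log_ratio; field.
have s1 := zenum_sep kl.
have h1 : `|(be1 - be2) * (ln (C k) - ln (C l))| <= e * `|k_(k) - k_(l)|.
  rewrite normrM (le_trans _ (Clip k l))// ler_piMl// ler_norml; lra.
have := lerB_normD (2 * e * (k_(k) - k_(l))) ((be1 - be2) * (ln (C k) - ln (C l))).
rewrite normrM gtr0_norm ?mulr_gt0//.
have : e <= e * `|k_(k) - k_(l)| by rewrite ler_peMr// ltW.
by lra.
Qed.

End core.

Variables (be1 be2 : R).
Hypotheses (be1b : 0 <= be1 <= 1) (be2b : 0 <= be2 <= 1).
Local Notation be := ((1 - th) * be1 + th * be2).
Let ln20 : 0 < ln (2 : R). Proof. by rewrite ln_gt0// ltr1n. Qed.
Let d1_gt0 : 0 < `|al1 - al2| * ln 2.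
Proof. by rewrite mulr_gt0// normr_gt0 subr_eq0. Qed.
Let d2_gt0 : 0 < (rho + sg) * ln 2 / 2.
Proof. by rewrite divr_gt0// mulr_gt0. Qed.

(** Above the threshold [l] the factor [(x / l)^(q - 1)] is at least 1. *)
Lemma young_powR (l x q : R) : 0 < l -> 0 <= x -> 1 <= q ->
  x <= l + l `^ (1 - q) * x `^ q.
Proof.
move=> l0 x0 q1; have [xl|lx] := leP x l.
  by rewrite (le_trans xl)// lerDl mulr_ge0// powR_ge0.
have xpos : 0 < x := lt_trans l0 lx.
suff : x <= l `^ (1 - q) * x `^ q by lra.
rewrite !powR_expR// -expRD -{1}(lnK xpos) ler_expR.
have : (1 - q) * (ln x - ln l) <= 0.
  by rewrite mulr_le0_ge0 ?subr_le0// subr_ge0 ler_ln ?posrE// ltW.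
by lra.
Qed.

(** Schur's test for the kernel [phi (z j k)]: Young's inequality with a threshold
depending on [j] makes the sum over [k] linear in [C], and the sums over [j] and
[k] are then exchanged. The summable sequence enters through its bound [A] only,
so that the constant is uniform. *)
Lemma sequence_interpolation : 0 < be -> forall A : R, exists2 M : R, 0 < M &
  forall (X Y : R) (c : nat -> R) (v : nat -> nat -> R) (y : nat -> R),
  0 < X -> 0 < Y -> (forall i, 0 < c i) -> (\sum_(i <oo) (c i)%:E <= A%:E)%E ->
  (forall j k, 0 <= v j k) -> (forall j, 0 <= y j) ->
  (forall j k, v j k <= 2 `^ (- al1 * k_(j) + rho * k_(k)) * X * c k `^ be1) ->
  (forall j k, v j k <= 2 `^ (- al2 * k_(j) - sg * k_(k)) * Y * c k `^ be2) ->
  (forall j, (y j)%:E <= \sum_(k <oo) (v j k)%:E)%E ->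
  (\sum_(j <oo) ((2 `^ (al * k_(j)) * y j) `^ be^-1)%:E <=
     ((M * (X `^ (1 - th) * Y `^ th)) `^ be^-1)%:E)%E.
Proof.
move=> be0 A.
have be_le1 : be <= 1.
  case/andP: be1b => _ b1; case/andP: be2b => _ b2.
  have h1 : (1 - th) * be1 <= (1 - th) * 1 by rewrite ler_pM2l ?subr_gt0.
  have h2 : th * be2 <= th * 1 by rewrite ler_pM2l.
  by rewrite (le_trans (lerD h1 h2))// !mulr1 subrK.
have q1 : 1 <= be^-1 by rewrite invf_ge1.
have [K K0 HK] := log_lipschitz_majorant d2_gt0.
have [M1 M10 HM1] := phi_series d1_gt0.
have [M2 M20 HM2] := phi_series d2_gt0.
pose A' := Num.max A 1; have A'0 : 0 < A' by rewrite lt_max ltr01 orbT.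
pose M := (M2 + 1) * (M1 * (K * A')) `^ be.
have MA0 : 0 < M1 * (K * A') by rewrite !mulr_gt0.
exists M; first by rewrite mulr_gt0 ?powR_gt0// addr_gt0.
move=> X Y c v y X0 Y0 c0 cA v0 y0 v1 v2 yv.
have cA' : (\sum_(i <oo) (c i)%:E <= A'%:E)%E.
  by rewrite (le_trans cA)// lee_fin le_max lexx.
have [C [C0 cC CA Clip]] := HK c A' c0 cA'.
have vb j k := two_bounds_common_factor (v := v j k) (be1 := be1) (be2 := be2)
  (j := j) (k := k) X0 Y0 C0.
move: vb; set P := X `^ (1 - th) * Y `^ th; set z := log_ratio X Y be1 be2 C.
move=> vb.
have P0 : 0 < P by rewrite mulr_gt0 ?powR_gt0.
have {}vb j k : v j k <= 2 `^ (- al * k_(j)) * P * (C k `^ be * phi (z j k)).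
  apply: vb; [apply: le_trans (v1 j k) _|apply: le_trans (v2 j k) _];
    rewrite ler_pM2l ?mulr_gt0 ?powR_gt0//; apply: ge0_ler_powR => //;
    rewrite ?nnegrE ?(ltW (c0 _)) ?(ltW (C0 _))//.
    by case/andP: be1b.
  by case/andP: be2b.
have phi0 x : 0 < phi x by exact: expR_gt0.
have Sphi j : (\sum_(k <oo) (phi (z j k))%:E <= M2%:E)%E.
  by apply: HM2 => k l kl; exact: separated_in_column.
have SCphi0 j k : (0 <= (C k * phi (z j k))%:E)%E.
  by rewrite lee_fin mulr_ge0// ltW.
have Tfin j : (\sum_(k <oo) (C k * phi (z j k))%:E)%E \is a fin_num.
  rewrite ge0_fin_numE; last exact: nneseries_ge0.
  apply: (@le_lt_trans _ _ (K * A')%:E); last exact: ltry.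
  apply: le_trans CA; apply: lee_nneseries => // k _.
  rewrite lee_fin ler_piMr ?(ltW (C0 k))// /phi -[leRHS]expR0 ler_expR.
  rewrite ge_min; have [x0|x0] := leP 0 (z j k).
    by apply/orP; right; rewrite mulr_le0_ge0// subr_le0 ltW.
  by apply/orP; left; rewrite mulr_ge0_le0// ltW.
pose T j := fine (\sum_(k <oo) (C k * phi (z j k))%:E)%E.
have TE j : (T j)%:E = (\sum_(k <oo) (C k * phi (z j k))%:E)%E by rewrite fineK.
have T0 j : 0 < T j.
  rewrite -lte_fin TE; apply: (@lt_le_trans _ _ (C 0%N * phi (z j 0%N))%:E).
    by rewrite lte_fin mulr_gt0.
  have := @nneseries_lim_ge R (fun l => (C l * phi (z j l))%:E) xpredT 0 1.
  by rewrite big_nat1; apply.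
have yT j : 2 `^ (al * k_(j)) * y j <= (M2 + 1) * P * T j `^ be.
  (* This threshold makes the two terms of Young's inequality comparable after
  summation over [k]. *)
  set l := T j `^ be; have l0 : 0 < l by rewrite powR_gt0.
  have bnd : ((y j)%:E <= (2 `^ (- al * k_(j)) * P)%:E * ((l * M2)%:E + (l `^ (1 - be^-1))%:E * (T j)%:E))%E.
    apply: (le_trans (yv j)).
    apply: (@le_trans _ _ (\sum_(k <oo) ((2 `^ (- al * k_(j)) * P)%:E *
       (l%:E * (phi (z j k))%:E + (l `^ (1 - be^-1))%:E * (C k * phi (z j k))%:E)))%E).
      apply: lee_nneseries => [k *|k _]; first by rewrite lee_fin.
      rewrite -!EFinM lee_fin (le_trans (vb j k))//.
      rewrite ler_pM2l ?mulr_gt0 ?powR_gt0// mulrA -mulrDl ler_pM2r//.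
      have := @young_powR l (C k `^ be) be^-1 l0 (powR_ge0 _ _) q1.
      by rewrite -powRrM mulfV ?gt_eqF// powRr1// ltW.
    rewrite nneseriesZl; last first.
      move=> k _; rewrite adde_ge0// mule_ge0// lee_fin ?powR_ge0//.
      exact: ltW.
    apply: lee_wpmul2l; first by rewrite lee_fin mulr_ge0 ?powR_ge0// ltW.
    rewrite nneseriesD; last 2 first.
      by move=> k *; rewrite mule_ge0// lee_fin ltW.
      by move=> k *; rewrite mule_ge0// lee_fin powR_ge0.
    rewrite nneseriesZl; last by move=> *; rewrite lee_fin ltW.
    rewrite nneseriesZl// -TE leeD// EFinM lee_wpmul2l// lee_fin ltW//.
  move: bnd; rewrite -!EFinM lee_fin.
  have -> : l `^ (1 - be^-1) * T j = l.
    rewrite /l -powRrM mulrBr mulr1 mulfV ?gt_eqF//.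
    rewrite -[X in _ * X]powRr1 ?(ltW (T0 j))// -powRD ?subrK//.
    by rewrite (gt_eqF (T0 j)) implybT.
  have E0 : 0 < 2 `^ (al * k_(j)) :> R by rewrite powR_gt0.
  rewrite -(ler_pM2l E0) !mulrA -powRD; last by rewrite pnatr_eq0 implybT.
  by rewrite mulNr subrr powRr0; lra.
have MP0 : 0 < (M2 + 1) * P by rewrite mulr_gt0// addr_gt0.
have Pq0 : 0 < ((M2 + 1) * P) `^ be^-1 by rewrite powR_gt0.
apply: (@le_trans _ _ (\sum_(j <oo) ((((M2 + 1) * P) `^ be^-1)%:E * (T j)%:E))%E).
  apply: lee_nneseries => [*|j _]; first by rewrite lee_fin powR_ge0.
  rewrite -EFinM lee_fin.
  have -> : ((M2 + 1) * P) `^ be^-1 * T j = ((M2 + 1) * P * T j `^ be) `^ be^-1.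
    rewrite [in RHS]powRM ?powR_ge0 ?(ltW MP0)//.
    by rewrite -powRrM mulfV ?gt_eqF// powRr1// ltW.
  apply: ge0_ler_powR; rewrite ?nnegrE ?invr_ge0 ?(ltW be0)//.
    by rewrite mulr_ge0// powR_ge0.
  by rewrite (mulr_ge0 (ltW MP0))// powR_ge0.
rewrite nneseriesZl; last by move=> j _; rewrite lee_fin ltW.
have -> : M * P = (M2 + 1) * P * (M1 * (K * A')) `^ be by rewrite /M mulrAC.
rewrite [in leRHS]powRM ?powR_ge0 ?(ltW MP0)//.
rewrite -[in leRHS]powRrM mulfV ?gt_eqF// powRr1; last exact: ltW.
rewrite EFinM; apply: lee_wpmul2l; first by rewrite lee_fin ltW.
under eq_eseriesr do rewrite TE.
rewrite nneseries_interchange//.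
apply: (@le_trans _ _ (\sum_(k <oo) (M1%:E * (C k)%:E))%E).
  apply: lee_nneseries => [*|k _]; first exact: nneseries_ge0.
  under eq_eseriesr do rewrite EFinM.
  rewrite nneseriesZl; last by move=> *; rewrite lee_fin ltW.
  rewrite muleC; apply: lee_wpmul2r; first by rewrite lee_fin ltW.
  by apply: HM1 => i j ij; exact: separated_in_row.
rewrite nneseriesZl; last by move=> *; rewrite lee_fin ltW.
by rewrite EFinM lee_wpmul2l// lee_fin ltW.
Qed.

(** The case [q = +oo], where the geometric decay in [k] alone gives the bound. *)
Lemma sequence_interpolation_sup : exists2 M : R, 0 < M &
  forall (X Y : R) (v : nat -> nat -> R) (y : nat -> R),
  0 < X -> 0 < Y ->
  (forall j k, 0 <= v j k) ->
  (forall j k, v j k <= 2 `^ (- al1 * k_(j) + rho * k_(k)) * X) ->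
  (forall j k, v j k <= 2 `^ (- al2 * k_(j) - sg * k_(k)) * Y) ->
  (forall j, (y j)%:E <= \sum_(k <oo) (v j k)%:E)%E ->
  forall j, 2 `^ (al * k_(j)) * y j <= M * (X `^ (1 - th) * Y `^ th).
Proof.
have [M2 M20 HM2] := phi_series d2_gt0.
exists M2 => // X Y v y X0 Y0 v0 v1 v2 yv j.
pose C (k : nat) : R := 1.
have C0 k : 0 < C k by [].
have vb j' k := two_bounds_common_factor (v := v j' k) (be1 := 0) (be2 := 0)
  (j := j') (k := k) X0 Y0 C0.
move: vb; set P := X `^ (1 - th) * Y `^ th; set z := log_ratio X Y 0 0 C.
move=> vb; have P0 : 0 < P by rewrite mulr_gt0 ?powR_gt0.
have {}vb k : v j k <= 2 `^ (- al * k_(j)) * P * phi (z j k).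
  by have := vb j k; rewrite !powR1 !mulr1 mul1r; apply.
have Sphi : (\sum_(k <oo) (phi (z j k))%:E <= M2%:E)%E.
  apply: HM2 => k l kl; apply: separated_in_column => //; rewrite ?lexx ?ler01//.
  by move=> i m; rewrite subrr normr0 mulr_ge0// ltW.
have phi0 x : 0 <= phi x by exact: expR_ge0.
have bnd : ((y j)%:E <= (2 `^ (- al * k_(j)) * P)%:E * M2%:E)%E.
  apply: (le_trans (yv j)).
  apply: (@le_trans _ _ (\sum_(k <oo) ((2 `^ (- al * k_(j)) * P)%:E * (phi (z j k))%:E))%E).
    by apply: lee_nneseries => [k *|k _]; rewrite -?EFinM lee_fin.
  rewrite nneseriesZl; last by move=> *; rewrite lee_fin.
  apply: lee_wpmul2l => //.
  by rewrite lee_fin mulr_ge0 ?powR_ge0// ltW.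
move: bnd; rewrite -EFinM lee_fin.
have E0 : 0 < 2 `^ (al * k_(j)) :> R by rewrite powR_gt0.
rewrite -(ler_pM2l E0) !mulrA -powRD; last by rewrite pnatr_eq0 implybT.
by rewrite mulNr subrr powRr0; lra.
Qed.

End sequences_interpolation.

(** * Dyadic decomposition of integrals over the half-line *)

(** The integral of any nonnegative function is the supremum of the integrals of the
simple functions below it; this covers the spatial norms as functions of time,
whose measurability is not known. *)
Lemma ge0_le_integral_any d (T : measurableType d) (R : realType)
    (mu : {measure set T -> \bar R}) (D : set T) (f g : T -> \bar R) :
  (forall x, D x -> 0 <= f x)%E -> (forall x, D x -> f x <= g x)%E ->
  (\int[mu]_(x in D) f x <= \int[mu]_(x in D) g x)%E.
Proof.
move=> f0 fg; rewrite ge0_integralE// ge0_integralE; last first.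
  by move=> x Dx; exact: le_trans (f0 x Dx) (fg x Dx).
apply: le_ereal_sup => _ [h hf <-]; exists h => //= x.
apply: (le_trans (hf x)); rewrite /patch.
by case: ifP => //; rewrite inE; exact: fg.
Qed.

Section dyadic.
Context {R : realType}.
Notation "k_( i )" := ((zenum i)%:~R : R) (at level 8, format "k_( i )").
Notation leb := (@lebesgue_measure R).
Notation Rpos := (`]0%R, +oo[%classic : set (measurableTypeR R)).
Implicit Types (f g n : R -> \bar R).

(** The interval [[2^k, 2^(k+1))], where [k] is the integer coded by [i]. *)
Definition dyad (i : nat) : set (measurableTypeR R) := `[2 `^ k_(i), 2 `^ (k_(i) + 1)[.

Lemma measurable_dyad i : measurable (dyad i). Proof. exact: measurable_itv. Qed.

Lemma powR2_gt0 (x : R) : 0 < 2 `^ x. Proof. by rewrite powR_gt0. Qed.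

Lemma powR2D (x y : R) : 2 `^ (x + y) = 2 `^ x * 2 `^ y.
Proof. by rewrite powRD// pnatr_eq0 implybT. Qed.

Lemma powR2_log (t : R) : 0 < t -> 2 `^ (ln t / ln 2) = t.
Proof.
move=> t0; rewrite powR_expR// divfK ?lnK//.
by rewrite gt_eqF// ln_gt0// ltr1n.
Qed.

Lemma ler_powR2 (x y : R) : (2 `^ x <= 2 `^ y) = (x <= y).
Proof.
by rewrite !powR_expR// ler_expR ler_pM2r// ln_gt0// ltr1n.
Qed.

Lemma ltr_powR2 (x y : R) : (2 `^ x < 2 `^ y) = (x < y).
Proof. by rewrite !ltNge ler_powR2. Qed.

Lemma dyad_floor (t : R) i : 0 < t ->
  dyad i t <-> zenum i = Num.floor (ln t / ln 2).
Proof.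
move=> t0; rewrite /dyad /= in_itv /= -{1 2}(powR2_log t0) ler_powR2 ltr_powR2.
have -> : k_(i) + 1 = (zenum i + 1)%:~R by rewrite intrD.
split => [/floor_def ->//|->]; exact: floor_itv.
Qed.

Lemma dyad_gt0 i t : dyad i t -> 0 < t.
Proof. by rewrite /dyad /= in_itv /= => /andP[/(lt_le_trans (powR2_gt0 _))]. Qed.

Lemma bigcup_dyad : \bigcup_i dyad i = `]0, +oo[%classic.
Proof.
apply/seteqP; split => [t [i _ /dyad_gt0]|t] /=; rewrite in_itv/= andbT//.
move=> t0; exists (zcode (Num.floor (ln t / ln 2))) => //.
by apply/(dyad_floor _ t0); rewrite zcodeK.
Qed.

Lemma dyad_exists (t : R) : 0 < t -> exists i, dyad i t.
Proof.
move=> t0; have : (\bigcup_i dyad i) t by rewrite bigcup_dyad /= in_itv/= t0.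
by case=> i _; exists i.
Qed.

Lemma trivIset_dyad : trivIset setT dyad.
Proof.
apply/trivIsetP => i j _ _ /eqP ij; apply/seteqP; split => // t [ti tj].
have t0 := dyad_gt0 ti; apply: ij; apply: (can_inj zenumK).
by rewrite ((dyad_floor i t0).1 ti) ((dyad_floor j t0).1 tj).
Qed.

Lemma lebesgue_measure_dyad i : leb (dyad i) = (2 `^ k_(i))%:E.
Proof.
rewrite /dyad lebesgue_measure_itv /= lte_fin ltr_powR2 ltrDl ltr01 -EFinB.
by rewrite powR2D powRr1//; congr EFin; ring.
Qed.

Lemma dyadic_integral g : measurable_fun Rpos g ->
  (forall t, (0 < t)%R -> 0 <= g t)%E ->
  (\int[leb]_(t in Rpos) g t = \sum_(i <oo) \int[leb]_(t in dyad i) g t)%E.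
Proof.
move=> mg g0; rewrite -bigcup_dyad ge0_integral_bigcup//.
- by move=> i; exact: measurable_dyad.
- by rewrite bigcup_dyad.
- by move=> t; rewrite bigcup_dyad /= in_itv/= andbT => /g0.
- exact: trivIset_dyad.
Qed.

Lemma dyad_sub i : dyad i `<=` `]0, +oo[.
Proof. by move=> t /dyad_gt0; rewrite /= in_itv/= andbT. Qed.

Lemma measurable_dyadS g i : measurable_fun Rpos g -> measurable_fun (dyad i) g.
Proof.
by apply: measurable_funS; [exact: measurable_itv|exact: dyad_sub].
Qed.

Lemma integral_le_dyadic_sum f (b : nat -> R) : (forall i, 0 <= b i) ->
  (forall t, (0 < t)%R -> 0 <= f t)%E ->
  (forall i t, dyad i t -> f t <= (b i)%:E)%E ->
  (\int[leb]_(t in Rpos) f t <= \sum_(i <oo) (b i * 2 `^ k_(i))%:E)%E.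
Proof.
move=> b0 f0 fb.
pose g t := (\sum_(i <oo) (b i * \1_(dyad i) t)%:E)%E.
have i0 i t : 0 <= b i * \1_(dyad i) t by rewrite mulr_ge0.
have m0 : measurable (`]0, +oo[%classic : set R) by exact: measurable_itv.
apply: (@le_trans _ _ (\int[leb]_(t in Rpos) g t)%E).
  apply: ge0_le_integral_any => t /=; rewrite in_itv/= andbT => t0; first exact: f0.
  have [i ti] := dyad_exists t0; apply: (le_trans (fb i t ti)).
  apply: (@le_trans _ _ (b i * \1_(dyad i) t)%:E).
    by rewrite indicE mem_set// mulr1.
  have := @nneseries_lim_ge R (fun l => (b l * \1_(dyad l) t)%:E) xpredT 0 i.+1.
  move=> /(_ (fun l _ _ => ltac:(by rewrite lee_fin)))/(le_trans _); apply.
  by rewrite big_nat_recr//= leeDr// sume_ge0// => l _; rewrite lee_fin.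
have mi i : measurable_fun setT (fun t : R => (b i * \1_(dyad i) t)%:E).
  apply/measurable_EFinP; apply: measurable_funM => //.
  by apply: measurable_indic; exact: measurable_dyad.
rewrite /g integral_nneseries//; last 2 first.
  by move=> i; exact: measurable_funTS (mi i).
  by move=> *; rewrite lee_fin.
apply: lee_nneseries => [i *|i _].
  by apply: integral_ge0 => *; rewrite lee_fin.
under eq_integral do rewrite EFinM.
rewrite ge0_integralZl_EFin//; first last.
  apply/measurable_EFinP; apply: measurable_funTS.
  by apply: measurable_indic; exact: measurable_dyad.
rewrite EFinM; apply: lee_wpmul2l; first by rewrite lee_fin.
rewrite integral_indic//; last exact: measurable_dyad.
rewrite -lebesgue_measure_dyad le_measure ?inE//; first by apply: measurableI => //; exact: measurable_dyad.
exact: measurable_dyad.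
Qed.

End dyadic.

Section mean_norms.
Context {R : realType}.
Notation "k_( i )" := ((zenum i)%:~R : R) (at level 8, format "k_( i )").
Notation leb := (@lebesgue_measure R).
Notation Rpos := (`]0%R, +oo[%classic : set (measurableTypeR R)).
Implicit Types (n N : R -> \bar R).

(** The Besov quasinorm as a function of the profile [h |-> N h] of spatial
norms alone. *)
Definition mean_norm (mm s : R) (q : \bar R) N : \bar R :=
  match q with
  | q%:E => ((\int[leb]_(h in Rpos)
      ((h `^ ((mm - s / 2) * q))%:E * N h `^ q * (h^-1)%:E)) `^ q^-1)%E
  | +oo%E => ereal_sup [set ((h `^ (mm - s / 2))%:E * N h)%E | h in Rpos]
  | -oo%E => 0%E
  end.

Lemma poweR_young (l q : R) (x : \bar R) : 0 < l -> (0 <= x)%E -> 1 <= q ->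
  (x <= l%:E + (l `^ (1 - q))%:E * x `^ q)%E.
Proof.
move=> l0; case: x => [x| |]// x0 q1.
  by rewrite poweR_EFin -EFinM -EFinD lee_fin young_powR.
rewrite poweRyr; last by rewrite gt_eqF// (lt_le_trans ltr01).
by rewrite gt0_muley ?lte_fin ?powR_gt0// addey// leey.
Qed.

Lemma powR_dyad_le (s : R) i h : dyad i h ->
  h `^ s <= 2 `^ `|s| * 2 `^ (s * k_(i)).
Proof.
move=> hi; have h0 := dyad_gt0 hi.
move: hi; rewrite /dyad /= in_itv/= -{1 2}(powR2_log h0) ler_powR2 ltr_powR2.
move=> /andP[h1 h2]; rewrite -{1}(powR2_log h0) -powRrM -powR2D ler_powR2.
set x := _ / _ in h1 h2 *.
have : `|s * (x - k_(i))| <= `|s|.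
  by rewrite normrM ler_piMr// ler_norml; lra.
by move/(le_trans (ler_norm _)); lra.
Qed.

Lemma measurable_weight (a : R) (D : set (measurableTypeR R)) :
  measurable_fun D (fun h : R => (h `^ a)%:E).
Proof. by apply/measurable_EFinP; apply: measurable_funTS; exact: measurable_powR. Qed.

Lemma measurable_invr_pos : measurable_fun Rpos (fun h : R => (h^-1)%:E).
Proof.
apply/measurable_EFinP.
apply: (@eq_measurable_fun _ _ _ _ _ (fun h : R => h `^ (-1))).
  by move=> h; rewrite inE/= in_itv/= andbT => h0; rewrite powR_inv1// ltW.
by apply: measurable_funTS; exact: measurable_powR.
Qed.

Lemma measurable_profile (mm s q : R) n : measurable_fun Rpos n ->
  measurable_fun Rpos
    (fun h => (h `^ ((mm - s / 2) * q))%:E * n h `^ q * (h^-1)%:E)%E.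
Proof.
move=> mn; apply: emeasurable_funM; first apply: emeasurable_funM.
- exact: measurable_weight.
- exact: measurableT_comp (measurable_poweR q) mn.
- exact: measurable_invr_pos.
Qed.

(** Hoelder's inequality on a dyadic interval, up to a factor 2, obtained by
integrating Young's inequality [x <= l + l^(1 - q) x^q] with the optimal [l]. *)
Lemma dyad_hoelder (mm s X c : R) (q : \bar R) n i : (1 <= q)%E ->
  measurable_fun Rpos n -> (forall h, 0 < h -> (0 <= n h)%E) -> 0 < X -> 0 < c ->
  match q return Prop with
  | q%:E => (\int[leb]_(h in dyad i)
      ((h `^ ((mm - s / 2) * q))%:E * n h `^ q * (h^-1)%:E) <= (X `^ q * c)%:E)%E
  | +oo%E => forall h, dyad i h -> ((h `^ (mm - s / 2))%:E * n h <= X%:E)%E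
  | -oo%E => True
  end ->
  (\int[leb]_(h in dyad i) ((h `^ (mm - 1))%:E * n h) <=
    (2 * 2 `^ `|s / 2| * 2 `^ (s / 2 * k_(i)) * X * c `^ fine q^-1)%:E)%E.
Proof.
move=> q1 mn n0 X0 c0 hyp.
set K := 2 `^ `|s / 2| * 2 `^ (s / 2 * k_(i)).
have K0 : 0 < K by rewrite mulr_gt0 ?powR2_gt0.
have mI (g : R -> \bar R) : measurable_fun Rpos g -> measurable_fun (dyad i : set (measurableTypeR R)) g.
  exact: measurable_dyadS.
have minv : measurable_fun (dyad i) (fun h : R => (h^-1)%:E).
  by apply: mI; exact: measurable_invr_pos.
have inv0 (h : R) : dyad i h -> (0 <= (h^-1)%:E)%E.
  by move=> /dyad_gt0 h0; rewrite lee_fin invr_ge0 ltW.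
have Iinv : (\int[leb]_(h in dyad i) (h^-1)%:E <= 1)%E.
  apply: (@le_trans _ _ (\int[leb]_(h in dyad i) (cst (2 `^ (- k_(i)))%:E h))%E).
    apply: ge0_le_integral_any => // h hi; rewrite lee_fin powRN.
    rewrite lef_pV2 ?posrE ?powR2_gt0 ?(dyad_gt0 hi)//.
    by move: hi; rewrite /dyad /= in_itv/= => /andP[].
  rewrite integral_cst; last exact: measurable_dyad.
  by rewrite [X in (_ * X)%E]lebesgue_measure_dyad -EFinM lee_fin -powR2D addrC subrr powRr0.
pose A h := ((h `^ (mm - s / 2))%:E * n h)%E.
have A0 h : dyad i h -> (0 <= A h)%E.
  by move=> /dyad_gt0 h0; rewrite mule_ge0 ?n0// lee_fin powR_ge0.
have mA : measurable_fun (dyad i) A.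
  by apply: mI; apply: emeasurable_funM => //; exact: measurable_weight.
have bnd h : dyad i h -> ((h `^ (mm - 1))%:E * n h <= K%:E * (A h * (h^-1)%:E))%E.
  move=> hi; have h0 := dyad_gt0 hi.
  have -> : h `^ (mm - 1) = h `^ (s / 2) * (h `^ (mm - s / 2) * h^-1).
    rewrite -(powR_inv1 (ltW h0)) -!powRD ?(gt_eqF h0) ?implybT//.
    by congr powR; ring.
  rewrite /A EFinM -muleA EFinM (muleAC (h `^ _)%:E).
  apply: lee_wpmul2r; last by rewrite lee_fin powR_dyad_le.
  by rewrite !mule_ge0 ?n0// lee_fin ?powR_ge0// invr_ge0 ltW.
apply: (@le_trans _ _ (K%:E * \int[leb]_(h in dyad i) (A h * (h^-1)%:E))%E).
  rewrite -ge0_integralZl_EFin//; last 4 first.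
    exact: measurable_dyad.
    by move=> h hi; rewrite mule_ge0 ?A0 ?inv0.
    by apply: emeasurable_funM.
    exact: ltW.
  apply: ge0_le_integral_any => // h /dyad_gt0 h0.
  by rewrite mule_ge0 ?n0// lee_fin powR_ge0.
suff: (\int[leb]_(h in dyad i) (A h * (h^-1)%:E) <= (2 * X * c `^ fine q^-1)%:E)%E.
  move=> H; apply: (@le_trans _ _ (K%:E * (2 * X * c `^ fine q^-1)%:E)%E).
    by apply: lee_wpmul2l => //; rewrite lee_fin ltW.
  by rewrite -EFinM lee_fin /K le_eqVlt; apply/orP; left; apply/eqP; ring.
case: q q1 hyp => [q| |]// q1 hyp; last first.
  rewrite invey /= powRr0 mulr1.
  apply: (@le_trans _ _ (\int[leb]_(h in dyad i) (X%:E * (h^-1)%:E))%E).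
    apply: ge0_le_integral_any => h hi; first by rewrite mule_ge0 ?A0 ?inv0.
    by apply: lee_wpmul2r; [exact: inv0|exact: hyp].
  rewrite ge0_integralZl_EFin//; [|exact: measurable_dyad|exact: ltW].
  apply: (@le_trans _ _ (X%:E * 1)%E); first by apply: lee_wpmul2l => //; rewrite lee_fin ltW.
  by rewrite mule1 lee_fin; lra.
have {}q1 : 1 <= q by rewrite -lee_fin.
have q0 : 0 < q by exact: lt_le_trans ltr01 q1.
rewrite inver gt_eqF//=.
set l := X * c `^ q^-1.
have l0 : 0 < l by rewrite mulr_gt0 ?powR_gt0.
have AqE h : dyad i h -> ((h `^ ((mm - s / 2) * q))%:E * n h `^ q = A h `^ q)%E.
  move=> /dyad_gt0 h0; rewrite /A poweRM ?n0 ?lee_fin ?powR_ge0//.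
  by rewrite poweR_EFin -powRrM.
have mAq : measurable_fun (dyad i) (fun h => A h `^ q * (h^-1)%:E)%E.
  by apply: emeasurable_funM => //; exact: measurableT_comp (measurable_poweR q) mA.
apply: (@le_trans _ _ (\int[leb]_(h in dyad i)
   (l%:E * (h^-1)%:E + (l `^ (1 - q))%:E * (A h `^ q * (h^-1)%:E)))%E).
  apply: ge0_le_integral_any => h hi; first by rewrite mule_ge0 ?A0 ?inv0.
  rewrite muleA -ge0_muleDl; last 2 first.
  - by rewrite lee_fin ltW.
  - by rewrite mule_ge0 ?lee_fin ?powR_ge0 ?poweR_ge0.
  by apply: lee_wpmul2r; [exact: inv0|apply: poweR_young => //; exact: A0].
rewrite ge0_integralD//; last 5 first.
- exact: measurable_dyad.
- by move=> h hi; rewrite mule_ge0 ?inv0// lee_fin ltW.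
- by apply: emeasurable_funM => //; exact: measurable_cst.
- by move=> h hi; rewrite mule_ge0 ?lee_fin ?powR_ge0// mule_ge0 ?poweR_ge0 ?inv0.
- by apply: emeasurable_funM => //; exact: measurable_cst.
rewrite ge0_integralZl_EFin//; [|exact: measurable_dyad|exact: ltW].
rewrite ge0_integralZl_EFin ?powR_ge0//; last 2 first.
- exact: measurable_dyad.
- by move=> h hi; rewrite mule_ge0 ?poweR_ge0 ?inv0.
have -> : (2 * X * c `^ q^-1)%:E = (l%:E * 1 + (l `^ (1 - q))%:E * (X `^ q * c)%:E)%E.
  rewrite mule1 -EFinM -EFinD; congr EFin.
  have -> : l `^ (1 - q) * (X `^ q * c) = l; last by rewrite /l; ring.
  rewrite /l powRM ?powR_ge0 ?ltW// -powRrM mulrACA -powRD ?(gt_eqF X0) ?implybT//.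
  rewrite subrK powRr1 ?(ltW X0)//; congr (_ * _).
  rewrite -[X in _ * X]powRr1 ?(ltW c0)// -powRD ?(gt_eqF c0) ?implybT//.
  by congr powR; field; rewrite gt_eqF.
apply: leeD; first by apply: lee_wpmul2l => //; rewrite lee_fin ltW.
apply: lee_wpmul2l; first by rewrite lee_fin powR_ge0.
apply: le_trans hyp; rewrite le_eqVlt; apply/orP; left; apply/eqP.
by apply: eq_integral => h; rewrite inE => hi; rewrite AqE.
Qed.

End mean_norms.

(** * Interpolation of profiles on the half-line *)

Section profile_interpolation.
Context {R : realType}.
Notation "k_( i )" := ((zenum i)%:~R : R) (at level 8, format "k_( i )").
Notation leb := (@lebesgue_measure R).
Notation Rpos := (`]0%R, +oo[%classic : set (measurableTypeR R)).
Implicit Types (n N F : R -> \bar R).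

Lemma Rpos_gt0 (h : R) : Rpos h = (0 < h) :> Prop.
Proof. by rewrite /= in_itv/= andbT. Qed.

(** The Lorentz quasinorm as a function of the rearrangement alone. *)
Definition lorentz_profile (al : R) (q : \bar R) F : \bar R :=
  match q with
  | q%:E => ((\int[leb]_(t in Rpos)
      (((t `^ al)%:E * F t) `^ q * (t^-1)%:E)) `^ q^-1)%E
  | +oo%E => ereal_sup [set ((t `^ al)%:E * F t)%E | t in Rpos]
  | -oo%E => 0%E
  end.

Lemma inve_ge1_fin (q : \bar R) : (1 <= q)%E ->
  exists2 b : R, (q^-1 = b%:E)%E & 0 <= b <= 1.
Proof.
case: q => [q| |]// q1; last by exists 0; rewrite ?invey// lexx ler01.
have {}q1 : 1 <= q by rewrite -lee_fin.
have q0 : 0 < q by exact: lt_le_trans ltr01 q1.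
exists q^-1; first by rewrite inver gt_eqF.
by rewrite invr_ge0 ltW//= invf_le1.
Qed.

Lemma gt0_ler_poweRW (r : R) (x y : \bar R) : 0 <= r -> (0 <= x)%E -> (x <= y)%E ->
  (x `^ r <= y `^ r)%E.
Proof.
move=> r0 x0 xy; apply: gt0_ler_poweR => //; rewrite in_itv/= leey andbT//.
exact: le_trans x0 xy.
Qed.

Lemma profile_ge0 (mm s q : R) n h : 0 < h ->
  (0 <= (h `^ ((mm - s / 2) * q))%:E * n h `^ q * (h^-1)%:E)%E.
Proof.
by move=> h0; rewrite !mule_ge0 ?poweR_ge0 ?lee_fin ?powR_ge0// invr_ge0 ltW.
Qed.

Lemma mean_norm_ge0 (mm s : R) (q : \bar R) N :
  (forall h, 0 < h -> (0 <= N h)%E) -> (0 <= mean_norm mm s q N)%E.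
Proof.
case: q => [q| |]//= N0; first exact: poweR_ge0.
have N10 : (0 <= ((1 : R) `^ (mm - s / 2))%:E * N 1%R)%E.
  by rewrite mule_ge0 ?lee_fin ?powR_ge0// N0.
apply: (le_trans N10); apply: ereal_sup_ubound; exists 1 => //.
by rewrite /= in_itv/= ltr01.
Qed.

Lemma le_mean_norm (mm s : R) (q : \bar R) n N : (1 <= q)%E ->
  (forall h, 0 < h -> (0 <= n h <= N h)%E) ->
  (mean_norm mm s q n <= mean_norm mm s q N)%E.
Proof.
case: q => [q| |]//= q1 nN.
  have q0 : 0 < q by rewrite -lte_fin; exact: lt_le_trans q1.
  apply: gt0_ler_poweRW; first by rewrite invr_ge0 ltW.
    by apply: integral_ge0 => h; rewrite Rpos_gt0; exact: profile_ge0.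
  apply: ge0_le_integral_any => h; rewrite Rpos_gt0 => h0; first exact: profile_ge0.
  have /andP[n0 nNh] := nN h h0.
  apply: lee_wpmul2r; first by rewrite lee_fin invr_ge0 ltW.
  apply: lee_wpmul2l; first by rewrite lee_fin powR_ge0.
  by apply: gt0_ler_poweRW => //; exact: ltW.
apply: ge_ereal_sup => _ [h hpos <-].
apply: (@le_trans _ _ ((h `^ (mm - s / 2))%:E * N h)%E); last first.
  by apply: ereal_sup_ubound; exists h.
apply: lee_wpmul2l; first by rewrite lee_fin powR_ge0.
by move: hpos; rewrite Rpos_gt0 => /nN/andP[].
Qed.

(** The dyadic pieces of a profile of finite mean norm [X] are governed by a
single sequence in the unit ball of l^1, whatever the exponent [q]. *)
Lemma mean_norm_dyad (mm s X : R) (q : \bar R) n : (1 <= q)%E ->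
  measurable_fun Rpos n -> (forall h, 0 < h -> (0 <= n h)%E) -> 0 < X ->
  (mean_norm mm s q n <= X%:E)%E ->
  exists a : nat -> R, [/\ forall i, 0 <= a i <= 1,
    (\sum_(i <oo) (a i)%:E <= 1%:E)%E &
    forall i c, 0 < c -> a i <= c ->
      (\int[leb]_(h in dyad i) ((h `^ (mm - 1))%:E * n h) <=
      (2 * 2 `^ `|s / 2| * 2 `^ (s / 2 * k_(i)) * X * c `^ fine q^-1)%:E)%E].
Proof.
case: q => [q| |]// q1 mn n0 X0 nX; last first.
  exists (fun=> 0); split.
  - by move=> i; rewrite lexx ler01.
  - by rewrite eseries0// lee_fin ler01.
  - move=> i c c0 _; apply: (@dyad_hoelder R mm s X c +oo) => // h hi.
    apply: le_trans nX; apply: ereal_sup_ubound; exists h => //.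
    exact: dyad_sub hi.
have q0 : 0 < q by rewrite -lte_fin; exact: lt_le_trans q1.
pose g h := ((h `^ ((mm - s / 2) * q))%:E * n h `^ q * (h^-1)%:E)%E.
have g0 h : 0 < h -> (0 <= g h)%E by exact: profile_ge0.
have Ig0 : (0 <= \int[leb]_(h in Rpos) g h)%E.
  by apply: integral_ge0 => h; rewrite Rpos_gt0; exact: g0.
have mg : measurable_fun Rpos g by exact: measurable_profile.
have Xq0 : 0 < X `^ q by rewrite powR_gt0.
have IgX : (\int[leb]_(h in Rpos) g h <= (X `^ q)%:E)%E.
  have := @gt0_ler_poweRW q _ _ (ltW q0) (poweR_ge0 _ _) nX.
  by rewrite -poweRrM mulVf ?gt_eqF// poweRe1.
have Idy0 i : (0 <= \int[leb]_(h in dyad i) g h)%E.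
  by apply: integral_ge0 => h /dyad_gt0; exact: g0.
have Idy : (\sum_(i <oo) \int[leb]_(h in dyad i) g h <= (X `^ q)%:E)%E.
  by rewrite -dyadic_integral.
have Ifin i : (\int[leb]_(h in dyad i) g h)%E \is a fin_num.
  rewrite ge0_fin_numE//; apply: (@le_lt_trans _ _ (X `^ q)%:E); last exact: ltry.
  apply: le_trans Idy.
  have := @nneseries_lim_ge R (fun i => (\int[leb]_(h in dyad i) g h)%E) xpredT 0 i.+1.
  move=> /(_ (fun l _ _ => Idy0 l))/(le_trans _); apply.
  by rewrite big_nat_recr//= leeDr// sume_ge0.
pose a i := fine (\int[leb]_(h in dyad i) g h)%E / X `^ q.
have a0 i : 0 <= a i by rewrite divr_ge0 ?fine_ge0// ltW.
have aE i : ((X `^ q * a i)%:E = \int[leb]_(h in dyad i) g h)%E.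
  by rewrite /a mulrCA mulfV ?gt_eqF// mulr1 fineK.
have asum : (\sum_(i <oo) (a i)%:E <= 1%:E)%E.
  rewrite -(@lee_pmul2l _ (X `^ q)%:E) ?lte_fin// -nneseriesZl; last first.
    by move=> i _; rewrite lee_fin.
  rewrite mule1; under eq_eseriesr do rewrite -EFinM aE.
  exact: Idy.
exists a; split => //.
- move=> i; rewrite a0 /= -lee_fin; apply: le_trans asum.
  have := @nneseries_lim_ge R (fun i => (a i)%:E) xpredT 0 i.+1.
  move=> /(_ (fun l _ _ => ltac:(by rewrite lee_fin)))/(le_trans _); apply.
  by rewrite big_nat_recr//= leeDr// sume_ge0// => l _; rewrite lee_fin.
- move=> i c c0 ac; apply: (@dyad_hoelder R mm s X c q%:E) => //.
  by rewrite -aE lee_fin ler_pM2l.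
Qed.

Lemma lorentz_profile_dyadic (al q : R) F (y : nat -> R) : 0 < q -> 0 <= al ->
  (forall j, 0 <= y j) -> (forall t, 0 < t -> (0 <= F t)%E) ->
  (forall t u, 0 < t -> t <= u -> (F u <= F t)%E) ->
  (forall j, F (2 `^ k_(j)) = (2 * y j)%:E) ->
  (lorentz_profile al q%:E F <= (2 `^ (al + 1))%:E *
     (\sum_(j <oo) ((2 `^ (al * k_(j)) * y j) `^ q)%:E) `^ q^-1)%E.
Proof.
move=> q0 al0 y0 F0 Fnd Fy /=.
pose b j := (2 `^ (al + 1) * (2 `^ (al * k_(j)) * y j)) `^ q * 2 `^ (- k_(j)).
have b0 j : 0 <= b j by rewrite mulr_ge0 ?powR_ge0.
have Fb j t : dyad j t -> (((t `^ al)%:E * F t) `^ q * (t^-1)%:E <= (b j)%:E)%E.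
  move=> tj; have t0 := dyad_gt0 tj.
  have Ft0 : (0 <= (t `^ al)%:E * F t)%E by rewrite mule_ge0 ?lee_fin ?powR_ge0// F0.
  have tb : 2 `^ k_(j) <= t by move: tj; rewrite /dyad /= in_itv/= => /andP[].
  apply: (@le_trans _ _ (((2 `^ (al + 1) * (2 `^ (al * k_(j)) * y j)) `^ q)%:E *
     (2 `^ (- k_(j)))%:E)%E); last by rewrite -EFinM.
  apply: lee_pmul.
  - exact: poweR_ge0.
  - by rewrite lee_fin invr_ge0 ltW.
  - rewrite -[leRHS]poweR_EFin; apply: gt0_ler_poweRW => //; first exact: ltW.
    apply: (@le_trans _ _ ((t `^ al)%:E * (2 * y j)%:E)%E).
      apply: lee_wpmul2l; first by rewrite lee_fin powR_ge0.
      by rewrite -Fy; apply: Fnd => //; exact: powR2_gt0.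
    rewrite -EFinM lee_fin powR2D powRr1//.
    have := powR_dyad_le al tj; rewrite ger0_norm// => tal.
    have : t `^ al * (2 * y j) <= 2 `^ al * 2 `^ (al * k_(j)) * (2 * y j).
      by rewrite ler_wpM2r// mulr_ge0.
    by lra.
  - rewrite lee_fin powRN lef_pV2 ?posrE ?powR2_gt0//.
have := integral_le_dyadic_sum b0 _ Fb.
move=> /(_ (fun t t0 => ltac:(by rewrite mule_ge0 ?poweR_ge0// lee_fin invr_ge0 ltW))) I1.
have {}I1 : (\int[leb]_(t in Rpos) (((t `^ al)%:E * F t) `^ q * (t^-1)%:E) <=
   ((2 `^ (al + 1)) `^ q)%:E * \sum_(j <oo) ((2 `^ (al * k_(j)) * y j) `^ q)%:E)%E.
  apply: (le_trans I1); rewrite -nneseriesZl; last by move=> *; rewrite lee_fin powR_ge0.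
  apply: lee_nneseries => [*|j _]; first by rewrite lee_fin mulr_ge0 ?b0 ?powR_ge0.
  rewrite -EFinM lee_fin /b -mulrA -powR2D addNr powRr0 mulr1.
  by rewrite powRM ?powR_ge0 ?mulr_ge0 ?powR_ge0.
apply: (le_trans (gt0_ler_poweRW _ _ I1)).
- by rewrite invr_ge0 ltW.
- apply: integral_ge0 => t; rewrite Rpos_gt0 => t0.
  by rewrite mule_ge0 ?poweR_ge0// lee_fin invr_ge0 ltW.
rewrite poweRM ?lee_fin ?powR_ge0//; last first.
  by apply: nneseries_ge0 => *; rewrite lee_fin powR_ge0.
by rewrite poweR_EFin -powRrM mulfV ?gt_eqF// powRr1// powR_ge0.
Qed.

Lemma lorentz_profile_dyadic_sup (al M : R) F (y : nat -> R) : 0 <= al ->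
  (forall t u, 0 < t -> t <= u -> (F u <= F t)%E) ->
  (forall j, 0 <= y j) -> (forall j, F (2 `^ k_(j)) = (2 * y j)%:E) ->
  (forall j, 2 `^ (al * k_(j)) * y j <= M) ->
  (lorentz_profile al +oo F <= (2 `^ (al + 1) * M)%:E)%E.
Proof.
move=> al0 Fnd y0 Fy yM /=; apply: ge_ereal_sup => _ [t + <-]; rewrite Rpos_gt0 => t0.
have [j tj] := dyad_exists t0.
have tb : 2 `^ k_(j) <= t by move: tj; rewrite /dyad /= in_itv/= => /andP[].
apply: (@le_trans _ _ ((t `^ al)%:E * (2 * y j)%:E)%E).
  apply: lee_wpmul2l; first by rewrite lee_fin powR_ge0.
  by rewrite -Fy; apply: Fnd => //; exact: powR2_gt0.
rewrite -EFinM lee_fin powR2D powRr1//.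
have := powR_dyad_le al tj; rewrite ger0_norm// => tal.
have : t `^ al * (2 * y j) <= 2 `^ al * 2 `^ (al * k_(j)) * (2 * y j).
  by rewrite ler_wpM2r// mulr_ge0.
have : 2 `^ al * (2 `^ (al * k_(j)) * y j) <= 2 `^ al * M.
  by rewrite ler_pM2l ?powR2_gt0.
by lra.
Qed.

End profile_interpolation.

Section profile_theorem.
Context {R : realType}.
Notation "k_( i )" := ((zenum i)%:~R : R) (at level 8, format "k_( i )").
Notation leb := (@lebesgue_measure R).
Notation Rpos := (`]0%R, +oo[%classic : set (measurableTypeR R)).
Implicit Types (n N F : R -> \bar R).

(** A countable supremum replaces the arbitrary profile [N], about which nothing
is known, by a measurable one without spoiling the bounds it is used for. *)
Lemma measurable_minorant (al : R) N (v : nat -> R -> R) :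
  (forall j, measurable_fun Rpos (v j)) -> (forall j h, 0 < h -> 0 <= v j h) ->
  (forall j h, 0 < h -> ((v j h)%:E <= (2 `^ (- al * k_(j)))%:E * N h)%E) ->
  exists n, [/\ measurable_fun Rpos n, forall h, 0 < h -> (0 <= n h <= N h)%E &
    forall j h, 0 < h -> ((v j h)%:E <= (2 `^ (- al * k_(j)))%:E * n h)%E].
Proof.
move=> mv v0 vN; pose u j h : \bar R := (2 `^ (al * k_(j)) * v j h)%:E.
have usup j h : (u j h <= esups (u ^~ h) 0%N)%E.
  by apply: ereal_sup_ubound; exists j.
have aK j : ((2 `^ (- al * k_(j)))%:E * (2 `^ (al * k_(j)))%:E = 1 :> \bar R)%E.
  by rewrite -EFinM -powR2D mulNr addNr powRr0.
exists (fun h => esups (u ^~ h) 0%N); split.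
- apply: measurable_fun_esups => j; apply/measurable_EFinP.
  by apply: measurable_funM => //.
- move=> h h0; apply/andP; split.
    apply: (le_trans _ (usup 0%N h)).
    by rewrite lee_fin mulr_ge0 ?powR_ge0// v0.
  apply: ge_ereal_sup => _ [j _ <-]; rewrite /u.
  rewrite EFinM -(@lee_pmul2l _ (2 `^ (- al * k_(j)))%:E) ?lte_fin ?powR2_gt0//.
  by rewrite muleA aK mul1e vN.
- move=> j h h0; have := usup j h.
  rewrite -(@lee_pmul2l _ (2 `^ (- al * k_(j)))%:E) ?lte_fin ?powR2_gt0//.
  by rewrite {1}/u EFinM muleA aK mul1e.
Qed.

Lemma profile_piece_bound (al B : R) n (v : nat -> R -> R) (mm : R) j k :
  measurable_fun Rpos n -> (forall h, 0 < h -> (0 <= n h)%E) ->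
  (forall j h, 0 < h -> 0 <= v j h) ->
  (forall j h, 0 < h -> ((v j h)%:E <= (2 `^ (- al * k_(j)))%:E * n h)%E) ->
  (\int[leb]_(h in dyad k) ((h `^ (mm - 1))%:E * n h) <= B%:E)%E ->
  (\int[leb]_(h in dyad k) ((h `^ (mm - 1))%:E * (v j h)%:E) <=
    (2 `^ (- al * k_(j)) * B)%:E)%E.
Proof.
move=> mn n0 v0 vn nB.
apply: (@le_trans _ _ (\int[leb]_(h in dyad k)
    ((2 `^ (- al * k_(j)))%:E * ((h `^ (mm - 1))%:E * n h)))%E).
  apply: ge0_le_integral_any => h /dyad_gt0 h0.
    by rewrite mule_ge0// lee_fin ?powR_ge0// v0.
  by rewrite muleCA lee_wpmul2l ?vn// lee_fin powR_ge0.
rewrite ge0_integralZl_EFin ?powR_ge0//; last 3 first.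
- exact: measurable_dyad.
- by move=> h /dyad_gt0 h0; rewrite mule_ge0 ?n0// lee_fin powR_ge0.
- apply: emeasurable_funM; first exact: measurable_weight.
  exact: measurable_dyadS.
by rewrite EFinM; apply: lee_wpmul2l => //; rewrite lee_fin powR_ge0.
Qed.

Variables (al1 al2 r s mm th : R) (q1 q2 q : \bar R).
Hypotheses (al12 : al1 != al2) (al1_ge0 : 0 <= al1) (al2_ge0 : 0 <= al2).
Hypotheses (r_gt0 : 0 < r) (s_lt0 : s < 0) (th_def : th = r / (r - s)).
Hypotheses (q1_ge1 : (1 <= q1)%E) (q2_ge1 : (1 <= q2)%E).
Hypothesis q_def : (q^-1 = (1 - th)%:E * q1^-1 + th%:E * q2^-1)%E.
Local Notation al := ((1 - th) * al1 + th * al2).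

Let rs0 : 0 < r - s. Proof. by rewrite subr_gt0 (lt_trans s_lt0). Qed.
Let th0 : 0 < th. Proof. by rewrite th_def divr_gt0. Qed.
Let th1 : th < 1. Proof. by rewrite th_def ltr_pdivrMr// mul1r ltrDl oppr_gt0. Qed.
Let r20 : 0 < r / 2. Proof. by rewrite divr_gt0. Qed.
Let s20 : 0 < - (s / 2). Proof. by rewrite -mulNr divr_gt0// oppr_gt0. Qed.
Let thE : th = (r / 2) / (r / 2 + - (s / 2)).
Proof.
have -> : r / 2 + - (s / 2) = (r - s) / 2 by rewrite mulrBl.
by rewrite th_def -mulf_div divff ?mulr1// invr_eq0 pnatr_eq0.
Qed.
Let al_ge0 : 0 <= al.
Proof. by rewrite addr_ge0// mulr_ge0// ?subr_ge0 ltW. Qed.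

Section data.
Variables (F n1 n2 : R -> \bar R) (y : nat -> R) (v : nat -> R -> R).
Hypotheses (F0 : forall t, 0 < t -> (0 <= F t)%E)
  (Fnd : forall t u, 0 < t -> t <= u -> (F u <= F t)%E)
  (y0 : forall j, 0 <= y j) (Fy : forall j, F (2 `^ k_(j)) = (2 * y j)%:E)
  (mn1 : measurable_fun Rpos n1) (mn2 : measurable_fun Rpos n2)
  (n10 : forall h, 0 < h -> (0 <= n1 h)%E)
  (n20 : forall h, 0 < h -> (0 <= n2 h)%E)
  (mv : forall j, measurable_fun Rpos (v j)) (v0 : forall j h, 0 < h -> 0 <= v j h)
  (vn1 : forall j h, 0 < h -> ((v j h)%:E <= (2 `^ (- al1 * k_(j)))%:E * n1 h)%E)
  (vn2 : forall j h, 0 < h -> ((v j h)%:E <= (2 `^ (- al2 * k_(j)))%:E * n2 h)%E)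
  (yv : forall j, ((y j)%:E <=
    \int[leb]_(h in Rpos) ((h `^ (mm - 1))%:E * (v j h)%:E))%E).

Let I j k := (\int[leb]_(h in dyad k) ((h `^ (mm - 1))%:E * (v j h)%:E))%E.

Let I0 j k : (0 <= I j k)%E.
Proof.
by apply: integral_ge0 => h /dyad_gt0 h0; rewrite mule_ge0// lee_fin ?powR_ge0// v0.
Qed.

Let yI j : ((y j)%:E <= \sum_(k <oo) I j k)%E.
Proof.
rewrite /I -dyadic_integral//.
  by apply: emeasurable_funM; [exact: measurable_weight|exact/measurable_EFinP].
by move=> h h0; rewrite mule_ge0// lee_fin ?powR_ge0// v0.
Qed.

(** If one mean norm vanishes and the other is infinite, the right-hand side of the
interpolation inequality is [0 * +oo = 0], so the left-hand side has to vanish as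
well. *)
Lemma lorentz_profile_zero : (0 <= q)%E -> (forall j k, I j k = 0%E) ->
  (lorentz_profile al q F <= 0)%E.
Proof.
move=> q0 Iz.
have yz j : y j = 0.
  apply/eqP; rewrite eq_le y0 andbT -lee_fin (le_trans (yI j))//.
  by rewrite eseries0.
case: q q0 q_def => [q'| |]// q0 qd.
- have {}q0 : 0 < q'.
    rewrite lt_neqAle -lee_fin q0 andbT; apply/eqP => q'0.
    have [b1 b1E _] := inve_ge1_fin q1_ge1.
    have [b2 b2E _] := inve_ge1_fin q2_ge1.
    by move: qd; rewrite -q'0 inve0 b1E b2E -!EFinM -EFinD.
  apply: (le_trans (lorentz_profile_dyadic q0 al_ge0 y0 F0 Fnd Fy)).
  rewrite eseries0; last by move=> i _ _; rewrite yz mulr0 powR0// gt_eqF.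
  by rewrite poweR0r ?mule0// gt_eqF// invr_gt0.
- have := @lorentz_profile_dyadic_sup R al 0 F y al_ge0 Fnd y0 Fy.
  by rewrite mulr0; apply => j; rewrite yz mulr0.
Qed.

(** A vanishing mean norm is below every [X > 0]; let [X] tend to 0 in
[mean_norm_dyad]. *)
Lemma mean_norm_zero_pieces (al' s' : R) (q' : \bar R) n : (1 <= q')%E ->
  measurable_fun Rpos n -> (forall h, 0 < h -> (0 <= n h)%E) ->
  (forall j h, 0 < h -> ((v j h)%:E <= (2 `^ (- al' * k_(j)))%:E * n h)%E) ->
  mean_norm mm s' q' n = 0%E -> forall j k, I j k = 0%E.
Proof.
move=> q'1 mn n0 vn nz j k; apply/eqP; rewrite eq_le I0 andbT.
apply/lee_addgt0Pr => e e0; rewrite add0e.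
set C := 2 `^ (- al' * k_(j)) * (2 * 2 `^ `|s' / 2| * 2 `^ (s' / 2 * k_(k))).
have C0 : 0 < C by rewrite !mulr_gt0 ?powR2_gt0.
have eC : 0 < e / C by rewrite divr_gt0.
have [|a [ab _ abnd]] := mean_norm_dyad (mm := mm) (s := s') q'1 mn n0 eC.
  by rewrite nz lee_fin ltW.
have := abnd k 1 ltr01 (proj2 (andP (ab k))).
rewrite powR1 mulr1 => /(profile_piece_bound j mn n0 v0 vn)/le_trans; apply.
by rewrite lee_fin mulrA -/C mulrC divfK ?gt_eqF.
Qed.

End data.

Lemma interpolated_exponent : exists b1 b2 : R,
  [/\ (q1^-1 = b1%:E)%E, (q2^-1 = b2%:E)%E, 0 <= b1 <= 1, 0 <= b2 <= 1 &
      ((1 - th) * b1 + th * b2 = 0 /\ q = +oo%E) \/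
      (0 < (1 - th) * b1 + th * b2 /\ q = (((1 - th) * b1 + th * b2)^-1)%:E)].
Proof.
have [b1 b1E b1b] := inve_ge1_fin q1_ge1.
have [b2 b2E b2b] := inve_ge1_fin q2_ge1.
exists b1, b2; split => //.
move: q_def; rewrite b1E b2E -!EFinM -EFinD; set b := _ + _ => qb.
have qE : q = (b%:E^-1)%E by rewrite -qb inveK.
have b0 : 0 <= b.
  case/andP: b1b => ? _; case/andP: b2b => ? _.
  by rewrite addr_ge0// mulr_ge0 ?subr_ge0// ltW.
move: b0; rewrite le_eqVlt => /predU1P[bz|b0].
  by left; split; [rewrite -bz|rewrite qE -bz inver eqxx].
by right; split => //; rewrite qE inver gt_eqF.
Qed.

Lemma measurable_profile_interpolation : exists2 c : R, 0 < c &
  forall F n1 n2 (y : nat -> R) (v : nat -> R -> R),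
  (forall t, 0 < t -> (0 <= F t)%E) ->
  (forall t u, 0 < t -> t <= u -> (F u <= F t)%E) ->
  (forall j, 0 <= y j) -> (forall j, F (2 `^ k_(j)) = (2 * y j)%:E) ->
  measurable_fun Rpos n1 -> measurable_fun Rpos n2 ->
  (forall h, 0 < h -> (0 <= n1 h)%E) -> (forall h, 0 < h -> (0 <= n2 h)%E) ->
  (forall j, measurable_fun Rpos (v j)) -> (forall j h, 0 < h -> 0 <= v j h) ->
  (forall j h, 0 < h -> ((v j h)%:E <= (2 `^ (- al1 * k_(j)))%:E * n1 h)%E) ->
  (forall j h, 0 < h -> ((v j h)%:E <= (2 `^ (- al2 * k_(j)))%:E * n2 h)%E) ->
  (forall j, ((y j)%:E <=
    \int[leb]_(h in Rpos) ((h `^ (mm - 1))%:E * (v j h)%:E))%E) ->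
  (lorentz_profile al q F <=
    c%:E * mean_norm mm r q1 n1 `^ (1 - th) * mean_norm mm s q2 n2 `^ th)%E.
Proof.
have [b1 [b2 [b1E b2E b1b b2b qb]]] := interpolated_exponent.
have q_ge0 : (0 <= q)%E.
  by case: qb => -[b0 ->]; rewrite ?leey// lee_fin invr_ge0 ltW.
have [G G0 HG] := @separated_exp_series R 1 1 ltr01 ltr01.
pose K1 := 2 * 2 `^ `|r / 2| : R; pose K2 := 2 * 2 `^ `|s / 2| : R.
have K10 : 0 < K1 by rewrite mulr_gt0 ?powR2_gt0.
have K20 : 0 < K2 by rewrite mulr_gt0 ?powR2_gt0.
(* The main case, in terms of sequences: both mean norms are positive and finite,
and [w j k] is the integral over the [k]-th dyadic interval. *)
suff [c c0 Hc] : exists2 c : R, 0 < c &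
  forall F (X Y : R) (y c1 c2 : nat -> R) (w : nat -> nat -> R),
  (forall t, 0 < t -> (0 <= F t)%E) ->
  (forall t u, 0 < t -> t <= u -> (F u <= F t)%E) ->
  (forall j, 0 <= y j) -> (forall j, F (2 `^ k_(j)) = (2 * y j)%:E) ->
  0 < X -> 0 < Y -> (forall j k, 0 <= w j k) ->
  (forall j, (y j)%:E <= \sum_(k <oo) (w j k)%:E)%E ->
  (forall i, 0 <= c1 i <= 1) -> (forall i, 0 <= c2 i <= 1) ->
  (\sum_(i <oo) (c1 i)%:E <= 1%:E)%E -> (\sum_(i <oo) (c2 i)%:E <= 1%:E)%E ->
  (forall j k c, 0 < c -> c1 k <= c ->
     w j k <= 2 `^ (- al1 * k_(j)) * (2 `^ (r / 2 * k_(k)) * (K1 * X) * c `^ b1)) ->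
  (forall j k c, 0 < c -> c2 k <= c ->
     w j k <= 2 `^ (- al2 * k_(j)) * (2 `^ (s / 2 * k_(k)) * (K2 * Y) * c `^ b2)) ->
  (lorentz_profile al q F <= (c * ((K1 * X) `^ (1 - th) * (K2 * Y) `^ th))%:E)%E.
  exists (c * (K1 `^ (1 - th) * K2 `^ th)); first by rewrite !mulr_gt0 ?powR_gt0.
  move=> F n1 n2 y v F0 Fnd y0 Fy mn1 mn2 n10 n20 mv v0 vn1 vn2 yv.
  have B10 := mean_norm_ge0 mm r q1 n10; have B20 := mean_norm_ge0 mm s q2 n20.
  set cc := c * _; have cc0 : 0 < cc by rewrite !mulr_gt0 ?powR_gt0.
  have RHS0 : (0 <= cc%:E * mean_norm mm r q1 n1 `^ (1 - th) * mean_norm mm s q2 n2 `^ th)%E.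
    by rewrite !mule_ge0 ?poweR_ge0// lee_fin ltW.
  have [B1z|B1nz] := eqVneq (mean_norm mm r q1 n1) 0%E.
    apply: le_trans RHS0; apply: (lorentz_profile_zero F0 Fnd y0 Fy mv v0 yv q_ge0).
    exact: (mean_norm_zero_pieces v0 q1_ge1 mn1 n10 vn1 B1z).
  have [B2z|B2nz] := eqVneq (mean_norm mm s q2 n2) 0%E.
    apply: le_trans RHS0; apply: (lorentz_profile_zero F0 Fnd y0 Fy mv v0 yv q_ge0).
    exact: (mean_norm_zero_pieces v0 q2_ge1 mn2 n20 vn2 B2z).
  move: B10 B20 B1nz B2nz RHS0.
  case B1E : (mean_norm mm r q1 n1) => [X| |]//; last first.
    move=> _ B20 _ B2nz _; rewrite poweRyr; last by rewrite gt_eqF// subr_gt0.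
    rewrite gt0_muley ?lte_fin// gt0_mulye ?leey//.
    by apply: poweR_gt0; rewrite lt_neqAle eq_sym B2nz.
  case B2E : (mean_norm mm s q2 n2) => [Y| |]//; last first.
    move=> B10 _ B1nz _ _; rewrite poweRyr; last by rewrite gt_eqF.
    rewrite gt0_muley ?leey// mule_gt0//.
    by apply: poweR_gt0; rewrite lt_neqAle eq_sym B1nz.
  rewrite !lee_fin !eqe => X0 Y0 Xnz Ynz _.
  have {X0 Xnz}X0 : 0 < X by rewrite lt_neqAle eq_sym Xnz.
  have {Y0 Ynz}Y0 : 0 < Y by rewrite lt_neqAle eq_sym Ynz.
  have [|c1 [c1b c1s H1]] := mean_norm_dyad (mm := mm) (s := r) q1_ge1 mn1 n10 X0.
    by rewrite B1E.
  have [|c2 [c2b c2s H2]] := mean_norm_dyad (mm := mm) (s := s) q2_ge1 mn2 n20 Y0.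
    by rewrite B2E.
  pose I j k := (\int[leb]_(h in dyad k) ((h `^ (mm - 1))%:E * (v j h)%:E))%E.
  have I0 j k : (0 <= I j k)%E.
    by apply: integral_ge0 => h /dyad_gt0 h0; rewrite mule_ge0// lee_fin ?powR_ge0// v0.
  have I1 j k e (e0 : 0 < e) (ce : c1 k <= e) := profile_piece_bound j mn1 n10 v0 vn1 (H1 k e e0 ce).
  have I2 j k e (e0 : 0 < e) (ce : c2 k <= e) := profile_piece_bound j mn2 n20 v0 vn2 (H2 k e e0 ce).
  have Ifin j k : I j k \is a fin_num.
    rewrite ge0_fin_numE//; apply: le_lt_trans (I1 j k 1 ltr01 _) (ltry _).
    by case/andP: (c1b k).
  pose w j k := fine (I j k).
  have wE j k : (w j k)%:E = I j k by rewrite fineK.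
  have := Hc F X Y y c1 c2 w F0 Fnd y0 Fy X0 Y0 _ _ c1b c2b c1s c2s.
  have -> : (cc%:E * X%:E `^ (1 - th) * Y%:E `^ th)%E =
      (c * ((K1 * X) `^ (1 - th) * (K2 * Y) `^ th))%:E.
    rewrite !poweR_EFin -!EFinM; congr EFin.
    have E1 := powRM (1 - th) (ltW K10) (ltW X0).
    have E2 := powRM th (ltW K20) (ltW Y0).
    by rewrite E1 E2 mulrACA [RHS]mulrA -[LHS]mulrA.
  apply.
  - by move=> j k; rewrite fine_ge0.
  - move=> j; under eq_eseriesr do rewrite wE.
    rewrite /I -dyadic_integral//.
      by apply: emeasurable_funM; [exact: measurable_weight|exact/measurable_EFinP].
    by move=> h h0; rewrite mule_ge0// lee_fin ?powR_ge0// v0.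
  - move=> j k e e0 ce; rewrite -lee_fin wE (le_trans (I1 j k e e0 ce))//.
    by rewrite b1E /= -/K1 [K1 * _]mulrC !mulrA lexx.
  - move=> j k e e0 ce; rewrite -lee_fin wE (le_trans (I2 j k e e0 ce))//.
    by rewrite b2E /= -/K2 [K2 * _]mulrC !mulrA lexx.
have e2 j k : - al2 * k_(j) - - (s / 2) * k_(k) = - al2 * k_(j) + s / 2 * k_(k).
  by rewrite [- (s / 2) * _]mulNr opprK.
case: qb => -[b0 ->].
- have b10 : b1 = 0.
    case/andP: b1b => b10 _; case/andP: b2b => b20 _.
    move/eqP: b0; rewrite paddr_eq0 ?mulr_ge0 ?subr_ge0 ?(ltW th0) ?(ltW th1)//.
    by rewrite mulf_eq0 subr_eq0 (gt_eqF th1)/= => /andP[/eqP].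
  have b20 : b2 = 0.
    by move/eqP: b0; rewrite b10 mulr0 add0r mulf_eq0 (gt_eqF th0) => /eqP.
  have [M M0 HM] := sequence_interpolation_sup al1 al2 r20 s20 thE.
  exists (2 `^ (al + 1) * M); first by rewrite mulr_gt0 ?powR2_gt0.
  move=> F X Y y c1 c2 w F0 Fnd y0 Fy X0 Y0 w0 yw c1b c2b c1s c2s w1 w2.
  rewrite -mulrA; apply: lorentz_profile_dyadic_sup Fy _ => //.
  apply: (HM _ _ w) => //; rewrite ?mulr_gt0//.
    move=> j k; have := w1 j k 1 ltr01 (proj2 (andP (c1b k))).
    by rewrite powR1 mulr1 powR2D mulrA.
  move=> j k; have := w2 j k 1 ltr01 (proj2 (andP (c2b k))).
  by rewrite e2 powR1 mulr1 powR2D mulrA.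
- have [M M0 HM] := sequence_interpolation al12 r20 s20 thE b1b b2b b0 (1 + 1 + G).
  exists (2 `^ (al + 1) * M); first by rewrite mulr_gt0 ?powR2_gt0.
  move=> F X Y y c1 c2 w F0 Fnd y0 Fy X0 Y0 w0 yw c1b c2b c1s c2s w1 w2.
  set b := _ + _ in b0 HM *.
  (* A positive summable sequence, added so that [e k] has a logarithm. *)
  pose g k : R := expR (- (1 * `|k_(k)|)).
  have g0 k : 0 < g k by exact: expR_gt0.
  pose e k := c1 k + c2 k + g k.
  have c10 k : 0 <= c1 k by case/andP: (c1b k).
  have c20 k : 0 <= c2 k by case/andP: (c2b k).
  have e0 k : 0 < e k by rewrite ltr_wpDl// addr_ge0.
  have KX0 : 0 < K1 * X by rewrite mulr_gt0.
  have KY0 : 0 < K2 * Y by rewrite mulr_gt0.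
  have PP0 : 0 <= M * ((K1 * X) `^ (1 - th) * (K2 * Y) `^ th).
    by rewrite !mulr_ge0 ?powR_ge0// ltW.
  apply: (@le_trans _ _ ((2 `^ (al + 1))%:E * (((M * ((K1 * X) `^ (1 - th) * (K2 * Y) `^ th))
     `^ b^-1)%:E `^ (b^-1)^-1))%E); last first.
    rewrite poweR_EFin -powRrM mulfV; last by rewrite invr_eq0 gt_eqF.
    by rewrite powRr1// -EFinM lee_fin [leLHS]mulrA lexx.
  apply: le_trans (lorentz_profile_dyadic _ al_ge0 y0 F0 Fnd Fy) _; first by rewrite invr_gt0.
  apply: lee_wpmul2l; first by rewrite lee_fin powR_ge0.
  apply: gt0_ler_poweRW; first by rewrite invrK ltW.
    by apply: nneseries_ge0 => *; rewrite lee_fin powR_ge0.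
  apply: (HM _ _ e w) => //.
  - under eq_eseriesr do rewrite /e !EFinD.
    rewrite nneseriesD//; last 2 first.
      by move=> *; rewrite adde_ge0// lee_fin.
      by move=> *; rewrite lee_fin ltW.
    rewrite nneseriesD//; [|by move=> *; rewrite lee_fin..].
    rewrite !EFinD; apply: leeD; first exact: leeD.
    by apply: HG => i j; exact: zenum_sep.
  - move=> j k; have := w1 j k (e k) (e0 k).
    rewrite powR2D !mulrA; apply.
    by rewrite /e -addrA lerDl addr_ge0// ltW.
  - move=> j k; have := w2 j k (e k) (e0 k).
    rewrite e2 powR2D !mulrA; apply.
    by rewrite /e (addrC (c1 k)) -addrA lerDl addr_ge0// ltW.
Qed.

(** In the application [F] is a rearrangement, [N1 h] and [N2 h] are the spatial
norms of a time derivative of the heat flow, [al1] and [al2] are [1/p1] and [1/p2],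
and [v h] is a mean value of that derivative over a level set of measure at least
[t]. *)
Theorem profile_interpolation : exists2 c : R, 0 < c & forall F N1 N2,
  (forall t, 0 < t -> (0 <= F t < +oo)%E) ->
  (forall t u, 0 < t -> t <= u -> (F u <= F t)%E) ->
  (forall h, 0 < h -> (0 <= N1 h)%E) -> (forall h, 0 < h -> (0 <= N2 h)%E) ->
  (forall t y : R, 0 < t -> 0 < y -> (y%:E < F t)%E -> exists v : R -> R,
    [/\ measurable_fun Rpos v, forall h, 0 < h -> 0 <= v h,
      forall h, 0 < h -> ((v h)%:E <= (t `^ (- al1))%:E * N1 h)%E,
      forall h, 0 < h -> ((v h)%:E <= (t `^ (- al2))%:E * N2 h)%E &
      (y%:E <= \int[leb]_(h in Rpos) ((h `^ (mm - 1))%:E * (v h)%:E))%E]) ->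
  (lorentz_profile al q F <=
    c%:E * mean_norm mm r q1 N1 `^ (1 - th) * mean_norm mm s q2 N2 `^ th)%E.
Proof.
have [c c0 Hc] := measurable_profile_interpolation.
exists c => // F N1 N2 F0 Fnd N10 N20 H.
(* Half the value of [F] lies strictly below it, as the hypothesis demands. *)
pose y j := fine (F (2 `^ k_(j))) / 2.
have Ffin j : F (2 `^ k_(j)) \is a fin_num.
  by have /andP[F1 F2] := F0 _ (powR2_gt0 k_(j)); rewrite ge0_fin_numE.
have Fy j : F (2 `^ k_(j)) = (2 * y j)%:E.
  by rewrite /y mulrC divfK ?pnatr_eq0// fineK.
have y0 j : 0 <= y j.
  by rewrite divr_ge0// fine_ge0//; have /andP[] := F0 _ (powR2_gt0 k_(j)).
have /choice[v Hv] j : exists v : R -> R,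
    [/\ measurable_fun Rpos v, forall h, 0 < h -> 0 <= v h,
      forall h, 0 < h -> ((v h)%:E <= (2 `^ (- al1 * k_(j)))%:E * N1 h)%E,
      forall h, 0 < h -> ((v h)%:E <= (2 `^ (- al2 * k_(j)))%:E * N2 h)%E &
      ((y j)%:E <= \int[leb]_(h in Rpos) ((h `^ (mm - 1))%:E * (v h)%:E))%E].
  have [yz|ynz] := eqVneq (y j) 0.
    exists (fun=> 0); split => //.
    - by move=> h h0; rewrite mule_ge0 ?N10// lee_fin powR_ge0.
    - by move=> h h0; rewrite mule_ge0 ?N20// lee_fin powR_ge0.
    - by rewrite yz; apply: integral_ge0 => h _; rewrite mule0.
  have yj0 : 0 < y j by rewrite lt_neqAle eq_sym ynz y0.
  have := H (2 `^ k_(j)) (y j) (powR2_gt0 _) yj0.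
  rewrite Fy lte_fin ltr_pMl// ltr1n => /(_ isT).
  by rewrite -!powRrM ![k_(j) * - _]mulrC.
have [n1 [mn1 n1N vn1]] := measurable_minorant (fun j => let: And5 a _ _ _ _ := Hv j in a)
  (fun j => let: And5 _ a _ _ _ := Hv j in a) (fun j => let: And5 _ _ a _ _ := Hv j in a).
have [n2 [mn2 n2N vn2]] := measurable_minorant (fun j => let: And5 a _ _ _ _ := Hv j in a)
  (fun j => let: And5 _ a _ _ _ := Hv j in a) (fun j => let: And5 _ _ _ a _ := Hv j in a).
have n10 h : 0 < h -> (0 <= n1 h)%E by move=> /n1N/andP[].
have n20 h : 0 < h -> (0 <= n2 h)%E by move=> /n2N/andP[].
apply: le_trans (Hc F n1 n2 y v _ Fnd y0 Fy mn1 mn2 n10 n20 _ _ vn1 vn2 _) _.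
- by move=> t /F0/andP[].
- by move=> j; have [] := Hv j.
- by move=> j; have [] := Hv j.
- by move=> j; have [] := Hv j.
apply: lee_pmul.
- by rewrite mule_ge0 ?poweR_ge0// lee_fin ltW.
- exact: poweR_ge0.
- apply: lee_wpmul2l; first by rewrite lee_fin ltW.
  apply: gt0_ler_poweRW; [by rewrite subr_ge0 ltW|exact: mean_norm_ge0|].
  exact: le_mean_norm.
- apply: gt0_ler_poweRW; [exact: ltW|exact: mean_norm_ge0|exact: le_mean_norm].
Qed.

End profile_theorem.

(** * Recovering a function from a derivative of high order *)

Section derivative_chain.
Context {R : realType}.
Notation leb := (@lebesgue_measure R).
Notation Rpos := (`]0%R, +oo[%classic : set (measurableTypeR R)).
Variable U : nat -> R -> R.
Hypothesis dU : forall i (h : R), 0 < h -> is_derive h 1 (U i) (U i.+1 h).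
Hypothesis Uinf : forall i (e : R), 0 < e -> exists A : R, forall h, A <= h -> `|U i h| <= e.

Lemma chain_continuous i (h : R) : 0 < h -> {for h, continuous (U i)}.
Proof.
by move=> h0; apply: differentiable_continuous; apply/derivable1_diffP; case: (dU i h0).
Qed.

Lemma measurable_chain i : measurable_fun Rpos (U i).
Proof.
apply: open_continuous_measurable_fun; first exact: interval_open.
by move=> h; rewrite inE => hpos; apply: chain_continuous; rewrite -Rpos_gt0.
Qed.

(** The fundamental theorem of calculus on [[a, b]], with [b] so large that [U i b]
is negligible. *)
Lemma chain_le_tail_integral i (a : R) : 0 < a ->
  (`|U i a|%:E <= \int[leb]_(t in `]a, +oo[) `|U i.+1 t|%:E)%E.
Proof.
move=> a0; apply/lee_addgt0Pr => e e0.
have [A HA] := Uinf i e0.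
pose b := Num.max (a + 1) A.
have ab : a < b by rewrite lt_max ltrDl ltr01.
have Ub : `|U i b| <= e by apply: HA; rewrite le_max lexx orbT.
have cU j : {within `[a, b], continuous (U j)}.
  apply: continuous_in_subspaceT => h; rewrite inE/= in_itv/= => /andP[ah _].
  by apply: chain_continuous; exact: lt_le_trans ah.
have FTC : (\int[leb]_(x in `[a, b]) (U i.+1 x)%:E = (U i b)%:E - (U i a)%:E)%E.
  apply: continuous_FTC2 => //.
  - split.
    + move=> h; rewrite in_itv/= => /andP[ah _].
      by case: (dU i (lt_trans a0 ah)).
    + by apply: cvg_at_right_filter; exact: chain_continuous.
    + by apply: cvg_at_left_filter; apply: chain_continuous; exact: lt_trans ab.
  - move=> h; rewrite in_itv/= => /andP[ah _].
    by rewrite derive1E; have := dU i (lt_trans a0 ah) => -[_ ->].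
have mab j : measurable_fun (`[a, b]%classic : set (measurableTypeR R)) (U j).
  by apply: subspace_continuous_measurable_fun; [exact: measurable_itv|exact: cU].
have le1 : (`|\int[leb]_(x in `[a, b]) (U i.+1 x)%:E| <=
    \int[leb]_(x in `[a, b]) `|U i.+1 x|%:E)%E.
  apply: le_abse_integral; first exact: measurable_itv.
  by apply/measurable_EFinP; exact: mab.
have le2 : (\int[leb]_(x in `[a, b]) `|U i.+1 x|%:E <=
    \int[leb]_(t in `]a, +oo[) `|U i.+1 t|%:E)%E.
  rewrite -[leLHS]integral_itv_obnd_cbnd; last first.
    apply/measurable_EFinP; apply: measurableT_comp => //.
    apply: measurable_funS (mab i.+1); first exact: measurable_itv.
    by apply: subset_itvr; rewrite bnd_simp.
  apply: ge0_subset_integral => //=.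
  - apply/measurable_EFinP; apply: measurableT_comp => //.
    apply: measurable_funS (measurable_chain i.+1); first exact: measurable_itv.
    by move=> t /=; rewrite !in_itv/= !andbT; exact: lt_trans.
  - by move=> t /=; rewrite !in_itv/= andbT => /andP[].
apply: (@le_trans _ _ (`|U i b - U i a|%:E + `|U i b|%:E)%E).
  rewrite -EFinD lee_fin; have := ler_distD (U i b) (U i a) 0.
  by rewrite !subr0 distrC.
apply: leeD; last by rewrite lee_fin.
by move: le1; rewrite FTC -EFinB => /le_trans; apply.
Qed.

(** Tonelli: the weight of [|U^(i+2)(t)|] in the iterated integral is the integral
of [h^i] over [0 < h < t]. *)
Lemma chain_moment_step i :
  (\int[leb]_(h in Rpos) ((h ^+ i)%:E * `|U i.+1 h|%:E) <=
   \int[leb]_(h in Rpos) ((h ^+ i.+1)%:E * `|U i.+2 h|%:E))%E.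
Proof.
pose V (t : R) := `|U i.+2 t| * \1_Rpos t.
have mRpos : measurable Rpos by exact: measurable_itv.
have V0 t : 0 <= V t by rewrite mulr_ge0.
have mV : measurable_fun setT V.
  rewrite (_ : V = (fun t => `|U i.+2 t|) \_ Rpos).
    apply/(measurable_restrictT _ mRpos); apply: measurableT_comp => //.
    exact: measurable_chain.
  by apply/funext => t; rewrite /V patchE indicE; case: ifP; rewrite ?mulr1 ?mulr0.
pose P (h t : R) := (`|h| ^+ i * (\1_[set z : measurableTypeR R * measurableTypeR R | 0 < z.1 < z.2] (h, t) * V t))%:E.
have P0 h t : (0 <= P h t)%E by rewrite lee_fin !mulr_ge0 ?exprn_ge0.
have mP : measurable_fun setT (fun z : measurableTypeR R * measurableTypeR R => P z.1 z.2).
  apply/measurable_EFinP; apply: measurable_funM.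
    apply: measurable_funX; apply: measurableT_comp => //; exact: measurable_fst.
  apply: measurable_funM; last exact: measurableT_comp mV measurable_snd.
  rewrite (_ : (fun _ => _) = \1_[set z : measurableTypeR R * measurableTypeR R | 0 < z.1 < z.2]); last first.
    by apply/funext => -[].
  apply: measurable_indic.
  have -> : [set z : measurableTypeR R * measurableTypeR R | 0 < z.1 < z.2] =
     [set z | 0 < z.1] `&` [set z | z.1 < z.2].
    by apply/seteqP; split => [z /= /andP[]//|z /= [-> ->]].
  apply: measurableI.
    rewrite -[X in measurable X]setTI; apply: measurable_fun_ltr => //.
  rewrite -[X in measurable X]setTI; apply: measurable_fun_ltr => //.
have in1 (h t : R) : \1_[set z : measurableTypeR R * measurableTypeR R | 0 < z.1 < z.2] (h, t)
   = if 0 < h < t then 1 else 0 :> R.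
  by rewrite indicE; case: (boolP (0 < h < t)) => c; [rewrite mem_set|rewrite memNset//=; exact/negP].
apply: (@le_trans _ _ (\int[leb]_h \int[leb]_t P h t)%E).
  rewrite [leLHS]integral_mkcond.
  apply: ge0_le_integral_any => h _.
    by rewrite erestrict_ge0// => t; rewrite Rpos_gt0 => t0; rewrite mule_ge0// lee_fin exprn_ge0// ltW.
  rewrite patchE; case: ifP => [|_]; last exact: integral_ge0.
  rewrite inE Rpos_gt0 => h0.
  have := chain_le_tail_integral i.+1 h0.
  have hi0 : (0 <= (h ^+ i)%:E)%E by rewrite lee_fin exprn_ge0// ltW.
  move=> /(lee_wpmul2l hi0)/le_trans; apply.
  have mU2 : measurable_fun (`]h, +oo[%classic : set (measurableTypeR R))
      (fun t => `|U i.+2 t|%:E).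
    apply/measurable_EFinP; apply: measurableT_comp => //.
    apply: measurable_funS (measurable_chain i.+2); first exact: measurable_itv.
    by move=> t /=; rewrite !in_itv/= !andbT; exact: lt_trans.
  rewrite -(@ge0_integralZl _ _ _ leb _ (measurable_itv _) _ mU2)//.
  rewrite integral_mkcond; apply: ge0_le_integral_any => t _.
    by rewrite erestrict_ge0// => x _; rewrite mule_ge0.
  rewrite patchE; case: ifP => [|_//]; rewrite inE/= in_itv/= andbT => ht.
  rewrite /P in1 h0 ht /= mul1r /V indicE mem_set ?Rpos_gt0 ?(lt_trans h0 ht)//.
  by rewrite mulr1 (gtr0_norm h0) -EFinM.
rewrite (@fubini_tonelli _ _ _ _ _ leb leb _ mP (fun z => P0 z.1 z.2)).
rewrite [leRHS]integral_mkcond; apply: ge0_le_integral_any => t _ /=.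
  exact: integral_ge0.
apply: (@le_trans _ _ (\int[leb]_(h in `]0%R, t[) ((t ^+ i * V t)%:E))%E).
  rewrite [leRHS]integral_mkcond; apply: ge0_le_integral_any => h _ //.
  rewrite patchE /P in1; case: (boolP (0 < h < t)) => c; last first.
    by rewrite memNset/= ?in_itv/= ?mul0r ?mulr0//; exact/negP.
  rewrite mem_set/= ?in_itv//= mul1r lee_fin ler_wpM2r//.
  case/andP: c => h0 ht; rewrite ger0_norm ?(ltW h0)//.
  by rewrite lerXn2r ?nnegrE ?(ltW ht) ?(ltW h0) ?(ltW (lt_trans h0 ht)).
rewrite integral_cst; last exact: measurable_itv.
rewrite patchE /V indicE; case: (boolP (t \in Rpos)) => tp; last by rewrite !mulr0 mul0e.
move: tp; rewrite inE Rpos_gt0 => t0.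
rewrite [X in (_ * X)%E]lebesgue_measure_itv/= lte_fin t0 -EFinD subr0 mulr1 -EFinM.
by rewrite -EFinM lee_fin exprSr mulrAC.
Qed.

(** Near 0, [|U 0|] is at most the integral of [|U 1|], which [chain_moment_step]
replaces by the weighted integrals of the higher derivatives. *)
Lemma chain_limit_le (L : R) m :
  (forall e, 0 < e -> exists2 d : R, 0 < d & forall h, 0 < h < d -> L - e <= `|U 0 h|) ->
  (L%:E <= \int[leb]_(h in Rpos) ((h `^ (m.+1%:R - 1))%:E * `|U m.+1 h|%:E))%E.
Proof.
move=> U0.
have -> : (\int[leb]_(h in Rpos) ((h `^ (m.+1%:R - 1))%:E * `|U m.+1 h|%:E) =
   \int[leb]_(h in Rpos) ((h ^+ m)%:E * `|U m.+1 h|%:E))%E.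
  apply: eq_integral => h; rewrite inE Rpos_gt0 => h0.
  by rewrite -natr1 addrK powR_mulrn// ltW.
apply: (@le_trans _ _ (\int[leb]_(h in Rpos) ((h ^+ 0)%:E * `|U 1 h|%:E))%E); last first.
  by elim: m => // m IH; apply: le_trans IH (chain_moment_step m).
apply/lee_addgt0Pr => e e0; have [d d0 Ud] := U0 e e0.
have d20 : 0 < d / 2 by rewrite divr_gt0.
have := Ud (d / 2); rewrite d20 ltr_pdivrMr// ltr_pMr// ltr1n => /(_ isT).
rewrite lerBlDr -lee_fin EFinD => /le_trans; apply.
rewrite leeD2r//; apply: (le_trans (chain_le_tail_integral 0 d20)).
have sub : (`]d / 2, +oo[%classic : set (measurableTypeR R)) `<=` Rpos.
  by move=> t /=; rewrite !in_itv/= !andbT; exact: lt_trans.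
under [leRHS]eq_integral do rewrite expr0 mul1e.
apply: ge0_subset_integral => //=; try exact: measurable_itv.
by apply/measurable_EFinP; apply: measurableT_comp => //; exact: measurable_chain.
Qed.

End derivative_chain.

(** * Lebesgue measure on R^n: invariance and Gaussian mass *)

Section image_integral.
Local Open Scope ereal_scope.
Context d1 d2 (X : measurableType d1) (Y : measurableType d2) (R : realType).
Variables (mu : {measure set X -> \bar R}) (nu : {measure set Y -> \bar R}).

Lemma ge0_integral_image (phi : X -> Y) (F : Y -> \bar R) :
  measurable_fun setT phi ->
  (forall A, measurable A -> nu A = mu (phi @^-1` A)) ->
  measurable_fun setT F -> (forall y, 0 <= F y) ->
  \int[nu]_y F y = \int[mu]_x F (phi x).
Proof.
move=> mphi numu mF F0.
rewrite -[RHS](@ge0_integral_pushforward _ _ _ _ _ _ mphi mu setT F)//.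
by apply: eq_measure_integral => A mA _; exact: numu.
Qed.

End image_integral.

Section translations.
Context {R : realType}.
Notation mR := (measurableTypeR R).
Notation leb := (@lebesgue_measure R).
Notation T n := (n.-tuple mR).
Notation mu n := (borel_lebesgue R n).

Lemma lebesgue_measure_translate (a : R) (A : set mR) : measurable A ->
  leb A = leb ((fun x : mR => x - a) @^-1` A).
Proof.
move=> mA; have mf : measurable_fun setT (fun x : mR => x - a : mR).
  exact: measurable_funB.
rewrite -/(pushforward leb (fun x : mR => x - a : mR) A).
apply: (@lebesgue_measure_unique R (pushforward leb (fun x : mR => x - a : mR))) => //.
move=> _ [[c d] _ <-]; rewrite -[RHS]/(leb ((fun x : mR => x - a) @^-1` `]c, d]%classic)).
rewrite (_ : _ @^-1` _ = `](c + a), (d + a)]%classic); last first.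
  by apply/seteqP; split => x /=; rewrite !in_itv/= ltrBrDr lerBlDr.
rewrite !lebesgue_measure_itv/= !lte_fin ltrD2r -!EFinB.
by have -> : d + a - (c + a) = d - c by ring.
Qed.

Lemma lebesgue_measure_reflect (a : R) (A : set mR) : measurable A ->
  leb A = leb ((fun x : mR => a - x) @^-1` A).
Proof.
move=> mA; have mf : measurable_fun setT (fun x : mR => a - x : mR).
  exact: measurable_funB.
rewrite -/(pushforward leb (fun x : mR => a - x : mR) A).
apply: (@lebesgue_measure_unique R (pushforward leb (fun x : mR => a - x : mR))) => //.
move=> _ [[c d] _ <-]; rewrite -[RHS]/(leb ((fun x : mR => a - x) @^-1` `]c, d]%classic)).
rewrite (_ : _ @^-1` _ = `[(a - d), (a - c)[%classic); last first.
  apply/seteqP; split => x /=; rewrite !in_itv/= => /andP[? ?]; apply/andP; split; lra.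
rewrite !lebesgue_measure_itv/= !lte_fin ltrD2l ltrN2 -!EFinB.
by have -> : a - c - (a - d) = d - c by ring.
Qed.

(** Convertible to [subRn], but on the Borel space, where the decomposition of
[R^(n+1)] as a product is available. *)
Definition tsub n (x y : T n) : T n := [tuple tnth x i - tnth y i | i < n].

Lemma measurable_tsub n d (S : measurableType d) (f g : S -> T n) :
  measurable_fun setT f -> measurable_fun setT g ->
  measurable_fun setT (fun s => tsub (f s) (g s)).
Proof.
move=> mf mg; apply/measurable_fun_tnthP => i.
rewrite (_ : _ \o _ = (fun s => tnth (f s) i - tnth (g s) i)); last first.
  by apply/funext => s /=; rewrite tnth_mktuple.
apply: measurable_funB.
  exact: measurableT_comp (measurable_tnth i) mf.
exact: measurableT_comp (measurable_tnth i) mg.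
Qed.

Lemma tsub_cons n (a b : mR) (x y : T n) :
  tsub (cons_pair (a, x)) (cons_pair (b, y)) = cons_pair (a - b, tsub x y).
Proof.
apply: eq_from_tnth => i; rewrite tnth_mktuple.
case: (unliftP ord0 i) => [j ->|->]; last by rewrite !tnth0.
by rewrite !tnthS tnth_mktuple.
Qed.

Lemma cons_pair_surj n (z : T n.+1) : exists a x, z = cons_pair (a, x).
Proof.
by exists (thead z), [tuple of behead z]; rewrite /cons_pair /= [LHS]tuple_eta.
Qed.

Local Open Scope ereal_scope.

Lemma measurable_cons_comp n (F : T n.+1 -> \bar R) : measurable_fun setT F ->
  measurable_fun setT (F \o @cons_pair R n).
Proof. by move=> mF; exact: measurableT_comp mF (@measurable_cons_pair R n). Qed.

Lemma integral_cons n (F : T n.+1 -> \bar R) : measurable_fun setT F ->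
  (forall z, 0 <= F z) ->
  \int[mu n.+1]_z F z = \int[leb]_x \int[mu n]_t F (cons_pair (x, t)).
Proof.
move=> mF F0.
rewrite (@ge0_integral_image _ _ _ _ _ (leb \x mu n) (mu n.+1) (@cons_pair R n))//.
  rewrite fubini_tonelli1//; exact: measurable_cons_comp.
exact: measurable_cons_pair.
Qed.

Lemma integral_cons_swap n (F : T n.+1 -> \bar R) : measurable_fun setT F ->
  (forall z, 0 <= F z) ->
  \int[mu n.+1]_z F z = \int[mu n]_t \int[leb]_x F (cons_pair (x, t)).
Proof.
move=> mF F0; rewrite integral_cons//.
exact: (@fubini_tonelli _ _ _ _ _ leb (mu n) _ (measurable_cons_comp mF) (fun z => F0 _)).
Qed.

Lemma measurable_cons_section n (F : T n.+1 -> \bar R) (x : mR) :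
  measurable_fun setT F -> measurable_fun setT (fun t => F (cons_pair (x, t))).
Proof.
move=> mF; have := measurable_cons_comp mF => /measurableT_comp; apply.
exact: measurable_pair1.
Qed.

Lemma measurable_cons_integral n (F : T n.+1 -> \bar R) : measurable_fun setT F ->
  (forall z, 0 <= F z) ->
  measurable_fun setT (fun x : mR => \int[mu n]_t F (cons_pair (x, t))).
Proof.
move=> mF F0.
exact: (@measurable_fun_fubini_tonelli_F _ _ _ _ _ (mu n) _ (measurable_cons_comp mF) (fun z => F0 _)).
Qed.

Lemma measurable_cons_integral_swap n (F : T n.+1 -> \bar R) : measurable_fun setT F ->
  (forall z, 0 <= F z) ->
  measurable_fun setT (fun t : T n => \int[leb]_x F (cons_pair (x, t))).
Proof.
move=> mF F0.
exact: (@measurable_fun_fubini_tonelli_G _ _ _ _ _ leb _ (measurable_cons_comp mF) (fun z => F0 _)).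
Qed.

(** By induction on [n] and Tonelli's theorem from the invariance on the line; the
same holds for reflections. *)
Lemma integral_translate n (F : T n -> \bar R) (y : T n) : measurable_fun setT F ->
  (forall z, 0 <= F z) -> \int[mu n]_x F (tsub x y) = \int[mu n]_x F x.
Proof.
elim: n F y => [|n IH] F y mF F0.
  by apply: eq_integral => x _; rewrite (tuple0 (tsub x y)) (tuple0 x).
have [b [y' ->]] := cons_pair_surj y.
have mFs z : measurable_fun setT (fun x => F (tsub x z)).
  by apply: measurableT_comp mF _; apply: measurable_tsub => //; exact: measurable_cst.
rewrite (integral_cons mF F0) (integral_cons (mFs _) (fun z => F0 _)).
under eq_integral => x _.
  under eq_integral do rewrite tsub_cons.
  rewrite (IH (fun t => F (cons_pair ((x - b)%R, t))))//; last first.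
    exact: (measurable_cons_section (x - b)%R mF).
  over.
rewrite -(@ge0_integral_image _ _ _ _ _ leb leb (fun x : mR => (x - b)%R)
  (fun x => \int[mu n]_t F (cons_pair (x, t))))//.
- exact: measurable_funB.
- by move=> A mA; exact: lebesgue_measure_translate.
- exact: measurable_cons_integral.
- by move=> x; exact: integral_ge0.
Qed.

Lemma integral_reflect n (F : T n -> \bar R) (y : T n) : measurable_fun setT F ->
  (forall z, 0 <= F z) -> \int[mu n]_x F (tsub y x) = \int[mu n]_x F x.
Proof.
elim: n F y => [|n IH] F y mF F0.
  by apply: eq_integral => x _; rewrite (tuple0 (tsub y x)) (tuple0 x).
have [b [y' ->]] := cons_pair_surj y.
have mFs z : measurable_fun setT (fun x => F (tsub z x)).
  by apply: measurableT_comp mF _; apply: measurable_tsub => //; exact: measurable_cst.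
rewrite (integral_cons mF F0) (integral_cons (mFs _) (fun z => F0 _)).
under eq_integral => x _.
  under eq_integral do rewrite tsub_cons.
  rewrite (IH (fun t => F (cons_pair ((b - x)%R, t))))//; last first.
    exact: (measurable_cons_section (b - x)%R mF).
  over.
rewrite -(@ge0_integral_image _ _ _ _ _ leb leb (fun x : mR => (b - x)%R)
  (fun x => \int[mu n]_t F (cons_pair (x, t))))//.
- exact: measurable_funB.
- by move=> A mA; exact: lebesgue_measure_reflect.
- exact: measurable_cons_integral.
- by move=> x; exact: integral_ge0.
Qed.

End translations.

Section gaussian.
Context {R : realType}.
Notation mR := (measurableTypeR R).
Notation leb := (@lebesgue_measure R).
Notation T n := (n.-tuple mR).
Notation mu n := (borel_lebesgue R n).

Definition sqnorm n (y : T n) : R := \sum_(i < n) tnth y i ^+ 2.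

(** Convertible to [heat_kernel]. *)
Definition gauss n (h : R) (y : T n) : R :=
  (4 * pi * h) `^ (- (n%:R / 2)) * expR (- (sqnorm y / (4 * h))).

Lemma sqnorm_ge0 n (y : T n) : 0 <= sqnorm y.
Proof. by apply: sumr_ge0 => i _; exact: sqr_ge0. Qed.

Lemma measurable_sqnorm n : measurable_fun setT (@sqnorm n).
Proof.
apply: measurable_sum => i; apply: measurable_funX; exact: measurable_tnth.
Qed.

Lemma measurable_gauss n h : measurable_fun setT (@gauss n h).
Proof.
apply: measurable_funM => //; apply: measurableT_comp => //.
apply: measurableT_comp => //; apply: measurable_funM => //.
exact: measurable_sqnorm.
Qed.

Lemma gauss_ge0 n h (y : T n) : 0 <= gauss h y.
Proof. by rewrite mulr_ge0 ?powR_ge0 ?expR_ge0. Qed.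

Lemma sqnorm_cons n (x : mR) (t : T n) : sqnorm (cons_pair (x, t)) = x ^+ 2 + sqnorm t.
Proof.
rewrite /sqnorm big_ord_recl tnth0; congr (_ + _).
by apply: eq_bigr => i _; rewrite tnthS.
Qed.

(** The kernel at time [h] is a product of normal densities of variance [2 h]. *)
Lemma gauss_cons n (h : R) (x : mR) (t : T n) : 0 < h ->
  gauss h (cons_pair (x, t)) = normal_pdf 0 (Num.sqrt (2 * h)) x * gauss h t.
Proof.
move=> h0; have h20 : 0 < 2 * h by rewrite mulr_gt0.
have s0 : Num.sqrt (2 * h) != 0 by rewrite gt_eqF// sqrtr_gt0.
have ph0 : 0 < 4 * pi * h :> R by rewrite !mulr_gt0// pi_gt0.
rewrite normal_pdfE// /normal_peak /normal_fun sqr_sqrtr ?(ltW h20)//.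
have -> : (Num.sqrt (2 * h * pi *+ 2))^-1 = (4 * pi * h) `^ (- 2^-1) :> R.
  rewrite powRN powR12_sqrt ?(ltW ph0)//; congr (Num.sqrt _)^-1.
  by rewrite -mulr_natr; ring.
rewrite /gauss sqnorm_cons mulrACA -expRD -powRD ?(gt_eqF ph0) ?implybT//.
congr (_ `^ _ * expR _); first by rewrite -natr1; field.
rewrite subr0 -mulr_natr; field.
by rewrite gt_eqF.
Qed.

Local Open Scope ereal_scope.

Lemma integral_gauss n h : (0 < h)%R -> \int[mu n]_y (gauss h y)%:E = 1.
Proof.
move=> h0; elim: n => [|n IH].
  rewrite [LHS](@integral_dirac _ _ [tuple] R setT)// ?diracT ?mul1e.
    by rewrite /gauss /sqnorm big_ord0 !mul0r oppr0 powRr0 expR0 mulr1.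
  by apply/measurable_EFinP; exact: measurable_gauss.
have mg k : measurable_fun setT (fun y : T k => (gauss h y)%:E).
  by apply/measurable_EFinP; exact: measurable_gauss.
have s0 : Num.sqrt (2 * h) != 0%R by rewrite gt_eqF// sqrtr_gt0 mulr_gt0.
rewrite integral_cons//; last by move=> z; rewrite lee_fin gauss_ge0.
rewrite -[RHS](@integral_normal_pdf R 0%R (Num.sqrt (2 * h))).
apply: eq_integral => x _.
under eq_integral do rewrite gauss_cons// EFinM.
have g0 (y : T n) : setT y -> 0 <= (gauss h y)%:E by rewrite lee_fin gauss_ge0.
rewrite (ge0_integralZl_EFin _ measurableT g0 (mg n)) ?normal_pdf_ge0//.
by rewrite [X in _ * X]IH mule1.
Qed.

End gaussian.

(** * Time derivatives of the heat kernel *)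

Section heat_kernel_derivatives.
Context {R : realType}.
Notation mR := (measurableTypeR R).
Notation T n := (n.-tuple mR).
Notation mu n := (borel_lebesgue R n).

(** Differentiating [h^(-a-i) exp(-z) Q(z)] in [h], where [z] is proportional to
[1/h], replaces [i] by [i+1] and [Q] by the polynomial below. *)
Fixpoint heat_poly (a : R) (i : nat) : {poly R} :=
  if i is j.+1 then
    (- (a + j%:R))%:P * heat_poly a j + 'X * heat_poly a j - 'X * (heat_poly a j)^`()
  else 1.

(** The [i]-th derivative in [h] of the Gaussian kernel. *)
Definition heatK n (i : nat) (h : R) (y : T n) : R :=
  (4 * pi) `^ (- (n%:R / 2)) * (h `^ (- (n%:R / 2 + i%:R)) *
    (expR (- (sqnorm y / 4 * h `^ (-1))) *
     (heat_poly (n%:R / 2) i).[sqnorm y / 4 * h `^ (-1)])).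

Lemma heatK0 n h (y : T n) : 0 < h -> heatK 0 h y = gauss h y.
Proof.
move=> h0; rewrite /heatK /gauss /= hornerC mulr1 addr0 mulrA.
rewrite -powRM ?(ltW h0)//; last by rewrite mulr_ge0// pi_ge0.
congr (_ * expR (- _)); rewrite powR_inv1 ?(ltW h0)//.
by field; rewrite gt_eqF.
Qed.

Lemma powR_subr1 (h a : R) : 0 < h -> h `^ (a - 1) = h `^ a * h `^ (-1).
Proof. by move=> h0; rewrite powRD// (gt_eqF h0) implybT. Qed.

Lemma is_derive_heatK n i (h : R) (y : T n) : 0 < h ->
  is_derive h 1 (fun h => heatK i h y) (heatK i.+1 h y).
Proof.
move=> h0; pose w := sqnorm y / 4; pose Q := heat_poly (n%:R / 2) i.
pose a : R := n%:R / 2 + i%:R.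
pose z (h : R) := w * h `^ (-1).
have dz : is_derive h 1 z (- (z h * h `^ (-1))).
  have dp := @is_derive1_powR R (-1) h h0.
  have -> : z = w \*: (fun h : R => h `^ (-1)) by apply/funext.
  apply: is_derive_eq; rewrite /z /GRing.scale /=.
  rewrite powR_subr1// -[w *: _]/(w * h `^ (-1)); ring.
have de : is_derive h 1 (fun h => expR (- z h)) (expR (- z h) * (z h * h `^ (-1))).
  have d1 : is_derive h 1 (\- z) (z h * h `^ (-1)).
    by rewrite -[z h * _]opprK; exact: is_deriveN.
  have := @is_derive1_comp R expR (\- z) h _ _ (is_derive_expR _) d1.
  by move=> H; apply: is_derive_eq H _ => /=; ring.
have dQ : is_derive h 1 (fun h => Q.[z h]) (Q^`().[z h] * - (z h * h `^ (-1))).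
  exact: (@is_derive1_comp R (horner Q) z h _ _ (is_derive_poly _ _) dz).
have dp := @is_derive1_powR R (- a) h h0.
have -> : (fun h => heatK i h y) = ((4 * pi) `^ (- (n%:R / 2)) \*:
    ((fun h : R => h `^ (- a)) * ((fun h => expR (- z h)) * (fun h => Q.[z h])))).
  by apply/funext => x.
apply: is_derive_eq.
rewrite /heatK -/w -/Q -/(z h) /= -/Q -/a.
have -> : - (n%:R / 2 + i.+1%:R) = - a - 1 by rewrite /a -natr1; ring.
rewrite !(hornerD, hornerN, hornerM, hornerC, hornerX) powR_subr1//.
change ((4 * pi) `^ (- (n%:R / 2)) * (h `^ (- a) *
    (expR (- z h) * (Q^`().[z h] * - (z h * h `^ (-1))) +
     Q.[z h] * (expR (- z h) * (z h * h `^ (-1)))) +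
   (expR (- z h) * Q.[z h]) * (- a * (h `^ (- a) * h `^ (-1)))) =
  (4 * pi) `^ (- (n%:R / 2)) * (h `^ (- a) * h `^ (-1) *
   (expR (- z h) * (- a * Q.[z h] + z h * Q.[z h] - z h * Q^`().[z h])))).
ring.
Qed.

Lemma poly_exp_bound (Q : {poly R}) (e : R) : 0 < e ->
  exists2 C : R, 0 < C & forall z, 0 <= z -> `|Q.[z]| <= C * expR (e * z).
Proof.
elim/poly_ind: Q e => [|Q c IH] e e0.
  by exists 1 => // z z0; rewrite horner0 normr0 mul1r expR_ge0.
have e20 : 0 < e / 2 by rewrite divr_gt0.
have [C C0 HC] := IH _ e20.
exists (C * (e / 2)^-1 + `|c| + 1).
  by rewrite ltr_wpDl// addr_ge0// mulr_ge0 ?invr_ge0 ?(ltW C0) ?(ltW e20).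
move=> z z0; rewrite hornerMXaddC.
apply: (le_trans (ler_normD _ _)); rewrite normrM (ger0_norm z0).
have z1 : z <= (e / 2)^-1 * expR (e / 2 * z).
  rewrite mulrC ler_pdivlMr// mulrC.
  by apply: le_trans (expR_ge1Dx _); rewrite lerDr.
have E : expR (e * z) = expR (e / 2 * z) * expR (e / 2 * z).
  by rewrite -expRD; congr expR; field.
have E1 : 1 <= expR (e * z) by rewrite -expR0 ler_expR mulr_ge0// ltW.
have : `|Q.[z]| * z <= C * (e / 2)^-1 * expR (e * z).
  apply: (le_trans (ler_pM _ z0 (HC z z0) z1)) => //.
  by rewrite E mulrACA.
have : `|c| <= `|c| * expR (e * z) by rewrite ler_peMr.
have : 0 <= expR (e * z) by exact: expR_ge0.
by rewrite !mulrDl mul1r; lra.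
Qed.

(** Half of the exponential absorbs the polynomial, which doubles the time. *)
Lemma heatK_bound n i : exists2 C : R, 0 < C & forall h (y : T n), 0 < h ->
  `|heatK i h y| <= C * h `^ (- i%:R) * gauss (2 * h) y.
Proof.
have [|C C0 HC] := @poly_exp_bound (heat_poly (n%:R / 2) i) 2^-1 => //.
exists (2 `^ (n%:R / 2) * C); first by rewrite mulr_gt0// powR_gt0.
move=> h y h0; rewrite /heatK; set z := sqnorm y / 4 * h `^ (-1).
have z0 : 0 <= z by rewrite mulr_ge0 ?powR_ge0// divr_ge0// sqnorm_ge0.
have p0 : 0 <= 4 * pi :> R by rewrite mulr_ge0// pi_ge0.
have -> : gauss (2 * h) y = 2 `^ (- (n%:R / 2)) * ((4 * pi) `^ (- (n%:R / 2)) *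
    (h `^ (- (n%:R / 2)) * (expR (- z) * expR (2^-1 * z)))).
  have -> : expR (- z) * expR (2^-1 * z) = expR (- (sqnorm y / (4 * (2 * h)))).
    rewrite -expRD /z powR_inv1 ?(ltW h0)//; congr expR.
    by field; rewrite gt_eqF.
  have p2 := powRM (- (n%:R / 2)) p0 (mulr_ge0 (ler0n _ 2) (ltW h0)).
  by rewrite /gauss p2 (powRM _ (ler0n _ 2) (ltW h0)); ring.
rewrite normrM [X in X * _]ger0_norm ?powR_ge0//.
rewrite normrM [X in _ * (X * _)]ger0_norm ?powR_ge0//.
rewrite normrM [X in _ * (_ * (X * _))]ger0_norm ?expR_ge0//.
rewrite opprD powRD; last by rewrite (gt_eqF h0) implybT.
have E2 : 2 `^ (n%:R / 2) * 2 `^ (- (n%:R / 2)) = 1 :> R.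
  by rewrite -powRD ?subrr ?powRr0// pnatr_eq0 implybT.
set a := (4 * pi) `^ _; set b := h `^ (- (n%:R / 2)); set c := h `^ (- i%:R).
set u := expR (- z).
have -> : 2 `^ (n%:R / 2) * C * c * (2 `^ (- (n%:R / 2)) * (a * (b * (u * expR (2^-1 * z))))) =
  a * (b * c * (u * (C * expR (2^-1 * z)))).
  rewrite -[RHS]mul1r -[X in _ = X * _]E2; ring.
rewrite ler_wpM2l ?powR_ge0// ler_wpM2l ?mulr_ge0 ?powR_ge0//.
by rewrite ler_wpM2l ?expR_ge0// HC.
Qed.

Lemma gauss_le n (a b : R) (y : T n) : 0 < a -> a <= b ->
  gauss a y <= (b / a) `^ (n%:R / 2) * gauss b y.
Proof.
move=> a0 ab; have b0 : 0 < b := lt_le_trans a0 ab.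
have p0 : 0 < 4 * pi :> R by rewrite mulr_gt0// pi_gt0.
rewrite /gauss [leRHS]mulrA.
have -> : (b / a) `^ (n%:R / 2) * (4 * pi * b) `^ (- (n%:R / 2)) =
    (4 * pi * a) `^ (- (n%:R / 2)).
  have -> : 4 * pi * b = 4 * pi * a * (b / a) by field; rewrite gt_eqF.
  rewrite (powRM _ (mulr_ge0 (ltW p0) (ltW a0)) (divr_ge0 (ltW b0) (ltW a0))).
  rewrite mulrCA -powRD ?subrr ?powRr0 ?mulr1//.
  by rewrite mulf_eq0 invr_eq0 (gt_eqF a0) (gt_eqF b0) implybT.
rewrite ler_wpM2l ?powR_ge0// ler_expR lerN2 ler_wpM2l ?sqnorm_ge0//.
by rewrite lef_pV2 ?posrE ?mulr_gt0// ler_pM2l.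
Qed.

Lemma measurable_heatK n i h : measurable_fun setT (@heatK n i h).
Proof.
have mz : measurable_fun setT (fun y : T n => sqnorm y / 4 * h `^ (-1)).
  by apply: measurable_funM => //; apply: measurable_funM => //; exact: measurable_sqnorm.
apply: measurable_funM => //; apply: measurable_funM => //.
apply: measurable_funM.
  by apply: measurableT_comp => //; apply: measurableT_comp => //.
apply: (measurableT_comp (f := horner (heat_poly (n%:R / 2) i)) _ mz).
by apply: continuous_measurable_fun; exact: continuous_horner.
Qed.

End heat_kernel_derivatives.

Section heat_integrals.
Context {R : realType}.
Notation mR := (measurableTypeR R).
Notation T n := (n.-tuple mR).
Notation mu n := (borel_lebesgue R n).

(** A growth condition that makes all the heat integrals of [F] converge. *)
Definition gauss_integrable n (F : T n -> R) := measurable_fun setT F /\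
  forall h, 0 < h -> (\int[mu n]_y (gauss h y * `|F y|)%:E < +oo)%E.

(** For [F y = f (x - y)] this is the [i]-th time derivative at [x] of the heat flow
of [f]. *)
Definition heatI n (i : nat) (F : T n -> R) (h : R) : R :=
  \int[mu n]_y (heatK i h y * F y).

Lemma integrable_gauss n (F : T n -> R) h : gauss_integrable F -> 0 < h ->
  (mu n).-integrable setT (fun y => (gauss h y * `|F y|)%:E).
Proof.
move=> [mF gF] h0; apply/integrableP; split.
  apply/measurable_EFinP; apply: measurable_funM; first exact: measurable_gauss.
  exact: measurableT_comp.
apply: le_lt_trans (gF h h0); apply: ge0_le_integral_any => y _ //.
by rewrite /= ger0_norm// mulr_ge0 ?gauss_ge0.
Qed.

Lemma integrable_heatK n i (F : T n -> R) h : gauss_integrable F -> 0 < h ->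
  (mu n).-integrable setT (fun y => (heatK i h y * F y)%:E).
Proof.
move=> gF h0; have [C C0 HC] := @heatK_bound R n i.
have h20 : 0 < 2 * h by rewrite mulr_gt0.
have := integrable_gauss gF h20 => /(integrableZl measurableT (C * h `^ (- i%:R))).
apply: le_integrable => //.
  apply/measurable_EFinP; apply: measurable_funM; first exact: measurable_heatK.
  by case: gF.
move=> y _; rewrite -EFinM !abse_EFin lee_fin.
rewrite [leRHS]ger0_norm; last by rewrite !mulr_ge0 ?gauss_ge0 ?powR_ge0 ?(ltW C0)//.
by rewrite normrM mulrA ler_wpM2r// HC.
Qed.

(** Differentiation under the integral: for times within a factor 2 of [h], the
kernels are dominated by a multiple of the Gaussian kernel at time [4 h]. *)
Lemma is_derive_heatI n i (F : T n -> R) (h : R) : gauss_integrable F -> 0 < h ->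
  is_derive h 1 (heatI i F) (heatI i.+1 F h).
Proof.
move=> gF h0; pose u := h / 2; pose v := 2 * h.
have u0 : 0 < u by rewrite divr_gt0.
have [C C0 HC] := @heatK_bound R n i.+1.
have h40 : 0 < 4 * h by rewrite mulr_gt0.
pose G y := C * u `^ (- i.+1%:R) * 4 `^ (n%:R / 2) * (gauss (4 * h) y * `|F y|).
have hI : `]u, v[%classic h by rewrite /= in_itv/= /u /v; apply/andP; split; lra.
have Ipos x : `]u, v[%classic x -> 0 < x.
  by rewrite /= in_itv/= => /andP[ux _]; exact: lt_trans ux.
have dK (x : R) y : 0 < x -> is_derive x 1 (fun x => heatK i x y * F y) (heatK i.+1 x y * F y).
  move=> x0; have dx := @is_derive_heatK R n i x y x0.
  have -> : (fun x => heatK i x y * F y) = F y \*: (fun x => heatK i x y).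
    by apply/funext => t; rewrite mulrC.
  by apply: is_derive_eq; rewrite mulrC.
have intf (x : R) : `]u, v[%classic x -> (mu n).-integrable setT (EFin \o (fun y => heatK i x y * F y)).
  by move=> /Ipos x0; exact: integrable_heatK.
have derf (x : R) y : `]u, v[%classic x -> setT y -> derivable (fun x => heatK i x y * F y) x 1.
  by move=> /Ipos x0 _; case: (dK x y x0).
have G0 y : 0 <= G y by rewrite !mulr_ge0 ?gauss_ge0 ?powR_ge0 ?(ltW C0)//.
have intG : (mu n).-integrable setT (EFin \o G).
  have := integrable_gauss gF h40.
  move=> /(integrableZl measurableT (C * u `^ (- i.+1%:R) * 4 `^ (n%:R / 2))).
  by apply: eq_integrable => // y _; rewrite /= -EFinM.
have Gub (x : R) y : `]u, v[%classic x -> setT y ->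
    `|partial1of2 (fun x y => heatK i x y * F y) x y| <= G y.
  move=> xI _; have x0 := Ipos x xI.
  rewrite partial1of2E; have -> := @derive_val _ _ _ _ _ _ _ (dK x y x0).
  rewrite normrM /G [leRHS]mulrA ler_wpM2r//.
  apply: (le_trans (HC x y x0)).
  move: xI; rewrite /= in_itv/= => /andP[ux xv].
  have h1 : gauss (2 * x) y <= 4 `^ (n%:R / 2) * gauss (4 * h) y.
    have x20 : 0 < 2 * x by rewrite mulr_gt0.
    apply: le_trans (gauss_le y x20 (_ : _ <= 4 * h)) _; first by rewrite /v in xv; lra.
    rewrite ler_wpM2r ?gauss_ge0// ge0_ler_powR ?nnegrE//.
      by rewrite divr_ge0// ltW.
    by rewrite ler_pdivrMr//; move: ux; rewrite /u; lra.
  have h2 : x `^ (- i.+1%:R) <= u `^ (- i.+1%:R).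
    rewrite !powRN lef_pV2 ?posrE ?powR_gt0//.
    by apply: ge0_ler_powR; rewrite ?nnegrE ?(ltW u0) ?(ltW x0) ?(ltW ux).
  rewrite -[leRHS]mulrA; apply: ler_pM => //.
  - by rewrite mulr_ge0 ?powR_ge0// ltW.
  - exact: gauss_ge0.
  - by rewrite ler_pM2l.
have D1 := derivable_under_integral measurableT hI intf derf G0 intG Gub.
have D2 := differentiation_under_integral measurableT hI intf derf G0 intG Gub.
apply: (@DeriveDef _ _ _ _ _ _ _ D1).
rewrite -derive1E D2; apply: eq_Rintegral => y _.
by rewrite partial1of2E; have -> := @derive_val _ _ _ _ _ _ _ (dK h y h0).
Qed.

Lemma gauss_integrable_cst n (L : R) : gauss_integrable (fun _ : T n => L).
Proof.
split; first exact: measurable_cst.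
move=> k k0; have L0 : 0 <= `|L| by [].
under eq_integral do rewrite mulrC EFinM.
have mg : measurable_fun setT (fun y : T n => (gauss k y)%:E).
  by apply/measurable_EFinP; exact: measurable_gauss.
have g0 (y : T n) : (0 <= (gauss k y)%:E)%E by rewrite lee_fin gauss_ge0.
rewrite (ge0_integralZl_EFin _ measurableT (fun y _ => g0 y) mg L0).
by rewrite integral_gauss// mule1 ltry.
Qed.

Lemma derive1n_heatI n (m : nat) (F : T n -> R) (g : R -> R) : gauss_integrable F ->
  (forall h, 0 < h -> g h = heatI 0 F h) ->
  forall h, 0 < h -> derive1n m g h = heatI m F h.
Proof.
move=> gF gE; elim: m => [|m IH] h h0; first exact: gE.
rewrite derive1nS derive1E.
have dV := @is_derive_heatI n m F h gF h0.
rewrite -(@derive_val _ _ _ _ _ _ _ dV); apply: near_eq_derive.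
have hpos : \forall x \near h, - x < 0 by apply: Nlt_nbhsl; rewrite oppr_lt0.
by apply: filterS hpos => x; rewrite oppr_lt0; exact: IH.
Qed.

End heat_integrals.

(** * Continuity of translations in the mean *)

Section translation_continuity.
Context {R : realType}.
Notation mR := (measurableTypeR R).
Notation leb := (@lebesgue_measure R).
Notation T n := (n.-tuple mR).
Notation mu n := (borel_lebesgue R n).

Lemma compact_translate_open (K U : set R) : compact K -> open U -> K `<=` U ->
  exists2 d : R, 0 < d & forall b x, `|b| < d -> K x -> U (x + b).
Proof.
move=> cK oU KU.
have near_cov : near_covering K by exact/compact_near_coveringP.
have := near_cov R (nbhs (0 : R)) (fun b x => U (x + b)) _ _.
have nearxU x : K x -> \forall x' \near x & b \near (0 : R), U (x' + b).
  move=> Kx; have Ux : nbhs (x + 0) U by rewrite addr0; apply: open_nbhs_nbhs; split => //; exact: KU.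
  have [[P Q] /= [Px Q0] PQ] := @add_continuous R (x, 0) U Ux.
  by exists (P, Q) => //= -[x' b'] [/= Px' Qb']; exact: (PQ (x', b')).
move=> /(_ _ nearxU)[d /= d0 Hd].
exists d => // b x bd Kx; apply: Hd => //=.
by rewrite sub0r normrN.
Qed.

Lemma indic_nneg (S : Type) (A : set S) x : 0 <= (\1_A x : R).
Proof. by rewrite indicE ler0n. Qed.

Local Open Scope ereal_scope.

Lemma integral_indic_shift (S : set mR) (b : R) : measurable S ->
  \int[leb]_x (\1_S (x - b)%R)%:E = leb S.
Proof.
move=> mS; have mi : measurable_fun setT (fun x : mR => (\1_S x)%:E : \bar R).
  by apply/measurable_EFinP; exact: measurable_indic.
rewrite -(@ge0_integral_image _ _ _ _ _ leb leb (fun x : mR => (x - b)%R) (fun x => (\1_S x)%:E))//.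
- by rewrite integral_indic// setIT.
- exact: measurable_funB.
- by move=> B mB; exact: lebesgue_measure_translate.
Qed.

(** A set of finite measure lies between a compact set and an open set of nearly
the same measure, and a compact set stays inside an open one under small shifts. *)
Lemma translation_continuity_line (A : set mR) (e : R) : measurable A ->
  leb A < +oo -> (0 < e)%R -> exists2 d : R, (0 < d)%R & forall b, (`|b| < d)%R ->
  \int[leb]_x (`|\1_A (x - b)%R - \1_A x|)%:E <= e%:E.
Proof.
move=> mA Afin e0; have e40 : (0 < e / 4)%R by rewrite divr_gt0.
have [U [oU AU UA]] := lebesgue_regularity_outer mA Afin e40.
have [K [cK KA AK]] := lebesgue_regularity_inner mA Afin e40.
have [d d0 Hd] := compact_translate_open cK oU (subset_trans KA AU).
exists d => // b bd.
have mU : measurable (U : set mR) by exact: open_measurable.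
have mK : measurable (K : set mR) by apply: closed_measurable; exact: compact_closed.
have mUA : measurable (U `\` A : set mR) by exact: measurableD.
have mAK : measurable (A `\` K : set mR) by exact: measurableD.
have mi (S : set mR) : measurable S -> measurable_fun setT (fun x : mR => (\1_S x)%:E : \bar R).
  by move=> mS; apply/measurable_EFinP; exact: measurable_indic.
have mib (S : set mR) : measurable S -> measurable_fun setT (fun x : mR => (\1_S (x - b)%R)%:E : \bar R).
  move=> mS; apply: measurableT_comp (mi S mS) _; exact: measurable_funB.
have i0 (S : set mR) (x : mR) : 0 <= (\1_S x)%:E :> \bar R by rewrite lee_fin indic_nneg.
apply: (@le_trans _ _ (\int[leb]_x (((\1_(A `\` K) (x - b)%R)%:E + (\1_(U `\` A) (x - b)%R)%:E)
   + ((\1_(A `\` K) x)%:E + (\1_(U `\` A) x)%:E)))).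
  apply: ge0_le_integral_any => x _; first by rewrite lee_fin.
  rewrite -!EFinD lee_fin !indicE.
  have h1 : K (x - b)%R -> U x by move=> /(Hd _ _ bd); rewrite subrK.
  have h2 : K x -> U (x - b)%R by apply: Hd; rewrite normrN.
  have le01 (c1 c2 c3 c4 : bool) : (c1 || c2 || c3 || c4) ->
     (1 <= c1%:R + c2%:R + (c3%:R + c4%:R) :> R)%R.
    by case: c1 c2 c3 c4 => [] [] [] []//= _; rewrite ?addr0 ?add0r; lra.
  case: (boolP ((x - b)%R \in A)) => a1; case: (boolP (x \in A)) => a2 /=;
    rewrite ?subrr ?normr0 ?sub0r ?normrN ?subr0 ?normr1 ?addr_ge0//; apply: le01.
  - case: (pselect (K (x - b)%R)) => k1.
      apply/orP; right; rewrite inE; split; first exact: h1.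
      by move: a2; rewrite notin_setE.
    have k2 : (x - b)%R \in A `\` K by rewrite inE; split => //; exact: set_mem.
    by rewrite k2.
  - case: (pselect (K x)) => k1; last first.
      apply/orP; left; apply/orP; right; rewrite inE; split => //; exact: set_mem.
    apply/orP; left; apply/orP; left; apply/orP; right; rewrite inE; split; first exact: h2.
    by move: a1; rewrite notin_setE.
rewrite ge0_integralD//; last 4 first.
- by move=> x _; rewrite adde_ge0.
- by apply: emeasurable_funD; exact: mib.
- by move=> x _; rewrite adde_ge0.
- by apply: emeasurable_funD; exact: mi.
rewrite ge0_integralD//; [|exact: mib..].
rewrite ge0_integralD//; [|exact: mi..].
rewrite !integral_indic_shift// !integral_indic// !setIT.
have -> : e%:E = (e / 4)%:E + (e / 4)%:E + ((e / 4)%:E + (e / 4)%:E).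
  by rewrite -!EFinD; congr EFin; field.
by apply: leeD; apply: leeD; exact: ltW.
Qed.

(** The measure of the symmetric difference of [A] and its translate by [y]. *)
Definition translation_defect n (A : set (T n)) (y : T n) : \bar R :=
  \int[mu n]_x (`|\1_A (tsub x y) - \1_A x|)%:E.

Lemma measurable_defect n (A : set (T n)) y : measurable A ->
  measurable_fun setT (fun x => (`|\1_A (tsub x y) - \1_A x|)%:E : \bar R).
Proof.
move=> mA; apply/measurable_EFinP; apply: measurableT_comp => //.
apply: measurable_funB; last exact: measurable_indic.
apply: measurableT_comp (measurable_indic mA) _.
by apply: measurable_tsub => //; exact: measurable_cst.
Qed.

Lemma indic_defect_le d (S : measurableType d) (m : {measure set S -> \bar R})
    (tau : S -> S) (A : set S) : measurable A -> measurable_fun setT tau ->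
  \int[m]_x (\1_A (tau x))%:E = m A ->
  \int[m]_x (`|\1_A (tau x) - \1_A x|)%:E <= 2%:E * m A.
Proof.
move=> mA mtau mtauA.
have mi : measurable_fun setT (fun x : S => (\1_A x)%:E : \bar R).
  by apply/measurable_EFinP; exact: measurable_indic.
have mib : measurable_fun setT (fun x : S => (\1_A (tau x))%:E : \bar R).
  exact: measurableT_comp mi mtau.
apply: (@le_trans _ _ (\int[m]_x ((\1_A (tau x))%:E + (\1_A x)%:E))).
  apply: ge0_le_integral_any => x _ //; rewrite -EFinD lee_fin.
  by apply: (le_trans (ler_normB _ _)); rewrite !ger0_norm ?indic_nneg.
rewrite ge0_integralD//; [|by move=> x _; rewrite lee_fin indic_nneg..].
by rewrite mtauA integral_indic// setIT -mule2n mule_natl.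
Qed.

Lemma defect_le n (A : set (T n)) y : measurable A ->
  translation_defect A y <= 2%:E * mu n A.
Proof.
move=> mA; have mi : measurable_fun setT (fun x : T n => (\1_A x)%:E : \bar R).
  by apply/measurable_EFinP; exact: measurable_indic.
apply: indic_defect_le => //.
  by apply: measurable_tsub => //; exact: measurable_cst.
by rewrite (integral_translate y mi) ?integral_indic ?setIT.
Qed.

End translation_continuity.

Section translation_continuity_nd.
Context {R : realType}.
Notation mR := (measurableTypeR R).
Notation leb := (@lebesgue_measure R).
Notation T n := (n.-tuple mR).
Notation mu n := (borel_lebesgue R n).
Local Open Scope ereal_scope.

(** An integrable bound is finite almost everywhere, so the pointwise convergence
matters only where it is finite. *)
Lemma dominated_integral_to0 d (S : measurableType d) (m : {measure set S -> \bar R})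
    (f : nat -> S -> \bar R) (g : S -> \bar R) :
  (forall k, measurable_fun setT (f k)) -> measurable_fun setT g ->
  (forall k x, 0 <= f k x <= g x) -> \int[m]_x g x < +oo ->
  (forall x, g x < +oo -> f k x @[k --> \oo] --> 0) ->
  \int[m]_x f k x @[k --> \oo] --> 0.
Proof.
move=> mf mg fg gfin f0.
have g0 x : 0 <= g x by have /andP[h1 h2] := fg 0%N x; exact: le_trans h2.
have ig : m.-integrable setT g.
  apply/integrableP; split => //; apply: le_lt_trans gfin.
  by apply: ge0_le_integral_any => x _ //; rewrite gee0_abs.
have f0ae : {ae m, forall x, setT x -> f k x @[k --> \oo] --> (cst 0 x : \bar R)}.
  have := integrable_ae measurableT ig; apply: filterS => x /(_ I) gx _.
  by apply: f0; rewrite -ge0_fin_numE.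
have fgae : {ae m, forall x k, setT x -> `|f k x| <= g x}.
  by apply: aeW => x k _; have /andP[h1 h2] := fg k x; rewrite gee0_abs.
have [_ _ H] := dominated_convergence measurableT mf (measurable_cst _) f0ae ig fgae.
by rewrite integral0 in H.
Qed.

Lemma mule2_lty (x : \bar R) : 2%:E * x < +oo -> x < +oo.
Proof.
case: x => [r| |] //; first by rewrite !ltry.
by rewrite gt0_muley// lte_fin ltr0n.
Qed.

Lemma defect_ge0 n (A : set (T n)) y (x : T n) :
  0 <= (`|\1_A (tsub x y) - \1_A x|)%:E :> \bar R.
Proof. by rewrite lee_fin. Qed.

Lemma defect_triangle n (A : set (T n)) (y z w : T n) : measurable A ->
  (forall x, tsub (tsub x y) z = tsub x w) ->
  translation_defect A w <= translation_defect A y + translation_defect A z.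
Proof.
move=> mA yzw; rewrite addeC.
rewrite [X in _ <= X + _]/translation_defect -(integral_translate y); last 2 first.
- exact: measurable_defect.
- by move=> x; rewrite lee_fin.
have mz := measurable_defect z mA.
have mzy : measurable_fun setT
    (fun x : T n => (`|\1_A (tsub (tsub x y) z) - \1_A (tsub x y)|)%:E : \bar R).
  by apply: measurableT_comp mz _; apply: measurable_tsub => //; exact: measurable_cst.
rewrite -ge0_integralD//; last exact: measurable_defect.
apply: ge0_le_integral_any => x _; first by rewrite lee_fin.
by rewrite -EFinD lee_fin yzw ler_distD.
Qed.

Definition tzero n : T n := [tuple 0%R | i < n].

Lemma tsub0 n (x : T n) : tsub x (tzero n) = x.
Proof. by apply: eq_from_tnth => i; rewrite !tnth_mktuple subr0. Qed.

Lemma tsub_split n (b : mR) (y : T n) (x : T n.+1) :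
  tsub (tsub x (cons_pair (b, tzero n))) (cons_pair (0%R, y)) = tsub x (cons_pair (b, y)).
Proof.
have [a [x' ->]] := cons_pair_surj x.
by rewrite !tsub_cons subr0 tsub0.
Qed.

Lemma measurable_slice1 n (A : set (T n.+1)) (x : mR) : measurable A ->
  measurable [set t : T n | A (cons_pair (x, t))].
Proof.
move=> mA; rewrite -[X in measurable X]setTI.
apply: (_ : measurable_fun setT (fun t : T n => cons_pair (x, t))) => //.
apply: measurableT_comp (@measurable_cons_pair R n) _; exact: measurable_pair1.
Qed.

Lemma measurable_slice2 n (A : set (T n.+1)) (t : T n) : measurable A ->
  measurable [set x : mR | A (cons_pair (x, t))].
Proof.
move=> mA; rewrite -[X in measurable X]setTI.
apply: (_ : measurable_fun setT (fun x : mR => cons_pair (x, t))) => //.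
apply: measurableT_comp (@measurable_cons_pair R n) _; exact: measurable_pair2.
Qed.

Lemma indicE_ge0 (S : Type) (A : set S) (z : S) : 0 <= (\1_A z)%:E :> \bar R.
Proof. by rewrite lee_fin indic_nneg. Qed.

Lemma measure_slices1 n (A : set (T n.+1)) : measurable A ->
  mu n.+1 A = \int[leb]_x mu n [set t | A (cons_pair (x, t))].
Proof.
move=> mA; transitivity (\int[mu n.+1]_z (\1_A z)%:E).
  by rewrite integral_indic// setIT.
have mi : measurable_fun setT (fun z : T n.+1 => (\1_A z)%:E : \bar R).
  by apply/measurable_EFinP; exact: measurable_indic.
rewrite (integral_cons mi (@indicE_ge0 _ A)).
apply: eq_integral => x _; have mx := measurable_slice1 x mA.
transitivity (\int[mu n]_t (\1_[set t | A (cons_pair (x, t))] t)%:E).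
  by apply: eq_integral => t _; rewrite !indicE.
by rewrite integral_indic// setIT.
Qed.

Lemma measure_slices2 n (A : set (T n.+1)) : measurable A ->
  mu n.+1 A = \int[mu n]_t leb [set x | A (cons_pair (x, t))].
Proof.
move=> mA; transitivity (\int[mu n.+1]_z (\1_A z)%:E).
  by rewrite integral_indic// setIT.
have mi : measurable_fun setT (fun z : T n.+1 => (\1_A z)%:E : \bar R).
  by apply/measurable_EFinP; exact: measurable_indic.
rewrite (integral_cons_swap mi (@indicE_ge0 _ A)).
apply: eq_integral => t _; have mx := measurable_slice2 t mA.
transitivity (\int[leb]_x (\1_[set x | A (cons_pair (x, t))] x)%:E).
  by apply: eq_integral => x _; rewrite !indicE.
by rewrite integral_indic// setIT.
Qed.

Lemma measurable_measure_slices1 n (A : set (T n.+1)) : measurable A ->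
  measurable_fun setT (fun x : mR => mu n [set t | A (cons_pair (x, t))]).
Proof.
move=> mA; have mi : measurable_fun setT (fun z : T n.+1 => (\1_A z)%:E : \bar R).
  by apply/measurable_EFinP; exact: measurable_indic.
apply: eq_measurable_fun (measurable_cons_integral mi (@indicE_ge0 _ A)) => x _.
transitivity (\int[mu n]_t (\1_[set t | A (cons_pair (x, t))] t)%:E).
  by apply: eq_integral => t _; rewrite !indicE.
by rewrite integral_indic ?setIT//; exact: measurable_slice1.
Qed.

Lemma measurable_measure_slices2 n (A : set (T n.+1)) : measurable A ->
  measurable_fun setT (fun t : T n => leb [set x | A (cons_pair (x, t))]).
Proof.
move=> mA; have mi : measurable_fun setT (fun z : T n.+1 => (\1_A z)%:E : \bar R).
  by apply/measurable_EFinP; exact: measurable_indic.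
apply: eq_measurable_fun (measurable_cons_integral_swap mi (@indicE_ge0 _ A)) => t _.
transitivity (\int[leb]_x (\1_[set x | A (cons_pair (x, t))] x)%:E).
  by apply: eq_integral => x _; rewrite !indicE.
by rewrite integral_indic ?setIT//; exact: measurable_slice2.
Qed.

(** Induction on the dimension: a translation is one in the first coordinate
followed by one in the others. For each of them the defect is an integral over
slices, dominated by twice the measure of the slice. *)
Lemma translation_continuity n (A : set (T n)) (yk : nat -> T n) : measurable A ->
  mu n A < +oo -> (forall i, tnth (yk k) i @[k --> \oo] --> (0 : R)%R) ->
  translation_defect A (yk k) @[k --> \oo] --> 0.
Proof.
elim: n A yk => [|n IH] A yk mA Afin yk0.
  rewrite (_ : (fun k => _) = cst 0); first exact: cvg_cst.
  apply/funext => k; rewrite /translation_defect /=.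
  rewrite (eq_integral (cst 0)) ?integral0// => x _.
  by rewrite (tuple0 (tsub x _)) (tuple0 x) subrr normr0.
pose b k := thead (yk k); pose y k : T n := [tuple of behead (yk k)].
have ykE k : yk k = cons_pair (b k, y k) by rewrite /cons_pair /= [LHS]tuple_eta.
have b0 : b k @[k --> \oo] --> (0 : R)%R by exact: (yk0 ord0).
have y0 i : tnth (y k) i @[k --> \oo] --> (0 : R)%R.
  rewrite (_ : (fun k => _) = (fun k => tnth (yk k) (lift ord0 i))); first exact: yk0.
  by apply/funext => k; rewrite ykE tnthS.
have D1 : translation_defect A (cons_pair (b k, tzero n)) @[k --> \oo] --> 0.
  pose f k t := \int[leb]_x (`|\1_A (cons_pair ((x - b k)%R, t)) - \1_A (cons_pair (x, t))|)%:E.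
  rewrite (_ : (fun k => _) = (fun k => \int[mu n]_t f k t)); last first.
    apply/funext => k; rewrite /translation_defect.
    rewrite (integral_cons_swap (measurable_defect _ mA) (@defect_ge0 _ A _)).
    by apply: eq_integral => t _; apply: eq_integral => x _; rewrite tsub_cons tsub0.
  apply: (@dominated_integral_to0 _ _ _ _ (fun t => 2%:E * leb [set x | A (cons_pair (x, t))])).
  - move=> k; have := measurable_cons_integral_swap
      (measurable_defect (cons_pair (b k, tzero n)) mA) (@defect_ge0 _ A _).
    apply: eq_measurable_fun => t _; apply: eq_integral => x _.
    by rewrite tsub_cons tsub0.
  - by apply: emeasurable_funM => //; exact: measurable_measure_slices2.
  - move=> k t; rewrite integral_ge0//=.
    have mAt := measurable_slice2 t mA.
    apply: (@indic_defect_le _ _ _ leb (fun x : mR => (x - b k)%R)) => //.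
      exact: measurable_funB.
    exact: integral_indic_shift.
  - rewrite ge0_integralZl_EFin//; last exact: measurable_measure_slices2.
    by rewrite -measure_slices2// lte_mul_pinfty.
  - move=> t tfin; have mAt := measurable_slice2 t mA.
    have {}tfin : leb [set x | A (cons_pair (x, t))] < +oo.
      exact: mule2_lty.
    apply/fine_cvgP; split.
      apply: nearW => k; rewrite ge0_fin_numE; last exact: integral_ge0.
      apply: (@le_lt_trans _ _ (2%:E * leb [set x | A (cons_pair (x, t))])).
        apply: (@indic_defect_le _ _ _ leb (fun x : mR => (x - b k)%R)) => //.
          exact: measurable_funB.
        exact: integral_indic_shift.
      by rewrite lte_mul_pinfty.
    apply/cvgrPdist_le => e e0.
    have [d d0 Hd] := translation_continuity_line mAt tfin e0.
    have /cvgrPdist_lt/(_ _ d0) := b0; apply: filterS => k; rewrite sub0r normrN => bk.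
    have := Hd _ bk; rewrite sub0r normrN => fk.
    have fk0 : 0 <= f k t by exact: integral_ge0.
    rewrite ger0_norm ?fine_ge0//= -lee_fin fineK//.
    rewrite ge0_fin_numE//; exact: le_lt_trans fk (ltry _).
have D2 : translation_defect A (cons_pair (0%R, y k)) @[k --> \oo] --> 0.
  pose f k x := translation_defect [set t | A (cons_pair (x, t))] (y k).
  rewrite (_ : (fun k => _) = (fun k => \int[leb]_x f k x)); last first.
    apply/funext => k; rewrite /translation_defect.
    rewrite (integral_cons (measurable_defect _ mA) (@defect_ge0 _ A _)).
    apply: eq_integral => x _; apply: eq_integral => t _.
    by rewrite tsub_cons subr0 !indicE.
  apply: (@dominated_integral_to0 _ _ _ _ (fun x => 2%:E * mu n [set t | A (cons_pair (x, t))])).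
  - move=> k; have := measurable_cons_integral
      (measurable_defect (cons_pair (0%R, y k)) mA) (@defect_ge0 _ A _).
    apply: eq_measurable_fun => x _; apply: eq_integral => t _.
    by rewrite tsub_cons subr0 !indicE.
  - by apply: emeasurable_funM => //; exact: measurable_measure_slices1.
  - move=> k x; rewrite integral_ge0//=.
    by apply: defect_le; exact: measurable_slice1.
  - rewrite ge0_integralZl_EFin//; last exact: measurable_measure_slices1.
    by rewrite -measure_slices1// lte_mul_pinfty.
  - move=> x xfin; apply: IH => //; first exact: measurable_slice1.
    exact: mule2_lty.
apply: (@squeeze_cvge _ _ _ _ (cst 0) _ (fun k => translation_defect A (cons_pair (b k, tzero n)) +
  translation_defect A (cons_pair (0%R, y k)))).
- apply: nearW => k; rewrite integral_ge0//= ykE; apply: defect_triangle => // x.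
  exact: tsub_split.
- exact: cvg_cst.
- by rewrite -[X in _ --> X]adde0; apply: cvgeD.
Qed.

End translation_continuity_nd.

(** * Gaussian averages *)

Section approximate_identity.
Context {R : realType}.
Notation mR := (measurableTypeR R).
Notation T n := (n.-tuple mR).
Notation mu n := (borel_lebesgue R n).

Lemma tnth_sqr_le n (y : T n) i : tnth y i ^+ 2 <= sqnorm y.
Proof.
rewrite /sqnorm (bigD1 i)//= lerDl; apply: sumr_ge0 => j _; exact: sqr_ge0.
Qed.

Lemma defect_small n (A : set (T n)) (e : R) : measurable A -> (mu n A < +oo)%E ->
  0 < e -> exists2 d : R, 0 < d &
    forall y, sqnorm y < d -> (translation_defect A y <= e%:E)%E.
Proof.
move=> mA Afin e0; apply: contrapT => H.
have /choice[yk Hyk] (k : nat) : exists y : T n,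
    sqnorm y < k.+1%:R^-1 /\ ~ (translation_defect A y <= e%:E)%E.
  apply: contrapT => Hk; apply: H; exists k.+1%:R^-1; first by rewrite invr_gt0.
  by move=> y yd; apply: contrapT => Hy; apply: Hk; exists y.
have yk0 i : tnth (yk k) i @[k --> \oo] --> (0 : R).
  apply/cvgrPdist_lt => r r0; have r20 : 0 < r ^+ 2 by rewrite exprn_gt0.
  have := near_infty_natSinv_lt (PosNum r20); apply: filterS => k /= kr.
  rewrite sub0r normrN -(@ltr_pXn2r _ 2) ?nnegrE ?(ltW r0)// real_normK ?num_real//.
  apply: (le_lt_trans (tnth_sqr_le (yk k) i)).
  exact: lt_trans (Hyk k).1 kr.
have /fine_cvgP[_ /cvgrPdist_lt/(_ _ e0)] := translation_continuity mA Afin yk0.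
case=> N _ /(_ N (leqnn N)) /=; rewrite sub0r normrN => HN.
apply: (Hyk N).2.
have D0 : (0 <= translation_defect A (yk N))%E.
  by apply: integral_ge0 => x _; exact: defect_ge0.
have Dfin : translation_defect A (yk N) \is a fin_num.
  rewrite ge0_fin_numE//; apply: le_lt_trans (defect_le (yk N) mA) _.
  by rewrite lte_mul_pinfty.
rewrite -(fineK Dfin) lee_fin; apply: le_trans (ltW HN); exact: ler_norm.
Qed.

(** The square of the norm is absorbed by half of the exponential, since
[z <= 2 exp (z / 2)]. *)
Lemma sqnorm_gauss_le n (h : R) (y : T n) : 0 < h ->
  sqnorm y * gauss h y <= 8 * h * 2 `^ (n%:R / 2) * gauss (2 * h) y.
Proof.
move=> h0; have p0 : 0 <= 4 * pi :> R by rewrite mulr_ge0// pi_ge0.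
pose z := sqnorm y / (4 * h).
have z0 : 0 <= z by rewrite divr_ge0 ?sqnorm_ge0// mulr_ge0// ltW.
have sE : sqnorm y = 4 * h * z by rewrite /z mulrC divfK// gt_eqF// mulr_gt0.
have E1 : expR (- (sqnorm y / (4 * (2 * h)))) = expR (- z) * expR (2^-1 * z).
  by rewrite -expRD; congr expR; rewrite /z; field; rewrite gt_eqF.
rewrite /gauss -/z E1 sE.
have p2 := powRM (- (n%:R / 2)) p0 (mulr_ge0 (ler0n _ 2) (ltW h0)).
rewrite p2 (powRM _ p0 (ltW h0)) (powRM _ (ler0n _ 2) (ltW h0)).
set a := (4 * pi) `^ _; set b := h `^ _; set c := 2 `^ (- _).
have E2 : 2 `^ (n%:R / 2) * c = 1.
  by rewrite /c -powRD ?subrr ?powRr0// pnatr_eq0 implybT.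
have -> : 8 * h * 2 `^ (n%:R / 2) * (a * (c * b) * (expR (- z) * expR (2^-1 * z))) =
   4 * h * (a * b * expR (- z)) * (2 * expR (2^-1 * z)) * (2 `^ (n%:R / 2) * c).
  by ring.
rewrite E2 mulr1.
have -> : 4 * h * z * (a * b * expR (- z)) = 4 * h * (a * b * expR (- z)) * z by ring.
apply: ler_wpM2l.
  by rewrite !mulr_ge0 ?powR_ge0 ?expR_ge0 ?(ltW h0).
by have := @expR_ge1Dx R (2^-1 * z); lra.
Qed.

Local Open Scope ereal_scope.

(** A Gaussian average of a bounded function which is small near the origin is
small for short times, since the mass outside a ball of squared radius [d] is
[O(h / d)]. *)
Lemma gauss_average_le n (w : T n -> \bar R) (e d B h : R) :
  measurable_fun setT w -> (forall y, 0 <= w y <= B%:E) ->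
  (forall y, (sqnorm y < d)%R -> w y <= e%:E) -> (0 < h)%R -> (0 < d)%R -> (0 <= e)%R ->
  \int[mu n]_y ((gauss h y)%:E * w y) <= (e + B / d * (8 * h * 2 `^ (n%:R / 2)))%:E.
Proof.
move=> mw wB we h0 d0 e0.
have B0 : (0 <= B)%R.
  by have /andP[w1 w2] := wB (tzero n); rewrite -lee_fin; exact: le_trans w2.
have h20 : (0 < 2 * h)%R by rewrite mulr_gt0.
have C0 : (0 <= B / d * (8 * h * 2 `^ (n%:R / 2)))%R.
  by rewrite !mulr_ge0 ?invr_ge0 ?powR_ge0 ?(ltW d0) ?(ltW h0).
have mg k : measurable_fun setT (fun y : T n => (gauss k y)%:E : \bar R).
  by apply/measurable_EFinP; exact: measurable_gauss.
have g0 k (y : T n) : setT y -> 0 <= (gauss k y)%:E :> \bar R by rewrite lee_fin gauss_ge0.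
apply: (@le_trans _ _ (\int[mu n]_y (e%:E * (gauss h y)%:E +
    (B / d * (8 * h * 2 `^ (n%:R / 2)))%:E * (gauss (2 * h) y)%:E))).
  apply: ge0_le_integral_any => y _.
    by have /andP[w0 _] := wB y; rewrite mule_ge0// lee_fin gauss_ge0.
  have [yd|dy] := ltP (sqnorm y) d.
    apply: (@le_trans _ _ (e%:E * (gauss h y)%:E)).
      by rewrite muleC lee_wpmul2r ?we// lee_fin gauss_ge0.
    by rewrite leeDl// mule_ge0// lee_fin ?gauss_ge0.
  apply: (@le_trans _ _ ((gauss h y)%:E * B%:E)).
    by apply: lee_wpmul2l; [rewrite lee_fin gauss_ge0|have /andP[] := wB y].
  rewrite -!EFinM -EFinD lee_fin.
  apply: (@le_trans _ _ (B / d * (sqnorm y * gauss h y))%R).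
    have -> : (B / d * (sqnorm y * gauss h y) = (gauss h y * B) * (sqnorm y / d))%R by ring.
    by rewrite ler_peMr ?(mulr_ge0 (gauss_ge0 _ _) B0)// ler_pdivlMr// mul1r.
  rewrite -[leLHS]add0r lerD ?(mulr_ge0 e0 (gauss_ge0 _ _))// -[leRHS]mulrA.
  by rewrite ler_wpM2l ?divr_ge0 ?(ltW d0)// sqnorm_gauss_le.
rewrite ge0_integralD//; last 4 first.
- by move=> y _; rewrite mule_ge0 ?lee_fin ?gauss_ge0.
- exact: emeasurable_funM.
- by move=> y _; rewrite mule_ge0 ?lee_fin ?gauss_ge0.
- exact: emeasurable_funM.
rewrite (ge0_integralZl_EFin _ measurableT (g0 h) (mg h) e0).
rewrite (ge0_integralZl_EFin _ measurableT (g0 _) (mg _) C0).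
by rewrite [X in _ * X + _]integral_gauss// [X in _ + _ * X]integral_gauss// !mule1 EFinD.
Qed.

(** Tonelli on the positive and negative parts. *)
Lemma measurable_param_integral d1 d2 (X : measurableType d1) (Y : measurableType d2)
    (m : {sigma_finite_measure set Y -> \bar R}) (G : X * Y -> \bar R) :
  measurable_fun setT G -> measurable_fun setT (fun x => \int[m]_y G (x, y)).
Proof.
move=> mG; under eq_fun do rewrite integralE.
apply: emeasurable_funB.
  have mp : measurable_fun setT (G^\+) by exact: measurable_funepos.
  have := measurable_fun_fubini_tonelli_F (m2 := m) (G^\+) mp (fun z => funepos_ge0 G z).
  by apply: eq_measurable_fun => x _; apply: eq_integral => y _; rewrite !unlock.
have mn : measurable_fun setT (G^\-) by exact: measurable_funeneg.
have := measurable_fun_fubini_tonelli_F (m2 := m) (G^\-) mn (fun z => funeneg_ge0 G z).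
by apply: eq_measurable_fun => x _; apply: eq_integral => y _; rewrite !unlock.
Qed.

End approximate_identity.

(** * The heat semigroup and the level sets of a function *)

Section level_sets.
Context {R : realType}.
Notation mR := (measurableTypeR R).
Notation T n := (n.-tuple mR).
Notation mu n := (borel_lebesgue R n).

(** The part of [|f|] above the level [M]. *)
Definition tail n (f : T n -> R) (M : R) (x : T n) : R :=
  `|f x| * \1_[set x | M < `|f x|] x.

Variables (n : nat) (f : T n -> R).
Hypothesis mf : measurable_fun setT f.
Hypothesis tail_fin : forall M, 0 < M -> (\int[mu n]_x (tail f M x)%:E < +oo)%E.

Let mnf : measurable_fun setT (fun x => `|f x|).
Proof. exact: measurableT_comp. Qed.

Lemma measurable_level M : measurable [set x | M < `|f x|].
Proof.
rewrite -[X in measurable X]setTI.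
apply: (measurable_fun_ltr (f := cst M) (g := fun x => `|f x|)) => //.
Qed.

Lemma measurable_tail M : measurable_fun setT (tail f M).
Proof.
by apply: measurable_funM => //; apply: measurable_indic; exact: measurable_level.
Qed.

Lemma tail_ge0 M x : 0 <= tail f M x.
Proof. by rewrite mulr_ge0 ?indic_nneg. Qed.

Lemma le_tail M x : 0 <= M -> `|f x| <= M + tail f M x.
Proof.
move=> M0; rewrite /tail indicE; case: (ltP M `|f x|) => h.
  by rewrite mem_set// mulr1 lerDr.
by rewrite memNset ?mulr0 ?addr0//=; apply/negP; rewrite -leNgt.
Qed.

Lemma tail_nonincreasing M N x : M <= N -> tail f N x <= tail f M x.
Proof.
move=> MN; rewrite /tail ler_wpM2l// !indicE.
case: (ltP N `|f x|) => h.
  by rewrite [X in _ <= (nat_of_bool X)%:R]mem_set ?ler_nat ?leq_b1//=; exact: le_lt_trans h.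
by rewrite memNset//=; apply/negP; rewrite -leNgt.
Qed.

Local Open Scope ereal_scope.

Let mtE M : measurable_fun setT (fun x => (tail f M x)%:E : \bar R).
Proof. by apply/measurable_EFinP; exact: measurable_tail. Qed.

Let t0 M x : 0 <= (tail f M x)%:E :> \bar R.
Proof. by rewrite lee_fin tail_ge0. Qed.

Lemma tail_small (d : R) : (0 < d)%R ->
  exists2 M : R, (0 < M)%R & \int[mu n]_x (tail f M x)%:E <= d%:E.
Proof.
move=> d0.
have H : \int[mu n]_x (tail f k.+1%:R x)%:E @[k --> \oo] --> 0.
  apply: (@dominated_integral_to0 _ _ _ _ _ (fun x => (tail f 1 x)%:E)) => //.
  - by move=> k x; rewrite t0/= lee_fin tail_nonincreasing// ler1n.
  - exact: tail_fin.
  - move=> x _; apply: cvg_near_cst.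
    exists (Num.truncn `|f x|%R) => // k /= kf.
    rewrite /tail indicE memNset/= ?mulr0//; apply/negP; rewrite -leNgt.
    by apply: (le_trans (ltW (truncnS_gt _))); rewrite ler_nat.
have /fine_cvgP[[N1 _ H1] /cvgrPdist_lt/(_ _ d0)[N2 _ H2]] := H.
pose N := maxn N1 N2; exists N.+1%:R => //.
have := H2 N (leq_maxr _ _); rewrite /= sub0r normrN => h2.
have := H1 N (leq_maxl _ _) => /fineK <-.
by rewrite lee_fin (le_trans (ler_norm _))// ltW.
Qed.

(** Markov's inequality. *)
Lemma markov_tail M : (0 < M)%R ->
  M%:E * mu n [set x | (M < `|f x|)%R] <= \int[mu n]_x (tail f M x)%:E.
Proof.
move=> M0; have mM := measurable_level M.
rewrite -[X in mu n X]setIT -integral_indic//.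
rewrite -(ge0_integralZl_EFin _ measurableT); last 3 first.
- by move=> x _; exact: indicE_ge0.
- by apply/measurable_EFinP; exact: measurable_indic.
- exact: ltW.
apply: ge0_le_integral_any => x _.
  by rewrite mule_ge0// ?indicE_ge0 ?lee_fin ltW.
rewrite -EFinM lee_fin /tail !indicE.
case: (ltP M `|f x|%R) => h; last by rewrite memNset ?mulr0//=; apply/negP; rewrite -leNgt.
by rewrite mem_set// !mulr1 ltW.
Qed.

Lemma level_fin M : (0 < M)%R -> mu n [set x | (M < `|f x|)%R] < +oo.
Proof.
move=> M0; have := le_lt_trans (markov_tail M0) (tail_fin M0).
case: (mu n _) => [r| |]//; first by rewrite !ltry.
by rewrite gt0_muley ?lte_fin.
Qed.

Lemma tail_translate M y : \int[mu n]_x (tail f M (tsub x y))%:E = \int[mu n]_x (tail f M x)%:E.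
Proof. exact: (integral_translate y (mtE M)). Qed.

Lemma tail_reflect M x : \int[mu n]_y (tail f M (tsub x y))%:E = \int[mu n]_y (tail f M y)%:E.
Proof. exact: (integral_reflect x (mtE M)). Qed.

Let mtsub_l y : measurable_fun setT (fun x : T n => tsub x y).
Proof. by apply: measurable_tsub => //; exact: measurable_cst. Qed.

Let mtsub_r x : measurable_fun setT (fun y : T n => tsub x y).
Proof. by apply: measurable_tsub => //; exact: measurable_cst. Qed.

Lemma gauss_peak h (y : T n) : (0 < h)%R -> (gauss h y <= (4 * pi * h) `^ (- (n%:R / 2)))%R.
Proof.
move=> h0; rewrite /gauss ler_piMr ?powR_ge0// -expR0 ler_expR oppr_le0.
by rewrite divr_ge0 ?sqnorm_ge0// mulr_ge0// ltW.
Qed.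

(** The part of [f] below level 1 is integrated against the unit mass of the kernel,
the tail against its peak. *)
Lemma gauss_integrable_translate x : gauss_integrable (fun y => f (tsub x y)).
Proof.
split; first exact: measurableT_comp mf (mtsub_r x).
move=> h h0; set c : R := ((4 * pi * h) `^ (- (n%:R / 2)))%R.
have c0 : (0 <= c)%R by rewrite powR_ge0.
have mg : measurable_fun setT (fun y : T n => (gauss h y)%:E : \bar R).
  by apply/measurable_EFinP; exact: measurable_gauss.
have mt : measurable_fun setT (fun y => (tail f 1 (tsub x y))%:E : \bar R).
  exact: measurableT_comp (mtE 1) (mtsub_r x).
apply: (@le_lt_trans _ _ (\int[mu n]_y ((gauss h y)%:E + c%:E * (tail f 1 (tsub x y))%:E))).
  apply: ge0_le_integral_any => y _; first by rewrite lee_fin mulr_ge0 ?gauss_ge0.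
  rewrite -EFinM -EFinD lee_fin.
  have h1 := ler_wpM2l (gauss_ge0 h y) (le_tail (tsub x y) ler01).
  apply: (le_trans h1); rewrite mulrDr mulr1 lerD2l.
  by rewrite ler_wpM2r ?tail_ge0// gauss_peak.
rewrite ge0_integralD//; last 3 first.
- by move=> y _; rewrite lee_fin gauss_ge0.
- by move=> y _; rewrite mule_ge0.
- exact: emeasurable_funM.
rewrite (ge0_integralZl_EFin _ measurableT (fun y _ => t0 1 (tsub x y)) mt c0) tail_reflect.
rewrite [X in X + _]integral_gauss// lte_add_pinfty ?ltry//.
by rewrite lte_mul_pinfty// tail_fin.
Qed.

End level_sets.

Section correlation.
Context {R : realType}.
Notation mR := (measurableTypeR R).
Notation leb := (@lebesgue_measure R).
Notation Rpos := (`]0%R, +oo[%classic : set (measurableTypeR R)).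
Notation T n := (n.-tuple mR).
Notation mu n := (borel_lebesgue R n).

Variables (n : nat) (f : T n -> R) (l : R).
Hypothesis n_gt0 : (0 < n)%N.
Hypothesis mf : measurable_fun setT f.
Hypothesis tail_fin : forall M, 0 < M -> (\int[mu n]_x (tail f M x)%:E < +oo)%E.
Hypothesis l0 : 0 < l.

Let E : set (T n) := [set x | l < `|f x|].
Let E1 : set (T n) := [set x | l < f x].
Let E2 : set (T n) := [set x | l < - f x].

Let mE : measurable E. Proof. exact: measurable_level. Qed.
Let mE1 : measurable E1.
Proof.
rewrite -[X in measurable X]setTI.
exact: (measurable_fun_ltr (f := cst l) (g := f)).
Qed.
Let mE2 : measurable E2.
Proof.
rewrite -[X in measurable X]setTI.
apply: (measurable_fun_ltr (f := cst l) (g := fun x => - f x)) => //.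
exact: measurableT_comp.
Qed.

(** The sign of [f] restricted to the level set [E]. *)
Definition level_sign (x : T n) : R := \1_E1 x - \1_E2 x.

Lemma measurable_level_sign : measurable_fun setT level_sign.
Proof. by apply: measurable_funB; exact: measurable_indic. Qed.

Lemma level_sign_cases x : [\/ [/\ l < f x, \1_E x = 1 :> R & level_sign x = 1],
  [/\ l < - f x, \1_E x = 1 :> R & level_sign x = -1] |
  [/\ `|f x| <= l, \1_E x = 0 :> R & level_sign x = 0]].
Proof.
rewrite /level_sign !indicE.
have [f1|f1] := ltP l (f x).
  have f2 : ~ l < - f x.
    by apply/negP; rewrite -leNgt (le_trans _ (ltW l0))// oppr_le0 ltW// (lt_trans l0).
  have Ex : x \in E by apply/mem_set; exact: lt_le_trans f1 (ler_norm _).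
  have E1x : x \in E1 by exact/mem_set.
  by apply: Or31; rewrite Ex E1x memNset ?subr0.
have [f2|f2] := ltP l (- f x).
  have Ex : x \in E.
    by apply/mem_set; rewrite /E/= -normrN; exact: lt_le_trans f2 (ler_norm _).
  have E1x : ~ E1 x by apply/negP; rewrite -leNgt.
  have E2x : x \in E2 by exact/mem_set.
  by apply: Or32; rewrite Ex E2x memNset ?sub0r.
have fl : `|f x| <= l by rewrite ler_norml lerNl f2 f1.
have Ex : ~ E x by apply/negP; rewrite -leNgt.
have E1x : ~ E1 x by apply/negP; rewrite -leNgt.
have E2x : ~ E2 x by apply/negP; rewrite -leNgt.
by apply: Or33; rewrite !memNset ?subrr.
Qed.

Lemma norm_level_sign x : `|level_sign x| = \1_E x.
Proof.
by have [[_ -> ->]|[_ -> ->]|[_ -> ->]] := level_sign_cases x;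
  rewrite ?normrN ?normr1 ?normr0.
Qed.

Lemma mul_level_sign x : f x * level_sign x = tail f l x.
Proof.
rewrite /tail -/E; have [[h -> ->]|[h -> ->]|[h -> ->]] := level_sign_cases x.
- by rewrite gtr0_norm ?(lt_trans l0 h).
- have f0 : f x < 0 by rewrite -oppr_gt0 (lt_trans l0 h).
  by rewrite ltr0_norm// mulrN1 mulr1.
- by rewrite !mulr0.
Qed.

Lemma norm_level_signB x y : `|level_sign x - level_sign y| <= 2.
Proof.
apply: (le_trans (ler_normB _ _)); rewrite !norm_level_sign.
have h z : \1_E z <= 1 :> R by rewrite indicE lern1 leq_b1.
by have := lerD (h x) (h y).
Qed.

Local Open Scope ereal_scope.

Let mtE M : measurable_fun setT (fun x => (tail f M x)%:E : \bar R).
Proof. by apply/measurable_EFinP; exact: measurable_tail. Qed.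

Let t0 M x : 0 <= (tail f M x)%:E :> \bar R.
Proof. by rewrite lee_fin tail_ge0. Qed.

Let mtsub_l y : measurable_fun setT (fun x : T n => tsub x y).
Proof. by apply: measurable_tsub => //; exact: measurable_cst. Qed.

Let mtl M y : measurable_fun setT (fun x => (tail f M (tsub x y))%:E : \bar R).
Proof. exact: measurableT_comp (mtE M) (mtsub_l y). Qed.

Let mi : measurable_fun setT (fun x : T n => (\1_E x)%:E : \bar R).
Proof. by apply/measurable_EFinP; exact: measurable_indic. Qed.

Let i0 x : 0 <= (\1_E x)%:E :> \bar R. Proof. exact: indicE_ge0. Qed.

Let Efin : mu n E < +oo. Proof. exact: (level_fin mf tail_fin l0). Qed.

(** Its heat averages are the integrals over [E] of the heat flow of [f], signed by
[f]. *)
Definition correlation (y : T n) : R := \int[mu n]_x (f (tsub x y) * level_sign x)%R.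

Let a : R := fine (mu n E).
Let J M : R := fine (\int[mu n]_x (tail f M x)%:E).
Let aE : a%:E = mu n E. Proof. by rewrite fineK// ge0_fin_numE. Qed.
Let a0 : (0 <= a)%R. Proof. by rewrite fine_ge0. Qed.
Let JE M : (0 < M)%R -> (J M)%:E = \int[mu n]_x (tail f M x)%:E.
Proof.
by move=> M0; rewrite fineK// ge0_fin_numE ?tail_fin//; exact: integral_ge0.
Qed.
Let J0 M : (0 <= J M)%R. Proof. by rewrite fine_ge0//; exact: integral_ge0. Qed.
Let B : R := (a + J 1)%R.

Let mcorr y : measurable_fun setT (fun x => (f (tsub x y) * level_sign x)%:E : \bar R).
Proof.
apply/measurable_EFinP; apply: measurable_funM; last exact: measurable_level_sign.
exact: measurableT_comp mf (mtsub_l y).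
Qed.

Lemma correlation_integrand_le M y x : (0 <= M)%R ->
  (`|f (tsub x y) * level_sign x| <= M * \1_E x + tail f M (tsub x y) * \1_E x)%R.
Proof.
move=> M0; rewrite normrM norm_level_sign -mulrDl.
by rewrite ler_wpM2r ?indic_nneg// le_tail.
Qed.

Lemma correlation_abs_le M y : (0 < M)%R ->
  \int[mu n]_x (`|f (tsub x y) * level_sign x|)%:E <=
  (M * a)%:E + \int[mu n]_x (tail f M (tsub x y) * \1_E x)%:E.
Proof.
move=> M0; have mti : measurable_fun setT
    (fun x => (tail f M (tsub x y) * \1_E x)%:E : \bar R).
  apply/measurable_EFinP; apply: measurable_funM; last exact: measurable_indic.
  exact: measurableT_comp (measurable_tail mf M) (mtsub_l y).
apply: (@le_trans _ _ (\int[mu n]_x (M%:E * (\1_E x)%:E + (tail f M (tsub x y) * \1_E x)%:E))).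
  apply: ge0_le_integral_any => x _; first by rewrite lee_fin.
  by rewrite -EFinM -EFinD lee_fin correlation_integrand_le// ltW.
rewrite ge0_integralD//; last 3 first.
- by move=> x _; rewrite mule_ge0 ?lee_fin ?indic_nneg ?(ltW M0).
- exact: emeasurable_funM.
- by move=> x _; rewrite lee_fin mulr_ge0 ?tail_ge0 ?indic_nneg.
rewrite (ge0_integralZl_EFin _ measurableT (fun x _ => i0 x) mi (ltW M0)).
by rewrite integral_indic// setIT EFinM aE.
Qed.

Lemma correlation_abs_leB y :
  \int[mu n]_x (`|f (tsub x y) * level_sign x|)%:E <= B%:E.
Proof.
apply: (le_trans (correlation_abs_le y ltr01)).
rewrite mul1r /B EFinD leeD2l// (JE ltr01) -(tail_translate mf 1 y).
apply: ge0_le_integral_any => x _.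
  by rewrite lee_fin mulr_ge0 ?tail_ge0 ?indic_nneg.
by rewrite lee_fin ler_piMr ?tail_ge0// indicE lern1 leq_b1.
Qed.

Lemma integrable_correlation y :
  (mu n).-integrable setT (fun x => (f (tsub x y) * level_sign x)%:E).
Proof.
apply/integrableP; split => //; apply: le_lt_trans (correlation_abs_leB y) (ltry _).
Qed.

Lemma correlationE y : (correlation y)%:E = \int[mu n]_x (f (tsub x y) * level_sign x)%:E.
Proof.
rewrite /correlation /Rintegral fineK//.
exact: integrable_fin_num (integrable_correlation y).
Qed.

Lemma norm_correlation_le y :
  (`|correlation y|)%:E <= \int[mu n]_x (`|f (tsub x y) * level_sign x|)%:E.
Proof. by rewrite -abse_EFin correlationE; exact: le_abse_integral. Qed.

Lemma correlation_bounded y : (`|correlation y| <= B)%R.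
Proof. by rewrite -lee_fin (le_trans (norm_correlation_le y))// correlation_abs_leB. Qed.

Lemma measurable_correlation : measurable_fun setT correlation.
Proof.
apply: measurableT_comp => //.
apply: (@measurable_param_integral _ _ _ _ _ (mu n)
  (fun z : T n * T n => (f (tsub z.2 z.1) * level_sign z.2)%:E)).
apply/measurable_EFinP; apply: measurable_funM.
  by apply: measurableT_comp mf _; apply: measurable_tsub.
by apply: measurableT_comp measurable_level_sign _.
Qed.

Let mg k : measurable_fun setT (fun y : T n => (gauss k y)%:E : \bar R).
Proof. by apply/measurable_EFinP; exact: measurable_gauss. Qed.

Let g0 k (y : T n) : setT y -> 0 <= (gauss k y)%:E :> \bar R.
Proof. by rewrite lee_fin gauss_ge0. Qed.

Lemma gauss_integrable_correlation : gauss_integrable correlation.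
Proof.
split; first exact: measurable_correlation.
move=> h h0; have B0 : (0 <= B)%R by rewrite addr_ge0.
apply: (@le_lt_trans _ _ (\int[mu n]_y (B%:E * (gauss h y)%:E))).
  apply: ge0_le_integral_any => y _; first by rewrite lee_fin mulr_ge0 ?gauss_ge0.
  by rewrite -EFinM lee_fin mulrC ler_wpM2r ?gauss_ge0// correlation_bounded.
rewrite (ge0_integralZl_EFin _ measurableT (g0 h) (mg h) B0).
by rewrite [X in _ * X]integral_gauss// mule1 ltry.
Qed.

(** Tonelli's theorem and the invariance under reflections. *)
Lemma tail_correlation_mass M : (0 < M)%R ->
  \int[mu n]_y \int[mu n]_x (tail f M (tsub x y) * \1_E x)%:E = (J M * a)%:E.
Proof.
move=> M0; have mG : measurable_fun setT
   (fun z : T n * T n => (tail f M (tsub z.2 z.1) * \1_E z.2)%:E : \bar R).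
  apply/measurable_EFinP; apply: measurable_funM.
    by apply: measurableT_comp (measurable_tail mf M) _; apply: measurable_tsub.
  exact: measurableT_comp (measurable_indic mE) measurable_snd.
have G0 (z : T n * T n) : 0 <= (tail f M (tsub z.2 z.1) * \1_E z.2)%:E :> \bar R.
  by rewrite lee_fin mulr_ge0 ?tail_ge0 ?indic_nneg.
rewrite (@fubini_tonelli _ _ _ _ _ (mu n) (mu n) _ mG G0) /=.
rewrite EFinM aE -[X in mu n X]setIT -integral_indic//.
rewrite -(ge0_integralZl_EFin _ measurableT (fun x _ => i0 x) mi (J0 M)).
apply: eq_integral => x _.
have mtr : measurable_fun setT (fun y => (tail f M (tsub x y))%:E : \bar R).
  by apply: measurableT_comp (mtE M) _; apply: measurable_tsub => //; exact: measurable_cst.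
under eq_integral do rewrite mulrC EFinM.
rewrite (ge0_integralZl_EFin _ measurableT (fun y _ => t0 M (tsub x y)) mtr (indic_nneg _ _)).
by rewrite tail_reflect// -(JE M0) muleC.
Qed.

(** The part of [f] below level [M] contributes at most [M] times the measure of
[E]; the tail contributes an integrable function of [y], weighted by at most the
peak of the kernel. *)
Lemma gauss_correlation_le M H : (0 < M)%R -> (0 < H)%R ->
  \int[mu n]_y (gauss H y * `|correlation y|)%:E <=
  (M * a + (4 * pi * H) `^ (- (n%:R / 2)) * (J M * a))%:E.
Proof.
move=> M0 H0; set c : R := ((4 * pi * H) `^ (- (n%:R / 2)))%R.
have c0 : (0 <= c)%R by rewrite powR_ge0.
have Ma0 : (0 <= M * a)%R by rewrite mulr_ge0// ltW.
pose P y := \int[mu n]_x (tail f M (tsub x y) * \1_E x)%:E.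
have P0 y : 0 <= P y.
  by apply: integral_ge0 => x _; rewrite lee_fin mulr_ge0 ?tail_ge0 ?indic_nneg.
have mP : measurable_fun setT P.
  apply: (@measurable_param_integral _ _ _ _ _ (mu n)
    (fun z : T n * T n => (tail f M (tsub z.2 z.1) * \1_E z.2)%:E)).
  apply/measurable_EFinP; apply: measurable_funM.
    by apply: measurableT_comp (measurable_tail mf M) _; apply: measurable_tsub.
  exact: measurableT_comp (measurable_indic mE) measurable_snd.
apply: (@le_trans _ _ (\int[mu n]_y ((M * a)%:E * (gauss H y)%:E + c%:E * P y))).
  apply: ge0_le_integral_any => y _; first by rewrite lee_fin mulr_ge0 ?gauss_ge0.
  have h1 := le_trans (norm_correlation_le y) (correlation_abs_le y M0).
  rewrite EFinM; apply: le_trans (lee_wpmul2l (_ : 0 <= (gauss H y)%:E) h1) _; first exact: g0.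
  rewrite ge0_muleDr ?lee_fin//; last exact: P0.
  apply: leeD; first by rewrite muleC.
  by apply: lee_wpmul2r; [exact: P0|rewrite lee_fin gauss_peak].
rewrite ge0_integralD//; last 4 first.
- by move=> y _; rewrite mule_ge0 ?g0.
- exact: emeasurable_funM.
- by move=> y _; rewrite mule_ge0.
- exact: emeasurable_funM.
rewrite (ge0_integralZl_EFin _ measurableT (g0 H) (mg H) Ma0).
rewrite (ge0_integralZl_EFin _ measurableT (fun y _ => P0 y) mP c0).
by rewrite [X in _ * X + _]integral_gauss// mule1 tail_correlation_mass// EFinD EFinM.
Qed.

(** In [gauss_correlation_le] first [M] is taken small and then [H] large: the peak
of the kernel tends to 0 because [n > 0]. *)
Lemma correlation_decay (e : R) : (0 < e)%R -> exists2 A : R, (0 < A)%R &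
  forall H, (A <= H)%R -> \int[mu n]_y (gauss H y * `|correlation y|)%:E <= e%:E.
Proof.
move=> e0; pose M : R := (e / (2 * (a + 1)))%R.
have a10 : (0 < 2 * (a + 1))%R by rewrite mulr_gt0// ltr_wpDl.
have M0 : (0 < M)%R by rewrite divr_gt0.
have Ma : (M * a <= e / 2)%R.
  have -> : (e / 2 = M * (a + 1))%R by rewrite /M; field; rewrite gt_eqF// ltr_wpDl.
  by rewrite ler_pM2l// lerDl.
pose K : R := (J M * a + 1)%R.
have K0 : (0 < K)%R by rewrite ltr_wpDl// mulr_ge0.
pose e' : R := (e / (2 * K))%R.
have e'0 : (0 < e')%R by rewrite divr_gt0// mulr_gt0.
have n0 : (0 < n%:R :> R)%R by rewrite ltr0n.
pose A : R := (e' `^ (- (2 / n%:R)))%R.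
have A0 : (0 < A)%R by rewrite powR_gt0.
exists A => // H AH; have H0 : (0 < H)%R by exact: lt_le_trans AH.
apply: (le_trans (gauss_correlation_le M0 H0)); rewrite lee_fin.
have cH : ((4 * pi * H) `^ (- (n%:R / 2)) <= e')%R.
  have AE : (A `^ (- (n%:R / 2)) = e')%R.
    rewrite /A -powRrM (_ : (- (2 / n%:R) * - (n%:R / 2) = 1)%R); last first.
      by field; rewrite gt_eqF.
    by rewrite powRr1// ltW.
  have HpH : (H <= 4 * pi * H)%R.
    by rewrite ler_peMl ?(ltW H0)//; have := @pi_ge2 R; lra.
  rewrite -AE !powRN lef_pV2 ?posrE ?powR_gt0//; last by rewrite (lt_le_trans H0).
  apply: ge0_ler_powR; rewrite ?nnegrE ?(ltW A0)//.
    by rewrite (le_trans (ltW H0)).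
  exact: le_trans AH HpH.
have : ((4 * pi * H) `^ (- (n%:R / 2)) * (J M * a) <= e' * K)%R.
  apply: ler_pM => //; first exact: powR_ge0.
    by rewrite mulr_ge0.
  by rewrite /K lerDl.
have -> : (e' * K = e / 2)%R by rewrite /e'; field; rewrite gt_eqF.
by lra.
Qed.

(** For times at least 1, [heatK_bound] reduces the derivatives to the kernel
itself. *)
Lemma heatI_correlation_decay i (e : R) : (0 < e)%R ->
  exists A : R, forall h, (A <= h)%R -> (`|heatI i correlation h| <= e)%R.
Proof.
move=> e0; have [C C0 HC] := @heatK_bound R n i.
have [A A0 HA] := correlation_decay (divr_gt0 e0 C0).
exists (Num.max 1 A)%R => h; rewrite ge_max => /andP[h1 hA].
have h0 : (0 < h)%R by exact: lt_le_trans ltr01 h1.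
have h20 : (0 < 2 * h)%R by rewrite mulr_gt0.
have gPhi := gauss_integrable_correlation.
have iK := integrable_heatK i gPhi h0.
have Ch0 : (0 <= C * h `^ (- i%:R))%R by rewrite mulr_ge0 ?powR_ge0// ltW.
rewrite -lee_fin -abse_EFin /heatI /Rintegral fineK; last exact: integrable_fin_num.
apply: le_trans (le_abse_integral (mu n) measurableT (measurable_int _ iK)) _.
apply: (@le_trans _ _ (\int[mu n]_y (C%:E * (gauss (2 * h) y * `|correlation y|)%:E))).
  apply: ge0_le_integral_any => y _ //.
  rewrite abse_EFin -EFinM lee_fin normrM mulrA ler_wpM2r//.
  apply: (le_trans (HC h y h0)); rewrite ler_wpM2r ?gauss_ge0// ler_piMr ?(ltW C0)//.
  by rewrite powRN powR_mulrn ?(ltW h0)// invf_le1 ?exprn_gt0// exprn_ege1.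
rewrite (ge0_integralZl_EFin _ measurableT _ _ (ltW C0)); last 2 first.
- by move=> y _; rewrite lee_fin mulr_ge0 ?gauss_ge0.
- by have /integrableP[] := integrable_gauss gPhi h20.
have : \int[mu n]_y (gauss (2 * h) y * `|correlation y|)%:E <= (e / C)%:E.
  by apply: HA; apply: (le_trans hA); lra.
have C0' : 0 <= C%:E by rewrite lee_fin ltW.
move=> /(lee_wpmul2l C0')/le_trans; apply.
by rewrite -EFinM lee_fin mulrC divfK// gt_eqF.
Qed.

Lemma correlation_zeroE : (correlation (tzero n))%:E = \int[mu n]_x (tail f l x)%:E.
Proof.
rewrite correlationE; apply: eq_integral => x _.
by rewrite tsub0 mul_level_sign.
Qed.

Lemma correlation_zero_ge : (l * a <= correlation (tzero n))%R.
Proof.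
rewrite -lee_fin EFinM aE correlation_zeroE -[X in mu n X]setIT -integral_indic//.
rewrite -(ge0_integralZl_EFin _ measurableT (fun x _ => i0 x) mi (ltW l0)).
apply: ge0_le_integral_any => x _.
  by rewrite mule_ge0// lee_fin ltW.
rewrite -EFinM lee_fin /tail -/E indicE.
case: (boolP (x \in E)) => xE; last by rewrite !mulr0.
by rewrite !mulr1 ltW//; exact: (set_mem xE).
Qed.

(** By invariance [correlation 0] is the integral of [f (x - y)] against the sign at
[x - y]. So the difference involves the change of the sign between [x] and
[x - y], which is controlled where [|f| <= M] by the defects of the two half level
sets, and elsewhere by the tail. *)
Lemma correlation_modulus M (d : R) y : (0 < M)%R ->
  \int[mu n]_x (tail f M x)%:E <= d%:E ->
  (`|correlation y - correlation (tzero n)|)%:E <=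
  M%:E * (translation_defect E1 y + translation_defect E2 y) + 2%:E * d%:E.
Proof.
move=> M0 Md.
pose D (x : T n) : R := (f (tsub x y) * (level_sign x - level_sign (tsub x y)))%R.
have mD : measurable_fun setT (fun x => (D x)%:E : \bar R).
  apply/measurable_EFinP; apply: measurable_funM.
    exact: measurableT_comp mf (mtsub_l y).
  apply: measurable_funB; first exact: measurable_level_sign.
  exact: measurableT_comp measurable_level_sign (mtsub_l y).
have shift0 : (correlation (tzero n))%:E =
    \int[mu n]_x (f (tsub x y) * level_sign (tsub x y))%:E.
  rewrite correlation_zeroE -(tail_translate mf l y).
  by apply: eq_integral => x _; rewrite mul_level_sign.
have ishift : (mu n).-integrable setT (fun x => (f (tsub x y) * level_sign (tsub x y))%:E).
  apply/integrableP; split.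
    apply/measurable_EFinP; apply: measurable_funM.
      exact: measurableT_comp mf (mtsub_l y).
    exact: measurableT_comp measurable_level_sign (mtsub_l y).
  apply: (@le_lt_trans _ _ (\int[mu n]_x (tail f l (tsub x y))%:E)).
    apply: ge0_le_integral_any => x _ //.
    by rewrite mul_level_sign gee0_abs.
  by rewrite tail_translate// tail_fin.
have -> : (`|correlation y - correlation (tzero n)|)%:E = `| \int[mu n]_x (D x)%:E |.
  rewrite -abse_EFin EFinB correlationE shift0.
  rewrite -(integralB_EFin measurableT (integrable_correlation y) ishift).
  apply: (congr1 (@abse R)); apply: eq_integral => x _; rewrite -EFinB /D.
  by rewrite -(mulrBr (f (tsub x y)) (level_sign x)).
apply: le_trans (le_abse_integral (mu n) measurableT mD) _.
have normE (u : R) : 0 <= `|u|%:E by rewrite lee_fin.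
have md A : measurable A -> measurable_fun setT
  (fun x => (`|\1_A (tsub x y) - \1_A x|)%:E : \bar R) by exact: measurable_defect.
apply: (@le_trans _ _ (\int[mu n]_x (M%:E * ((`|\1_E1 (tsub x y) - \1_E1 x|)%:E +
    (`|\1_E2 (tsub x y) - \1_E2 x|)%:E) + 2%:E * (tail f M (tsub x y))%:E))).
  apply: ge0_le_integral_any => x _ //.
  have EE (u v w : R) : M%:E * (u%:E + v%:E) + 2%:E * w%:E = (M * (u + v) + 2 * w)%:E by [].
  rewrite abse_EFin EE lee_fin /D normrM.
  have s1 : (`|level_sign x - level_sign (tsub x y)| <=
     `|\1_E1 (tsub x y) - \1_E1 x| + `|\1_E2 (tsub x y) - \1_E2 x|)%R.
    have -> : (level_sign x - level_sign (tsub x y) =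
       - (\1_E1 (tsub x y) - \1_E1 x) + (\1_E2 (tsub x y) - \1_E2 x))%R.
      by rewrite /level_sign; ring.
    by rewrite (le_trans (ler_normD _ _))// normrN.
  have s2 := norm_level_signB x (tsub x y).
  have fl := le_tail f (tsub x y) (ltW M0).
  apply: (@le_trans _ _ ((M + tail f M (tsub x y)) * `|level_sign x - level_sign (tsub x y)|)%R).
    by rewrite ler_wpM2r.
  rewrite mulrDl; apply: lerD; first by rewrite ler_pM2l.
  by rewrite mulrC ler_wpM2r ?tail_ge0.
rewrite ge0_integralD//; last 4 first.
- by move=> x _; rewrite mule_ge0 ?adde_ge0 ?lee_fin// ltW.
- by apply: emeasurable_funM => //; apply: emeasurable_funD; exact: md.
- by move=> x _; rewrite mule_ge0.
- exact: emeasurable_funM.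
rewrite (ge0_integralZl_EFin _ measurableT _ _ (ltW M0)); last 2 first.
- by move=> x _; rewrite adde_ge0 ?lee_fin.
- by apply: emeasurable_funD; exact: md.
rewrite (ge0_integralD _ measurableT (fun x _ => normE _) (md E1 mE1) (fun x _ => normE _) (md E2 mE2)).
apply: leeD => //.
rewrite (ge0_integralZl_EFin _ measurableT (fun x _ => t0 M (tsub x y)) (mtl M y) (ler0n _ 2)).
by apply: lee_wpmul2l => //; rewrite tail_translate.
Qed.

Lemma correlation_continuous (e : R) : (0 < e)%R -> exists2 d : R, (0 < d)%R &
  forall y, (sqnorm y < d)%R -> (`|correlation y - correlation (tzero n)| <= e)%R.
Proof.
move=> e0; have e40 : (0 < e / 4)%R by rewrite divr_gt0.
have [M M0 HM] := tail_small mf tail_fin e40.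
have eM : (0 < e / (4 * M))%R by rewrite divr_gt0// mulr_gt0.
have sub1 : E1 `<=` E by move=> x /= h; exact: lt_le_trans h (ler_norm _).
have sub2 : E2 `<=` E by move=> x /= h; rewrite /E/= -normrN; exact: lt_le_trans h (ler_norm _).
have E1fin : mu n E1 < +oo by apply: le_lt_trans Efin; apply: le_measure; rewrite ?inE.
have E2fin : mu n E2 < +oo by apply: le_lt_trans Efin; apply: le_measure; rewrite ?inE.
have [d1 d10 H1] := defect_small mE1 E1fin eM.
have [d2 d20 H2] := defect_small mE2 E2fin eM.
exists (Num.min d1 d2); first by rewrite lt_min d10.
move=> y; rewrite lt_min => /andP[y1 y2].
rewrite -lee_fin; apply: (le_trans (correlation_modulus y M0 HM)).
apply: (@le_trans _ _ (M%:E * ((e / (4 * M))%:E + (e / (4 * M))%:E) + 2%:E * (e / 4)%:E)).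
  apply: leeD => //; apply: lee_wpmul2l; first by rewrite lee_fin ltW.
  by apply: leeD; [exact: H1|exact: H2].
have EE (u v w : R) : M%:E * (u%:E + v%:E) + 2%:E * w%:E = (M * (u + v) + 2 * w)%:E by [].
rewrite EE lee_fin le_eqVlt; apply/orP; left; apply/eqP.
by field; rewrite gt_eqF.
Qed.

Lemma heatI_correlation_limit (e : R) : (0 < e)%R -> exists2 d : R, (0 < d)%R &
  forall h, (0 < h < d)%R -> (correlation (tzero n) - e <= `|heatI 0 correlation h|)%R.
Proof.
move=> e0; have e20 : (0 < e / 2)%R by rewrite divr_gt0.
have [d d0 Hd] := correlation_continuous e20.
pose L := correlation (tzero n).
have B0 : (0 <= B)%R by rewrite addr_ge0.
pose K : R := (2 * B / d * (8 * 2 `^ (n%:R / 2)) + 1)%R.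
have K0 : (0 < K)%R.
  by rewrite ltr_wpDl// !mulr_ge0 ?invr_ge0 ?powR_ge0// ltW.
exists (e / (2 * K))%R; first by rewrite divr_gt0// mulr_gt0.
move=> h /andP[h0 hK].
have gPhi := gauss_integrable_correlation.
have gL := @gauss_integrable_cst R n L.
have iPhi : (mu n).-integrable setT (fun y => (gauss h y * correlation y)%:E).
  have := integrable_heatK 0 gPhi h0; apply: eq_integrable => // y _.
  by rewrite heatK0.
have iL : (mu n).-integrable setT (fun y => (gauss h y * L)%:E).
  have := integrable_heatK 0 gL h0; apply: eq_integrable => // y _.
  by rewrite heatK0.
have UE : (heatI 0 correlation h)%:E = \int[mu n]_y (gauss h y * correlation y)%:E.
  rewrite /heatI /Rintegral fineK; last exact: integrable_fin_num (integrable_heatK 0 gPhi h0).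
  by apply: eq_integral => y _; rewrite heatK0.
have LE : L%:E = \int[mu n]_y (gauss h y * L)%:E.
  under eq_integral do rewrite mulrC EFinM.
  rewrite integralZl//; last first.
    by apply/integrableP; split => //; rewrite (eq_integral (fun y => (gauss h y)%:E)) ?integral_gauss ?ltry// => y _; rewrite gee0_abs// lee_fin gauss_ge0.
  by rewrite [X in _ * X]integral_gauss// mule1.
have mw : measurable_fun setT (fun y => (`|correlation y - L|)%:E : \bar R).
  apply/measurable_EFinP; apply: measurableT_comp => //.
  by apply: measurable_funB => //; exact: measurable_correlation.
have diff : (`|heatI 0 correlation h - L|)%:E <=
    \int[mu n]_y ((gauss h y)%:E * (`|correlation y - L|)%:E).
  rewrite -abse_EFin EFinB UE LE -integralB_EFin//.
  apply: le_trans (le_abse_integral _ measurableT _) _.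
    by apply: emeasurable_funB; [have /integrableP[] := iPhi|have /integrableP[] := iL].
  apply: ge0_le_integral_any => y _ //.
  by rewrite -EFinB abse_EFin -mulrBr normrM (ger0_norm (gauss_ge0 _ _)) EFinM.
have wB y : 0 <= (`|correlation y - L|)%:E <= (2 * B)%:E.
  rewrite !lee_fin normr_ge0/= (le_trans (ler_normB _ _))//.
  by have := lerD (correlation_bounded y) (correlation_bounded (tzero n)); rewrite -mulr2n mulr_natl.
have we y : (sqnorm y < d)%R -> (`|correlation y - L|)%:E <= (e / 2)%:E.
  by move=> yd; rewrite lee_fin; exact: Hd.
have := le_trans diff (gauss_average_le mw wB we h0 d0 (ltW e20)).
rewrite lee_fin => hd.
have : (2 * B / d * (8 * h * 2 `^ (n%:R / 2)) <= e / 2)%R.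
  have -> : (2 * B / d * (8 * h * 2 `^ (n%:R / 2)) = (K - 1) * h)%R by rewrite /K; ring.
  apply: (@le_trans _ _ (K * h)%R); first by rewrite ler_pM2r//; lra.
  have -> : (e / 2 = K * (e / (2 * K)))%R by field; rewrite gt_eqF.
  by rewrite ler_pM2l// ltW.
have := ler_norm (L - heatI 0 correlation h)%R; rewrite distrC.
have := ler_norm (heatI 0 correlation h).
by rewrite -/L; lra.
Qed.
End correlation.

Section level_mass.
Context {R : realType}.
Notation mR := (measurableTypeR R).
Notation leb := (@lebesgue_measure R).
Notation Rpos := (`]0%R, +oo[%classic : set (measurableTypeR R)).
Notation T n := (n.-tuple mR).
Notation mu n := (borel_lebesgue R n).
Local Open Scope ereal_scope.

Variables (n : nat) (f : T n -> R) (l : R).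
Hypothesis n_gt0 : (0 < n)%N.
Hypothesis mf : measurable_fun setT f.
Hypothesis tail_fin : forall M, (0 < M)%R -> (\int[mu n]_x (tail f M x)%:E < +oo)%E.
Hypothesis l0 : (0 < l)%R.

Let E : set (T n) := [set x | (l < `|f x|)%R].

(** The heat averages of the correlation tend to [correlation 0 >= l |E|]. *)
Lemma level_mass_le m : (l * fine (mu n E))%:E <=
  \int[leb]_(h in Rpos) ((h `^ (m.+1%:R - 1))%:E * `|heatI m.+1 (correlation f l) h|%:E).
Proof.
apply: (@le_trans _ _ (correlation f l (tzero n))%:E).
  by rewrite lee_fin; exact: correlation_zero_ge.
apply: (@chain_limit_le R (fun i => heatI i (correlation f l))).
- by move=> i h h0; apply: is_derive_heatI => //; exact: gauss_integrable_correlation.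
- by move=> i e e0; exact: heatI_correlation_decay.
- by move=> e e0; exact: heatI_correlation_limit.
Qed.

Lemma measurable_heatI_correlation i : measurable_fun Rpos (heatI i (correlation f l)).
Proof.
apply: (@measurable_chain R (fun i => heatI i (correlation f l))).
by move=> {}i h h0; apply: is_derive_heatI => //; exact: gauss_integrable_correlation.
Qed.

Lemma measurable_heatI_translate i h :
  measurable_fun setT (fun x => heatI i (fun y => f (tsub x y)) h).
Proof.
apply: measurableT_comp => //.
apply: (@measurable_param_integral _ _ _ _ _ (mu n)
  (fun z : T n * T n => (heatK i h z.2 * f (tsub z.1 z.2))%:E)).
apply/measurable_EFinP; apply: measurable_funM.
  exact: measurableT_comp (measurable_heatK _ _) measurable_snd.
by apply: measurableT_comp mf _; exact: measurable_tsub.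
Qed.

(** Fubini's theorem. *)
Lemma heatI_correlation_le i h : (0 < h)%R ->
  (`|heatI i (correlation f l) h|)%:E <=
  \int[mu n]_x (`|heatI i (fun y => f (tsub x y)) h| * \1_E x)%:E.
Proof.
move=> h0.
pose G (z : T n * T n) : \bar R := (heatK i h z.1 * (f (tsub z.2 z.1) * level_sign f l z.2))%:E.
have mG : measurable_fun setT G.
  apply/measurable_EFinP; apply: measurable_funM.
    exact: measurableT_comp (measurable_heatK _ _) measurable_fst.
  apply: measurable_funM; first by apply: measurableT_comp mf _; exact: measurable_tsub.
  exact: measurableT_comp (measurable_level_sign _ mf) measurable_snd.
have gPhi := gauss_integrable_correlation mf tail_fin l0.
have inner y : \int[mu n]_x G (y, x) = (heatK i h y * correlation f l y)%:E.
  rewrite EFinM (correlationE mf tail_fin l0).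
  rewrite -(integralZl measurableT (integrable_correlation mf tail_fin l0 y)).
  by apply: eq_integral => x _; rewrite -EFinM.
have iG : (mu n \x mu n).-integrable setT G.
  apply/(integrable12ltyP _ _ mG).
  set b : R := (fine (mu n E) + fine (\int[mu n]_x (tail f 1 x)%:E))%R.
  have b0 : (0 <= b)%R.
    by rewrite addr_ge0 ?fine_ge0//; apply: integral_ge0 => x _; rewrite lee_fin tail_ge0.
  have /integrableP[mK fK] := integrable_heatK i (@gauss_integrable_cst R n b) h0.
  apply: le_lt_trans fK; apply: ge0_le_integral_any => y _.
    exact: integral_ge0.
  have mc : measurable_fun setT (fun x => (`|f (tsub x y) * level_sign f l x|)%:E : \bar R).
    apply/measurable_EFinP; apply: measurableT_comp => //.
    have /integrableP[/measurable_EFinP] := integrable_correlation mf tail_fin l0 y.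
    by [].
  rewrite (eq_integral (fun x => (`|heatK i h y|)%:E * (`|f (tsub x y) * level_sign f l x|)%:E));
    last by move=> x _; rewrite -EFinM -normrM -abse_EFin.
  have c0 x : setT x -> 0 <= (`|f (tsub x y) * level_sign f l x|)%:E by rewrite lee_fin.
  rewrite (ge0_integralZl_EFin _ measurableT c0 mc (normr_ge0 _)).
  have -> : `|(heatK i h y * b)%:E| = (`|heatK i h y|)%:E * b%:E.
    by rewrite abse_EFin normrM (ger0_norm b0) EFinM.
  by apply: lee_wpmul2l; rewrite ?lee_fin//; exact: correlation_abs_leB.
have := Fubini iG.
rewrite (eq_integral (fun y => (heatK i h y * correlation f l y)%:E)); last by move=> y _; exact: inner.
move=> FE.
have UE : (heatI i (correlation f l) h)%:E = \int[mu n]_x \int[mu n]_y G (y, x).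
  rewrite -FE /heatI /Rintegral fineK//.
  exact: integrable_fin_num (integrable_heatK i gPhi h0).
have VE x : \int[mu n]_y G (y, x) = (heatI i (fun y => f (tsub x y)) h * level_sign f l x)%:E.
  have gx := gauss_integrable_translate mf tail_fin x.
  have iK := integrable_heatK i gx h0.
  have -> : \int[mu n]_y G (y, x) =
      \int[mu n]_y ((heatK i h y * f (tsub x y))%:E * (level_sign f l x)%:E).
    by apply: eq_integral => y _; rewrite -EFinM /G/= mulrA.
  rewrite EFinM {1}/heatI /Rintegral fineK; last exact: integrable_fin_num iK.
 by rewrite -(integralZr measurableT iK).
rewrite -abse_EFin UE.
rewrite (eq_integral (fun x => (heatI i (fun y => f (tsub x y)) h * level_sign f l x)%:E)); last first.
  by move=> x _; exact: VE.
apply: (le_trans (le_abse_integral _ measurableT _)).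
  apply/measurable_EFinP; apply: measurable_funM; first exact: measurable_heatI_translate.
  exact: measurable_level_sign.
apply: ge0_le_integral_any => x _ //.
by rewrite abse_EFin normrM norm_level_sign.
Qed.

End level_mass.

(** * From the completed sigma-algebra to the Borel one *)

Section completion.
Local Open Scope ereal_scope.
Local Open Scope measure_scope.
Context d (T : measurableType d) (R : realType).
Variable m : {sigma_finite_measure set T -> \bar R}.
Notation mo := (mu_ext m).
Notation cT := (caratheodory_type (m^*)%mu).
Notation mc := (@completed_measure_extension _ _ _ m).

Lemma outer_hull (X : set T) : mo X < +oo ->
  exists B : set T, [/\ measurable B, X `<=` B & m B = mo X].
Proof.
move=> Xoo; have Xfin : mo X \is a fin_num by rewrite ge0_fin_numE//; exact: outer_measure_ge0.
have cov k : exists A : (set T)^nat, measurable_cover X A /\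
    \sum_(i <oo) m (A i) < mo X + k.+1%:R^-1%:E.
  have k0 : (0 < k.+1%:R^-1 :> R)%R by rewrite invr_gt0.
  by have [_ [A XA <-] ?] := lb_ereal_inf_adherent k0 Xfin; exists A.
have [A HA] := choice cov.
have mA k i : measurable (A k i) by have [[]] := HA k.
exists (\bigcap_k \bigcup_i A k i).
have mB : measurable (\bigcap_k \bigcup_i A k i).
  by apply: bigcapT_measurable => k; exact: bigcupT_measurable.
have XB : X `<=` \bigcap_k \bigcup_i A k i.
  by move=> x Xx k _; have [[_ H] _] := HA k; exact: H.
split => //; apply/eqP; rewrite eq_le; apply/andP; split; last first.
  by rewrite -(measurable_mu_extE m mB); exact: le_outer_measure.
apply/lee_addgt0Pr => e e0.
have [k ke] : exists k, (k.+1%:R^-1 < e :> R)%R.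
  have [k _ Hk] := near_infty_natSinv_lt (PosNum e0).
  by exists k; exact: Hk (leqnn k).
have [_ Hk] := HA k.
apply: (@le_trans _ _ (m (\bigcup_i A k i))).
  by apply: le_measure; rewrite ?inE//; [exact: bigcupT_measurable|exact: bigcap_inf].
apply: (@le_trans _ _ (\sum_(i <oo) m (A k i))).
  by apply: measure_sigma_subadditive => //; exact: bigcupT_measurable.
by apply: (le_trans (ltW Hk)); rewrite leeD2l// lee_fin ltW.
Qed.

Lemma null_hull (X : set T) : mo X = 0 ->
  exists N : set T, [/\ measurable N, X `<=` N & m N = 0].
Proof. by move=> X0; have [|N] := @outer_hull X; rewrite X0//; exists N. Qed.

Lemma negligible_hull (X : set T) : mc.-negligible X ->
  exists N : set T, [/\ measurable N, X `<=` N & m N = 0].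
Proof.
move=> [A [mA A0 XA]]; apply: null_hull; apply/eqP; rewrite eq_le outer_measure_ge0 andbT.
by rewrite -A0; exact: le_outer_measure.
Qed.

Lemma completed_measureE (A : set T) : measurable A -> mc A = m A.
Proof. exact: measurable_mu_extE. Qed.

Lemma completed_measurable (A : set T) : measurable A -> measurable (A : set cT).
Proof. exact: caratheodory_measurable_mu_ext. Qed.

(** [B] is a measurable hull of [X] and [N] a null hull of its excess over [X]. *)
Lemma caratheodory_borel_fin (X : set T) : measurable (X : set cT) -> mo X < +oo ->
  exists B N : set T, [/\ measurable B, measurable N, m N = 0 &
    forall x, ~ N x -> (X x <-> B x)].
Proof.
move=> mX Xoo; have [B [mB XB BE]] := outer_hull Xoo.
have [|N [mN BN N0]] := @null_hull (B `\` X).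
  have BX : mo B = mo X by rewrite measurable_mu_extE.
  have : mo X = mo X + mo (B `\` X).
    by rewrite -{1}BX; have := mX B; rewrite (setIidr XB) -setDE.
  have XE : mo X = (fine (mo X))%:E by rewrite fineK// ge0_fin_numE// outer_measure_ge0.
  rewrite XE; case: (mo (B `\` X)) => [r| |]//= /eqP; rewrite eqe addrC -subr_eq subrr.
  by move=> /eqP <-.
exists B, N; split => // x Nx; split => [/XB//|Bx].
by apply: contrapT => Xx; apply: Nx; apply: BN.
Qed.

Let null_bigcup (F : (set T)^nat) :
  (forall k, measurable (F k)) -> (forall k, m (F k) = 0) -> m (\bigcup_k F k) = 0.
Proof.
move=> mF F0; apply/negligibleP; first exact: bigcupT_measurable.
by apply: negligible_bigcup => k; exists (F k); split; [exact: mF|exact: F0|exact: subset_refl].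
Qed.

Lemma caratheodory_borel (X : set T) : measurable (X : set cT) ->
  exists B N : set T, [/\ measurable B, measurable N, m N = 0 &
    forall x, ~ N x -> (X x <-> B x)].
Proof.
move=> mX; have [F FT mF] := sigma_finiteT m.
have loc k : exists BN : set T * set T, [/\ measurable BN.1, measurable BN.2, m BN.2 = 0 &
    forall x, ~ BN.2 x -> ((X `&` F k) x <-> BN.1 x)].
  have [mFk Fk] := mF k.
  have [||B [N H]] := @caratheodory_borel_fin (X `&` F k).
  - by apply: measurableI => //; exact: completed_measurable.
  - apply: (@le_lt_trans _ _ (mo (F k))); first by apply: le_outer_measure; exact: subIsetr.
    by rewrite (measurable_mu_extE m mFk).
  - by exists (B, N).
have [BN HBN] := choice loc.
exists (\bigcup_k (BN k).1), (\bigcup_k (BN k).2); split.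
- by apply: bigcupT_measurable => k; have [] := HBN k.
- by apply: bigcupT_measurable => k; have [] := HBN k.
- by apply: null_bigcup => k; have [] := HBN k.
- move=> x Nx; have nN k : ~ (BN k).2 x by move=> h; apply: Nx; exists k.
  split=> [Xx|[k _ Bx]].
    have [k _ Fx] : (\bigcup_k F k) x by rewrite -FT.
    by exists k => //; have [_ _ _ H] := HBN k; apply/(H x (nN k)).
  by have [_ _ _ H] := HBN k; have [] := (H x (nN k)).2 Bx.
Qed.

(** A function is determined by its level sets at rational heights, so countably
many null sets have to be removed. *)
Lemma caratheodory_borel_fun (f : T -> R) : measurable_fun setT (f : cT -> R) ->
  exists (g : T -> R) (N : set T), [/\ measurable_fun setT g, measurable N, m N = 0 &
    forall x, ~ N x -> f x = g x].
Proof.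
move=> mf; pose q (k : nat) : R := ratr (odflt 0%R (unpickle k : option rat)).
have loc k : exists BN : set T * set T, [/\ measurable BN.1, measurable BN.2, m BN.2 = 0 &
    forall x, ~ BN.2 x -> ((q k < f x)%R <-> BN.1 x)].
  have [|B [N H]] := @caratheodory_borel [set x | (q k < f x)%R]; last by exists (B, N).
  rewrite -[X in measurable X]setTI.
  exact: (measurable_fun_ltr (f := cst (q k)) (g := (f : cT -> R))).
have [BN HBN] := choice loc.
pose N := \bigcup_k (BN k).2.
have mN : measurable N by apply: bigcupT_measurable => k; have [] := HBN k.
have NE k x : ~ N x -> ((q k < f x)%R <-> (BN k).1 x).
  by move=> Nx; have [_ _ _] := HBN k; apply => h; apply: Nx; exists k.
exists (f \_ (~` N)), N; split => //.
- apply/(measurable_restrictT _ (measurableC mN)).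
  move=> mNc; apply: (measurability _ (RGenOInfty.measurableE R)) => // _ [_ [x ->] <-].
  rewrite [X in measurable X](_ : _ = ~` N `&` \bigcup_k
      (if (x < q k)%R then (BN k).1 else set0)); last first.
    apply/seteqP; split => y /= [Ny].
      rewrite in_itv/= andbT => xy; split => //.
      have [z] := rat_in_itvoo xy; rewrite in_itv/= => /andP[xz zy].
      have qz : q (pickle z) = ratr z by rewrite /q pickleK.
      by exists (pickle z) => //; rewrite qz xz; apply/(NE _ _ Ny); rewrite qz.
    move=> [k _]; case: ifP => // xk Bk; split => //; rewrite in_itv/= andbT.
    by apply: (lt_trans xk); apply/(NE _ _ Ny).
  apply: measurableI => //; apply: bigcupT_measurable => k.
  by case: ifP => // _; have [] := HBN k.
- by apply: null_bigcup => k; have [] := HBN k.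
- by move=> x Nx; rewrite patchT//; exact/mem_set.
Qed.

Lemma ae_off_null (N : set T) (P : T -> Prop) : measurable N -> m N = 0 ->
  (forall x, ~ N x -> P x) -> {ae mc, forall x, P x}.
Proof.
move=> mN N0 NP; exists N; split; first exact: completed_measurable.
  by rewrite -N0; exact: completed_measureE.
by move=> x /= nP; apply: contrapT => /NP.
Qed.

Let measurable_id_completed : measurable_fun setT (fun x : cT => x : T).
Proof. by move=> _ B mB; rewrite setTI; exact: completed_measurable. Qed.

Lemma measurable_fun_completed d' (U : measurableType d') (F : T -> U) :
  measurable_fun setT F -> measurable_fun setT (F : cT -> U).
Proof. by move=> mF; exact: measurableT_comp mF measurable_id_completed. Qed.

Lemma ge0_integral_completed (F : T -> \bar R) : measurable_fun setT F ->
  (forall x, 0 <= F x) -> \int[mc]_x F x = \int[m]_x F x.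
Proof.
move=> mF F0; apply/esym.
apply: (ge0_integral_image (phi := fun x : cT => x : T)) => // A mA.
exact/esym/completed_measureE.
Qed.

Lemma integral_completed (F : T -> \bar R) : measurable_fun setT F ->
  \int[mc]_x F x = \int[m]_x F x.
Proof.
move=> mF; rewrite integralE [RHS]integralE; congr (_ - _).
- by apply: ge0_integral_completed => //; exact: measurable_funepos.
- by apply: ge0_integral_completed => //; exact: measurable_funeneg.
Qed.

Lemma completed_measure_eq (A B N : set T) : measurable N -> m N = 0 ->
  (forall x, ~ N x -> (A x <-> B x)) -> mc A = mc B.
Proof.
move=> mN N0.
have half (C D : set T) : (forall x, ~ N x -> C x -> D x) -> mo C <= mo D.
  move=> CD; apply: (@le_trans _ _ (mo (D `|` N))).
    apply: le_outer_measure => x Cx; have [Nx|Nx] := pselect (N x); first by right.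
    by left; exact: CD.
  apply: (le_trans (outer_measureU2 _ D N)).
  have /eqP : mo N = 0 by rewrite -N0; exact: measurable_mu_extE.
  rewrite eq_le => /andP[NE _].
  by rewrite -[leRHS]adde0; apply: leeD => //; exact: NE.
move=> AB; apply/eqP; rewrite eq_le; apply/andP; split.
  by apply: half => x Nx /(AB x Nx).
by apply: half => x Nx /(AB x Nx).
Qed.

End completion.

Lemma Lnorm_oo_ae d (T : measurableType d) (R : realType)
    (m : {measure set T -> \bar R}) (F : T -> \bar R) :
  {ae m, forall x, (`|F x| <= 'N[m]_+oo[F])%E}.
Proof.
rewrite unlock /=; case: ifPn => [_|]; first exact: ess_sup_ge.
rewrite -leNgt measure_le0 => /eqP mT.
by exists setT; split => // x _.
Qed.

Section borel_version.
Context {R : realType}.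
Notation mR := (measurableTypeR R).
Notation T n := (n.-tuple mR).
Notation mu n := (borel_lebesgue R n).
Notation cmu n := (lebesgue_Rn R n).
Local Open Scope ereal_scope.

Variables (n : nat) (f : Rn R n -> \bar R) (g : T n -> R) (N : set (T n)).
Hypothesis mf : measurable_fun setT f.
Hypothesis mg : measurable_fun setT g.
Hypothesis mN : measurable N.
Hypothesis N0 : mu n N = 0.
Hypothesis fg : forall x, ~ N x -> f x = (g x)%:E.

Lemma null_reflect x : mu n [set y | N (tsub x y)] = 0.
Proof.
have mi : measurable_fun setT (fun y : T n => (\1_N y)%:E : \bar R).
  by apply/measurable_EFinP; exact: measurable_indic.
have mN' : measurable [set y | N (tsub x y)].
  rewrite -[X in measurable X]setTI.
  by apply: (measurable_tsub (f := cst x) (g := id)) => //; exact: measurable_cst.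
rewrite -[X in mu n X]setIT -integral_indic// -N0 -[X in _ = mu n X]setIT -[RHS]integral_indic//.
exact: (integral_reflect x mi).
Qed.

(** This holds at every [x], since the set of the [y] with [x - y] in [N] is null for
each [x]. The integrand is measurable by completeness. *)
Lemma heat_borelE h x : (0 < h)%R -> heat f h x = heatI 0 (fun y => g (tsub x y)) h.
Proof.
move=> h0; rewrite /heat /heatI /Rintegral; congr fine.
have mG : measurable_fun setT (fun y : T n => (gauss h y * g (tsub x y))%:E : \bar R).
  apply/measurable_EFinP; apply: measurable_funM; first exact: measurable_gauss.
  by apply: measurableT_comp mg _; apply: measurable_tsub => //; exact: measurable_cst.
have mN' : measurable [set y | N (tsub x y)].
  rewrite -[X in measurable X]setTI.
  by apply: (measurable_tsub (f := cst x) (g := id)) => //; exact: measurable_cst.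
have ae : ae_eq (cmu n) setT (fun y : Rn R n => (gauss h y * g (tsub x y))%:E)
    (fun y : Rn R n => (heat_kernel h y)%:E * f (subRn x y)).
  apply: (ae_off_null mN' (null_reflect x)) => y Ny _.
  by rewrite (fg Ny).
have mGc := measurable_fun_completed (m := mu n) mG.
rewrite -(ae_eq_integral _ _ measurableT mGc _ ae); last first.
  exact: (ae_measurable_fun (@measure_is_complete_caratheodory _ _ _) ae mGc).
rewrite (@integral_completed _ _ _ (mu n) _ mG); apply: eq_integral => y _.
by rewrite heatK0.
Qed.

Lemma heat_derivative_borelE m h x :
  (forall x, gauss_integrable (fun y => g (tsub x y))) -> (0 < h)%R ->
  heat_derivative m f h x = heatI m (fun y => g (tsub x y)) h.
Proof.
move=> gi; apply: (@derive1n_heatI R n m _ (heat f ^~ x)) => // h' h'0.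
exact: heat_borelE.
Qed.

Lemma distribution_borelE y :
  distribution_function (cmu n) f y = mu n [set x | (y < `|g x|)%R].
Proof.
have mE : measurable [set x | (y < `|g x|)%R] by exact: measurable_level.
rewrite -(completed_measureE (mu n) mE).
apply: (completed_measure_eq (m := mu n) mN N0) => x Nx /=.
by rewrite fg.
Qed.

Hypothesis fL : class_L1_plus_Loo (cmu n) f.
Hypothesis level_lty : forall y, (0 < y)%R -> mu n [set x | (y < `|g x|)%R] < +oo.

(** Almost everywhere [|g|] is at most an integrable function plus a constant, and
the constant is integrated over a set of finite measure. *)
Lemma tail_integrable M : (0 < M)%R -> \int[mu n]_x (tail g M x)%:E < +oo.
Proof.
move=> M0; have [g1 [g2 [L1 Loo fE]]] := fL.
have mE : measurable [set x | (M < `|g x|)%R] by exact: measurable_level.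
pose e (x : T n) : R := \1_[set x | (M < `|g x|)%R] x.
have e0 x : (0 <= e x)%R by rewrite indic_nneg.
have me : measurable_fun setT (fun x : Rn R n => (e x)%:E : \bar R).
  apply: (measurable_fun_completed (m := mu n) (F := fun x => (e x)%:E)).
  by apply/measurable_EFinP; exact: measurable_indic.
have [K K0 HK] : exists2 K : R, (0 <= K)%R &
    {ae cmu n, forall x, (`|g2 x|)%:E <= K%:E}.
  move: Loo; rewrite inE/= => /andP[_]; rewrite inE/= /finite_norm => Noo.
  exists (fine 'N[cmu n]_+oo[EFin \o g2]); first by rewrite fine_ge0// Lnorm_ge0.
  rewrite fineK ?ge0_fin_numE ?Lnorm_ge0//.
  by have := Lnorm_oo_ae (lebesgue_Rn R n) (EFin \o g2); apply: filterS => x; rewrite abse_EFin.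
have /integrableP[mg1 ig1] := (Lfun1_integrable (cmu n) g1).1 L1.
have mt : measurable_fun setT (fun x : T n => (tail g M x)%:E : \bar R).
  by apply/measurable_EFinP; exact: measurable_tail.
have t0 x : 0 <= (tail g M x)%:E :> \bar R by rewrite lee_fin tail_ge0.
rewrite -(@ge0_integral_completed _ _ _ (mu n) _ mt t0).
have Efin : \int[cmu n]_x (e x)%:E < +oo.
  rewrite (@ge0_integral_completed _ _ _ (mu n) (fun x => (e x)%:E))//.
  - by rewrite integral_indic// setIT level_lty.
  - by apply/measurable_EFinP; exact: measurable_indic.
apply: (@le_lt_trans _ _ (\int[cmu n]_x (`|(g1 x)%:E| + K%:E * (e x)%:E))).
  apply: ae_ge0_le_integral.
  - exact: measurableT.
  - by move=> x _; exact: t0.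
  - exact: (measurable_fun_completed (m := mu n) mt).
  - by move=> x _; apply: adde_ge0; [exact: abse_ge0|rewrite mule_ge0// lee_fin].
  - apply: emeasurable_funD; first exact: measurableT_comp mg1.
    by apply: emeasurable_funM me; exact: measurable_cst.
  have fg' : {ae cmu n, forall x, f x = (g x)%:E} by exact: (ae_off_null mN N0).
  apply: filterS3 fE fg' HK => x fE fgE gK _.
  rewrite abse_EFin -EFinM -EFinD lee_fin /tail.
  move: fE; rewrite fgE => -[->].
  rewrite -/(e x); apply: (@le_trans _ _ ((`|g1 x| + `|g2 x|) * e x)%R).
    by rewrite ler_wpM2r// ler_normD.
  rewrite mulrDl; apply: lerD; first by rewrite ler_piMr// /e indicE lern1 leq_b1.
  by rewrite ler_wpM2r// -lee_fin.
have a0 (x : Rn R n) : setT x -> 0 <= `|(g1 x)%:E| by move=> _; exact: abse_ge0.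
have b0 (x : Rn R n) : setT x -> 0 <= K%:E * (e x)%:E by move=> _; rewrite mule_ge0// lee_fin.
have ma : measurable_fun setT (fun x : Rn R n => `|(g1 x)%:E|).
  exact: measurableT_comp mg1.
have mb : measurable_fun setT (fun x : Rn R n => K%:E * (e x)%:E).
  by apply: emeasurable_funM me; exact: measurable_cst.
rewrite (ge0_integralD _ measurableT a0 ma b0 mb).
rewrite (ge0_integralZl_EFin _ measurableT _ me K0); last by move=> x _; rewrite lee_fin.
by rewrite lte_add_pinfty// lte_mul_pinfty// lee_fin.
Qed.

End borel_version.

(** * Hoelder's inequality on a set of finite measure *)

Section hoelder_on_set.
Local Open Scope ereal_scope.
Context d (T : measurableType d) (R : realType).
Variable m : {measure set T -> \bar R}.

Lemma hoelder_indic (p : \bar R) (F : T -> R) (E : set T) : 1 <= p ->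
  measurable_fun setT F -> measurable E -> m E < +oo ->
  \int[m]_x (`|F x| * \1_E x)%:E <=
  (fine (m E) `^ (1 - fine p^-1))%:E * 'N[m]_p[EFin \o F].
Proof.
move=> p1 mF mE Eoo.
have mFE : measurable_fun setT (fun x => (`|F x|)%:E : \bar R).
  by apply/measurable_EFinP; exact: measurableT_comp.
have mi : measurable_fun setT (fun x => (\1_E x)%:E : \bar R).
  by apply/measurable_EFinP; exact: measurable_indic.
have i0 x : (0 <= \1_E x :> R)%R by rewrite indic_nneg.
have mp : measurable_fun setT (fun x => (`|F x| * \1_E x)%:E : \bar R).
  under eq_fun do rewrite EFinM; exact: emeasurable_funM.
have Efin : m E \is a fin_num by rewrite ge0_fin_numE.
have E0 : (0 <= fine (m E))%R by rewrite fine_ge0.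
case: p p1 => [p|_|//].
  rewrite lee_fin le_eqVlt => /predU1P[<-|p1].
    rewrite inve1 subrr powRr0 mul1e Lnorm1.
    apply: ge0_le_integral_any => x _; first by rewrite lee_fin mulr_ge0.
    by rewrite abse_EFin lee_fin ler_piMr// indicE lern1 leq_b1.
  have p0 : (0 < p)%R by exact: lt_trans p1.
  have pn0 : p != 0%R by rewrite gt_eqF.
  have pm1 : (p - 1 != 0)%R by rewrite subr_eq0 gt_eqF.
  pose q := (p / (p - 1))%R.
  have q0 : (0 < q)%R by rewrite divr_gt0// subr_gt0.
  have qE : (q^-1 = 1 - p^-1)%R by rewrite /q; field; rewrite pn0 pm1.
  have pq : (p^-1 + q^-1 = 1)%R by rewrite qE addrC subrK.
  have H := hoelder m mF (measurable_indic mE) p0 q0 pq.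
  have Nq : 'N[m]_q%:E[EFin \o \1_E] = (fine (m E) `^ (1 - p^-1))%:E.
    rewrite unlock -qE (eq_integral (fun x => (\1_E x)%:E)); last first.
      move=> x _; rewrite /= ger0_norm// indicE.
      by case: (x \in E); rewrite ?powR1// powR0// gt_eqF.
    by rewrite integral_indic// setIT -{1}(fineK Efin).
  rewrite inver (negbTE pn0)/= muleC -Nq; apply: le_trans H.
  rewrite Lnorm1; apply: ge0_le_integral_any => x _; first by rewrite lee_fin mulr_ge0.
  by rewrite /= lee_fin normrM (ger0_norm (i0 x)).
rewrite invey subr0 powRr1//.
set K := 'N[m]_+oo[_].
have K0 : 0 <= K by exact: Lnorm_ge0.
rewrite fineK// -[X in m X]setIT -integral_indic//.
rewrite -ge0_integralZr//.
apply: ae_ge0_le_integral.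
- exact: measurableT.
- by move=> x _; rewrite lee_fin mulr_ge0.
- exact: mp.
- by move=> x _; rewrite mule_ge0// lee_fin.
- by apply: emeasurable_funM mi _; exact: measurable_cst.
have := Lnorm_oo_ae m (EFin \o F); apply: filterS => x H _.
by rewrite EFinM muleC lee_wpmul2l ?lee_fin.
Qed.

End hoelder_on_set.

(** * Rearrangements and the interpolation inequality *)

Section rearrangements.
Context {R : realType}.
Notation mR := (measurableTypeR R).
Notation leb := (@lebesgue_measure R).
Notation Rpos := (`]0%R, +oo[%classic : set (measurableTypeR R)).
Notation T n := (n.-tuple mR).
Notation mu n := (borel_lebesgue R n).
Notation cmu n := (lebesgue_Rn R n).
Local Open Scope ereal_scope.

Lemma borel_version n (f : Rn R n -> \bar R) : class_S0 (cmu n) f ->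
  exists (g : T n -> R) (N : set (T n)), [/\ measurable_fun setT g, measurable N,
    mu n N = 0 & forall x, ~ N x -> f x = (g x)%:E].
Proof.
move=> [mf ff _].
have mff : measurable_fun setT (fine \o f : Rn R n -> R).
  exact: measurableT_comp mf.
have [g [N1 [mg mN1 N10 fg]]] := caratheodory_borel_fun mff.
have [N2 [mN2 fN2 N20]] := negligible_hull ff.
exists g, (N1 `|` N2); split => //; first exact: measurableU.
  apply/negligibleP; first exact: measurableU.
  by apply: negligibleU; [exists N1|exists N2]; split => //; exact: subset_refl.
move=> x Nx; have [n1 n2] : ~ N1 x /\ ~ N2 x by split => h; apply: Nx; [left|right].
rewrite -(fg x n1) /= fineK//; apply: contrapT => nf; apply: n2; exact: fN2.
Qed.

Lemma rearrangement_gt d (S : measurableType d) (m : {measure set S -> \bar R})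
    (f : S -> \bar R) (t y : R) : (0 < y)%R ->
  y%:E < rearrangement m f t -> t%:E <= distribution_function m f y.
Proof.
move=> y0 yt; rewrite leNgt; apply/negP => H.
suff : rearrangement m f t <= y%:E by rewrite leNgt yt.
by apply: ereal_inf_lbound; exists y.
Qed.

Lemma rearrangement_ge0 d (S : measurableType d) (m : {measure set S -> \bar R})
    (f : S -> \bar R) (t : R) : 0 <= rearrangement m f t.
Proof. by apply: le_ereal_inf_tmp => _ [y [y0 _] <-]; rewrite lee_fin ltW. Qed.

Lemma rearrangement_nonincreasing d (S : measurableType d)
    (m : {measure set S -> \bar R}) (f : S -> \bar R) (t u : R) : (t <= u)%R ->
  rearrangement m f u <= rearrangement m f t.
Proof.
move=> tu; apply: le_ereal_inf_tmp => _ [y [y0 yt] <-].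
apply: ereal_inf_lbound; exists y => //; split => //.
by apply: (lt_le_trans yt); rewrite lee_fin.
Qed.

End rearrangements.

Section heat_level_sets.
Context {R : realType}.
Notation mR := (measurableTypeR R).
Notation leb := (@lebesgue_measure R).
Notation Rpos := (`]0%R, +oo[%classic : set (measurableTypeR R)).
Notation T n := (n.-tuple mR).
Notation mu n := (borel_lebesgue R n).
Notation cmu n := (lebesgue_Rn R n).
Local Open Scope ereal_scope.

Variables (n m : nat) (f : Rn R n -> \bar R).
Hypothesis n_gt0 : (0 < n)%N.
Hypothesis f0 : class_S0 (cmu n) f.
Hypothesis fL : class_L1_plus_Loo (cmu n) f.

Lemma borel_version_tail : exists (g : T n -> R) (N : set (T n)),
  [/\ measurable_fun setT g, measurable N, mu n N = 0,
      forall x, ~ N x -> f x = (g x)%:E &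
      forall M, (0 < M)%R -> \int[mu n]_x (tail g M x)%:E < +oo].
Proof.
have [mf _ fS] := f0; have [g [N [mg mN N0 fg]]] := borel_version f0.
exists g, N; split => // M M0.
apply: (tail_integrable mg mN N0 fg fL) => // y y0.
by rewrite -(distribution_borelE mg mN N0 fg); exact: fS.
Qed.

(** Markov's inequality: the measure of the set where [|f| > y] is [O(1 / y)]. *)
Lemma rearrangement_lty t : (0 < t)%R -> rearrangement (cmu n) f t < +oo.
Proof.
move=> t0; have [g [N [mg mN N0 fg tg]]] := borel_version_tail.
pose K := fine (\int[mu n]_x (tail g 1 x)%:E).
have I0 : 0 <= \int[mu n]_x (tail g 1 x)%:E.
  by apply: integral_ge0 => x _; rewrite lee_fin tail_ge0.
have KE : K%:E = \int[mu n]_x (tail g 1 x)%:E.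
  by rewrite fineK// ge0_fin_numE// tg.
have K0 : (0 <= K)%R by rewrite fine_ge0.
pose y : R := (1 + K / t)%R.
have y1 : (1 <= y)%R by rewrite lerDl divr_ge0// ltW.
have y0 : (0 < y)%R by exact: lt_le_trans y1.
apply: (@le_lt_trans _ _ y%:E); last exact: ltry.
apply: ereal_inf_lbound; exists y => //; split => //.
rewrite (distribution_borelE mg mN N0 fg).
have H : y%:E * mu n [set x | (y < `|g x|)%R] <= K%:E.
  rewrite KE; apply: (le_trans (markov_tail mg y0)).
  apply: ge0_le_integral_any => x _; rewrite lee_fin; first exact: tail_ge0.
  exact: tail_nonincreasing.
have Efin : mu n [set x | (y < `|g x|)%R] \is a fin_num.
  by rewrite ge0_fin_numE//; exact: (level_fin mg tg y0).
move: H; rewrite -(fineK Efin) -EFinM lee_fin lte_fin => H.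
have : (y * fine (mu n [set x | (y < `|g x|)%R]) < y * t)%R.
  apply: (le_lt_trans H); rewrite /y mulrDl mul1r divfK ?gt_eqF//.
  by rewrite ltrDr.
by rewrite ltr_pM2l.
Qed.

(** Here [v h] is the size of the time derivative of the heat average of the
correlation at level [y], divided by the measure of the level set, which is at
least [t]. The same [v] serves all the exponents [p]. *)
Lemma heat_level_bound (t y : R) : (0 < t)%R -> (0 < y)%R ->
  y%:E < rearrangement (cmu n) f t ->
  exists v : R -> R, [/\ measurable_fun Rpos v, forall h, (0 < h)%R -> (0 <= v h)%R,
    forall p, 1 <= p -> forall h, (0 < h)%R -> (v h)%:E <=
      (t `^ (- fine p^-1))%:E * 'N[cmu n]_p[EFin \o heat_derivative m.+1 f h] &
    y%:E <= \int[leb]_(h in Rpos) ((h `^ (m.+1%:R - 1))%:E * (v h)%:E)].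
Proof.
move=> t0 y0 yt; have [g [N [mg mN N0 fg tg]]] := borel_version_tail.
have := rearrangement_gt y0 yt; rewrite (distribution_borelE mg mN N0 fg).
set E := [set x | (y < `|g x|)%R]; pose a := fine (mu n E).
have mE : measurable E by exact: measurable_level.
have Eoo : mu n E < +oo by exact: (level_fin mg tg y0).
have aE : a%:E = mu n E by rewrite fineK// ge0_fin_numE.
rewrite -aE lee_fin => ta.
have a0 : (0 < a)%R by exact: lt_le_trans ta.
pose V h : R := `|heatI m.+1 (correlation g y) h|%R.
have mV : measurable_fun Rpos V.
  by apply: measurableT_comp => //; exact: measurable_heatI_correlation.
exists (fun h => (V h / a)%R); split.
- exact: measurable_funM.
- by move=> h h0; rewrite divr_ge0 ?normr_ge0 ?(ltW a0).
- move=> p p1 h h0; pose D := heat_derivative m.+1 f h.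
  have DE x : D x = heatI m.+1 (fun z => g (tsub x z)) h.
    apply: (heat_derivative_borelE mg mN N0 fg) => // {}x.
    exact: gauss_integrable_translate.
  have mD : measurable_fun setT (D : T n -> R).
    have -> : (D : T n -> R) = (fun x => heatI m.+1 (fun z => g (tsub x z)) h) by exact/funext.
    exact: measurable_heatI_translate.
  have mEc : measurable (E : set (Rn R n)) := completed_measurable (mu n) mE.
  have cE : cmu n E = mu n E := completed_measureE (mu n) mE.
  have cEoo : cmu n E < +oo by rewrite cE.
  have mDc := measurable_fun_completed (m := mu n) mD.
  have VN : (V h)%:E <= (a `^ (1 - fine p^-1))%:E * 'N[cmu n]_p[EFin \o D].
    rewrite /a -cE; apply: le_trans (hoelder_indic p1 mDc mEc cEoo).
    apply: (le_trans (heatI_correlation_le mg tg y0 m.+1 h0)).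
    have mDE : measurable_fun setT (fun x : T n => (`|D x| * \1_E x)%:E : \bar R).
      apply/measurable_EFinP; apply: measurable_funM; last exact: measurable_indic.
      exact: measurableT_comp.
    rewrite (@ge0_integral_completed _ _ _ (mu n) _ mDE); last first.
      by move=> x; rewrite lee_fin mulr_ge0.
    by rewrite le_eqVlt; apply/orP; left; apply/eqP; apply: eq_integral => x _; rewrite DE.
  have [al alE /andP[al0 _]] := inve_ge1_fin p1; rewrite alE/= in VN *.
  apply: (@le_trans _ _ ((a `^ (- al))%:E * 'N[cmu n]_p[EFin \o D])).
    rewrite EFinM muleC.
    have -> : (a `^ (- al) = a^-1 * a `^ (1 - al))%R.
      have e : (- al = -1 + (1 - al))%R by ring.
      by rewrite [in LHS]e powRD ?(gt_eqF a0) ?implybT// powR_inv1 ?(ltW a0).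
    by rewrite EFinM -muleA lee_wpmul2l// lee_fin invr_ge0 ltW.
  apply: lee_wpmul2r; first exact: Lnorm_ge0.
  rewrite lee_fin !powRN lef_pV2 ?posrE ?powR_gt0//.
  by apply: ge0_ler_powR => //; rewrite nnegrE ltW.
- have := @level_mass_le R n g y n_gt0 mg tg y0 m; rewrite -/E -/a => H.
  rewrite -(@lee_pmul2l _ a%:E)// -EFinM mulrC; apply: (le_trans H).
  rewrite -ge0_integralZl_EFin//; last 3 first.
  - by move=> h _; rewrite -EFinM lee_fin mulr_ge0 ?powR_ge0// divr_ge0 ?normr_ge0// ltW.
  - apply: emeasurable_funM; first exact: measurable_weight.
    by apply/measurable_EFinP; exact: measurable_funM.
  - exact: ltW.
  rewrite le_eqVlt; apply/orP; left; apply/eqP; apply: eq_integral => h _.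
  by rewrite -!EFinM /V; congr EFin; field; rewrite gt_eqF.
Qed.

End heat_level_sets.

Unset Implicit Arguments.

Theorem theorem6p3 (R : realType) (n m : nat) (p1 p2 q1 q2 p q : \bar R)
    (r s theta : R) (n_gt0 : (0 < n)%N)
    (p1_ge1 : (1 <= p1)%E) (p2_ge1 : (1 <= p2)%E)
    (q1_ge1 : (1 <= q1)%E) (q2_ge1 : (1 <= q2)%E)
    (r_gt0 : 0 < r) (s_lt0 : s < 0) (p1_neq_p2 : p1 <> p2)
    (r_lt_2m : r < 2 * m%:R)
    (theta_def : theta = r / (r - s))
    (p_def : (p^-1 = (1 - theta)%:E * p1^-1 + theta%:E * p2^-1)%E)
    (q_def : (q^-1 = (1 - theta)%:E * q1^-1 + theta%:E * q2^-1)%E) :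
  exists c : R, 0 < c /\
    forall f : Rn R n -> \bar R,
      class_S0 (lebesgue_Rn R n) f -> class_L1_plus_Loo (lebesgue_Rn R n) f ->
      (lorentz_norm (lebesgue_Rn R n) p q f <=
         c%:E * besov_norm m r p1 q1 f `^ (1 - theta) *
                besov_norm m s p2 q2 f `^ theta)%E.
Proof.
case: m r_lt_2m => [|m] r_lt_2m.
  by move: (lt_trans r_gt0 r_lt_2m); rewrite mulr0 ltxx.
have [al1 al1E /andP[al1_ge0 _]] := inve_ge1_fin p1_ge1.
have [al2 al2E /andP[al2_ge0 _]] := inve_ge1_fin p2_ge1.
have al12 : al1 != al2.
  by apply/eqP => e; apply: p1_neq_p2; apply: (can_inj inveK); rewrite al1E al2E e.
have pE : fine p^-1 = (1 - theta) * al1 + theta * al2 by rewrite p_def al1E al2E.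
have [c c0 Hc] := profile_interpolation m.+1%:R al12 al1_ge0 al2_ge0 r_gt0 s_lt0
  theta_def q1_ge1 q2_ge1 q_def.
exists c; split => // f f0 fL.
pose Nf p h := ('N[lebesgue_Rn R n]_p[EFin \o heat_derivative m.+1 f h])%E.
have -> : lorentz_norm (lebesgue_Rn R n) p q f =
    lorentz_profile ((1 - theta) * al1 + theta * al2) q
      (rearrangement (lebesgue_Rn R n) f) by rewrite -pE.
apply: (Hc _ (Nf p1) (Nf p2)).
- by move=> t t0; rewrite rearrangement_ge0 rearrangement_lty.
- by move=> t u _; exact: rearrangement_nonincreasing.
- by move=> h _; exact: Lnorm_ge0.
- by move=> h _; exact: Lnorm_ge0.
move=> t y t0 y0 yt.
have [v [mv v0 vN vy]] := heat_level_bound m n_gt0 f0 fL t0 y0 yt.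
exists v; split => // h h0.
- by have := vN p1 p1_ge1 h h0; rewrite al1E.
- by have := vN p2 p2_ge1 h h0; rewrite al2E.
Qed.
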